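(* Let $p\ge 2$ and $q$ be coprime integers, $I_1,I_3>0$, $\eta=I_1/I_3-1$, and consider $L(p;q)$ with the Berger metric and base point $o=\Pi(\mathrm{id})$. Let $$\partial L=\Big\{(q_0,q_1,q_2,q_3)\in S^3:\ q_0\sin\tfrac{\pi}{p}=|q_3|\cos\tfrac{\pi}{p}\Big\},\qquad J=\Big\{(q_0,0,0,q_3)\in S^3:\ q_0\ge0,\ \sin(\pi|\eta|)\le|q_3|\le\sin\tfrac{\pi}{p}\Big\}.$$ Then the cut locus $\mathrm{Cut}_o$ of $o$ in $L(p;q)$ is: (a) $\Pi(\partial L)$ if $\eta\ge-\frac{p-1}{p}$; (b) $\Pi(\partial L)\cup\Pi(J)$ if $-1<\eta<-\frac{p-1}{p}$. In this case $\Pi(J)$ is an arc (the two points $(\cos\frac\pi p,0,0,\pm\sin\frac\pi p)$ of $\partial L$ being identified under $\Pi$), attached to the two-dimensional set $\Pi(\partial L)$ at a single point.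
   Context: Identify $S^3=\{(z,w)\in\mathbb{C}^2:|z|^2+|w|^2=1\}$ with $\mathrm{SU}_2$ via $(z,w)\mapsto\begin{pmatrix} z& w\\ -\bar w&\bar z\end{pmatrix}$, write $z=q_0+iq_3$, $w=q_1+iq_2$. The basis of $\mathfrak{su}_2$ is $e_1=\frac12\begin{pmatrix}0&1\\-1&0\end{pmatrix}$, $e_2=\frac12\begin{pmatrix}0&i\\ i&0\end{pmatrix}$, $e_3=\frac12\begin{pmatrix}i&0\\0&-i\end{pmatrix}$. The metric $g$ is the left-invariant metric on $\mathrm{SU}_2$ equal to $I_1u_1^2+I_1u_2^2+I_3u_3^2$ at the identity on $u_1e_1+u_2e_2+u_3e_3$; it is invariant under the $\mathbb{Z}_p$-action $[k]\cdot(z,w)=(e^{2\pi ik/p}z,e^{2\pi ikq/p}w)$, so it descends to the lens space $L(p;q)=S^3/\mathbb{Z}_p$ (projection $\Pi:S^3\to L(p;q)$); this is the Berger metric on $L(p;q)$. The point $o=\Pi(\mathrm{id})$ with $\mathrm{id}=(1,0)$. The cut locus $\mathrm{Cut}_o$ is the set of points $\Pi\circ\gamma(t_{\mathrm{cut}})$ over all unit-speed geodesics $\gamma$ from $o$, where $t_{\mathrm{cut}}$ is the time after which $\gamma$ ceases to be length-minimizing. ($\partial L$ is the boundary of the fundamental domain $\{q_0\ge0,\ q_1^2+q_2^2+q_3^2/\sin^2\frac\pi p\le1\}$ of the $\mathbb{Z}_p$-action.) *)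

(* Defs.v *)
From Stdlib Require Import Reals ZArith Lra.
From Coquelicot Require Import Coquelicot.
Open Scope R_scope.

(** Points of R^4, read as quaternion coordinates (q0,q1,q2,q3),
    z = q0 + i q3, w = q1 + i q2. *)
Record P4 := mkP4 { qc0 : R; qc1 : R; qc2 : R; qc3 : R }.

Definition onS3 (x : P4) : Prop :=
  qc0 x ^ 2 + qc1 x ^ 2 + qc2 x ^ 2 + qc3 x ^ 2 = 1.

Definition idP : P4 := mkP4 1 0 0 0.

(** Z_p action [k].(z,w) = (e^{2 pi i k/p} z, e^{2 pi i k q/p} w) *)
Definition act (p q k : Z) (x : P4) : P4 :=
  let th := 2 * PI * IZR k / IZR p in
  let ph := 2 * PI * IZR (k * q) / IZR p in
  mkP4 (cos th * qc0 x - sin th * qc3 x)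
       (cos ph * qc1 x - sin ph * qc2 x)
       (sin ph * qc1 x + cos ph * qc2 x)
       (sin th * qc0 x + cos th * qc3 x).

(** y and x lie in the same Z_p-orbit, i.e. Pi y = Pi x *)
Definition sameorbit (p q : Z) (y x : P4) : Prop := exists k : Z, x = act p q k y.

(** Under the identification, the quaternion units i,j,k correspond to
    2e1, 2e2, 2e3.  For x in S^3 and a tangent vector v at x, x^{-1} v = conj(x) v
    is the pure quaternion a1 i + a2 j + a3 k = u1 e1 + u2 e2 + u3 e3 with u = 2a.
    The Berger metric gives |v|^2 = I1 u1^2 + I1 u2^2 + I3 u3^2. *)
Definition speed2 (I1 I3 : R) (x v : P4) : R :=
  let a1 := qc0 x * qc1 v - qc1 x * qc0 v - qc2 x * qc3 v + qc3 x * qc2 v in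
  let a2 := qc0 x * qc2 v - qc2 x * qc0 v - qc3 x * qc1 v + qc1 x * qc3 v in
  let a3 := qc0 x * qc3 v - qc3 x * qc0 v - qc1 x * qc2 v + qc2 x * qc1 v in
  I1 * (2 * a1) ^ 2 + I1 * (2 * a2) ^ 2 + I3 * (2 * a3) ^ 2.

Definition C1curve (c : R -> P4) : Prop :=
  forall t,
    ex_derive (fun s => qc0 (c s)) t /\ continuous (Derive (fun s => qc0 (c s))) t /\
    ex_derive (fun s => qc1 (c s)) t /\ continuous (Derive (fun s => qc1 (c s))) t /\
    ex_derive (fun s => qc2 (c s)) t /\ continuous (Derive (fun s => qc2 (c s))) t /\
    ex_derive (fun s => qc3 (c s)) t /\ continuous (Derive (fun s => qc3 (c s))) t.

Definition velocity (c : R -> P4) (t : R) : P4 :=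
  mkP4 (Derive (fun s => qc0 (c s)) t) (Derive (fun s => qc1 (c s)) t)
       (Derive (fun s => qc2 (c s)) t) (Derive (fun s => qc3 (c s)) t).

Definition speed (I1 I3 : R) (c : R -> P4) (t : R) : R :=
  sqrt (speed2 I1 I3 (c t) (velocity c t)).

Definition len (I1 I3 : R) (c : R -> P4) (a b : R) : R :=
  RInt (speed I1 I3 c) a b.

Definition admissible (c : R -> P4) (a b : R) (x y : P4) : Prop :=
  a <= b /\ C1curve c /\ (forall t, a <= t <= b -> onS3 (c t)) /\ c a = x /\ c b = y.

(** gamma restricted to [0,t] is length-minimizing in L(p;q) between o and
    Pi(gamma t): no curve in S^3 from id to any lift of Pi(gamma t) is shorter. *)
Definition minimizingL (p q : Z) (I1 I3 : R) (g : R -> P4) (t : R) : Prop :=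
  forall (k : Z) (c : R -> P4) (a b : R),
    admissible c a b idP (act p q k (g t)) -> len I1 I3 g 0 t <= len I1 I3 c a b.

(** unit-speed geodesic from id (equivalently, lift of one from o):
    a C^1 unit-speed curve in S^3 which is locally length-minimizing. *)
Definition unit_geodesic (I1 I3 : R) (g : R -> P4) : Prop :=
  C1curve g /\ g 0 = idP /\
  (forall t, 0 <= t -> onS3 (g t)) /\
  (forall t, 0 <= t -> speed I1 I3 g t = 1) /\
  (forall t0, 0 <= t0 -> exists eps, 0 < eps /\
     forall s1 s2, 0 <= s1 -> s1 <= s2 -> t0 - eps < s1 -> s2 < t0 + eps ->
       forall c a b, admissible c a b (g s1) (g s2) ->
         len I1 I3 g s1 s2 <= len I1 I3 c a b).

Definition cutTime (p q : Z) (I1 I3 : R) (g : R -> P4) (T : R) : Prop :=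
  0 <= T /\ (forall t, 0 <= t <= T -> minimizingL p q I1 I3 g t) /\
  (forall t, T < t -> ~ minimizingL p q I1 I3 g t).

Definition inCut (p q : Z) (I1 I3 : R) (x : P4) : Prop :=
  exists g T, unit_geodesic I1 I3 g /\ cutTime p q I1 I3 g T /\ sameorbit p q (g T) x.

Definition inPi (p q : Z) (S : P4 -> Prop) (x : P4) : Prop :=
  exists y, S y /\ sameorbit p q y x.

Definition dL (p : Z) (x : P4) : Prop :=
  onS3 x /\ qc0 x * sin (PI / IZR p) = Rabs (qc3 x) * cos (PI / IZR p).

Definition Jset (p : Z) (eta : R) (x : P4) : Prop :=
  onS3 x /\ qc1 x = 0 /\ qc2 x = 0 /\ 0 <= qc0 x /\
  sin (PI * Rabs eta) <= Rabs (qc3 x) <= sin (PI / IZR p).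

(* Main.v *)
Require Import Defs.
From Stdlib Require Import Reals ZArith Lra Lia Psatz.
From Coquelicot Require Import Coquelicot.
Open Scope R_scope.

(** For a curve [c] in S^3 put [a = c^{-1} c'] and let [theta] be any function vanishing at
    the start. The rotated curve [c e^{-theta k}] has round speed
    [N = sqrt (a1^2 + a2^2 + (a3 - theta')^2)], so [cos (int N)] is at most its final height.
    When [eta > 0] the Berger metric is the Riemannian quotient of (round S^3) x R, and the
    horizontal [theta] turns this into a lower bound for Berger length; when [eta <= 0] the
    product is Lorentzian, and [theta' = beta N] does the same. In both cases one-variable
    trigonometry shows that the explicit geodesic [exp(t M) exp(t eta m3 k)] is shortest in
    the lens space as long as [|arg z| <= pi/p] and its parameter [tau] is at most [pi].

    Past that point it is not: on the wall [|arg z| = pi/p] it meets the mirror image of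
    itself, and at [tau = pi] all geodesics with the same [s] meet, so that a corner can be
    cut off; only the fibre ([s = 1]) needs a direct comparison. Conversely every locally
    shortest curve is explicit: variations along the Killing fields of left translations
    show that the momentum is conserved, which makes the geodesic equation linear. *)

(** * Continuous functions and integrals on the line *)

(** With [a = c^{-1} c'] the squared Berger speed is [4 I1 (a1^2 + a2^2 + a3^2 / (1 + eta))], and
    the bracket is the extremum over [theta'] of [N^2 + theta'^2 / eta]: a minimum for [eta > 0], a
    maximum for [eta < 0]. This sign splits the lower bound in two. For [eta > 0] the minimizing
    [theta'] is dictated by the curve, so its total is an unknown that has to be charged to the
    length. For [eta < 0] every [theta'] bounds the speed from below, and [theta' = beta N] ties the
    total to the round length, leaving one unknown. All lower bounds read only the coordinate z of
    the endpoint. An orbit rotates z by multiples of [2 pi / p], so minimality in the lens space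
    reduces to comparing cosines of arguments. For [0 < s <= 1] the argument of z runs continuously
    from 0 to [pi (1 + eta s)] while [tau] runs from 0 to [pi]; hence [tau = pi] can come before the
    wall only if [1 + eta < 1 / p], which is the threshold of the theorem. *)

Definition ctn (f : R -> R) : Prop := forall t, continuous f t.

Lemma ctn_const (k : R) : ctn (fun _ => k).
Proof. intros t; apply continuous_const. Qed.

Lemma ctn_id : ctn (fun t => t).
Proof. intros t; apply continuous_id. Qed.

Lemma ctn_plus (f g : R -> R) : ctn f -> ctn g -> ctn (fun t => f t + g t).
Proof. intros Hf Hg t; exact (continuous_plus f g t (Hf t) (Hg t)). Qed.

Lemma ctn_opp (f : R -> R) : ctn f -> ctn (fun t => - f t).
Proof. intros Hf t; exact (continuous_opp f t (Hf t)). Qed.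

Lemma ctn_minus (f g : R -> R) : ctn f -> ctn g -> ctn (fun t => f t - g t).
Proof. intros Hf Hg t; exact (continuous_minus f g t (Hf t) (Hg t)). Qed.

Lemma ctn_mult (f g : R -> R) : ctn f -> ctn g -> ctn (fun t => f t * g t).
Proof. intros Hf Hg t; exact (continuous_mult f g t (Hf t) (Hg t)). Qed.

Lemma ctn_pow (f : R -> R) (n : nat) : ctn f -> ctn (fun t => f t ^ n).
Proof.
  intros Hf; induction n as [|n IH]; simpl.
  - apply ctn_const.
  - now apply ctn_mult.
Qed.

Lemma ctn_comp (g f : R -> R) : ctn f -> ctn g -> ctn (fun t => g (f t)).
Proof. intros Hf Hg t; exact (continuous_comp f g t (Hf t) (Hg (f t))). Qed.

Lemma ctn_sqrt (f : R -> R) : ctn f -> ctn (fun t => sqrt (f t)).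
Proof. intros Hf; apply (ctn_comp sqrt f Hf); intros t; apply continuous_sqrt. Qed.

Lemma ctn_abs (f : R -> R) : ctn f -> ctn (fun t => Rabs (f t)).
Proof. intros Hf; apply (ctn_comp Rabs f Hf); intros t; apply continuous_Rabs. Qed.

Lemma ctn_cos (f : R -> R) : ctn f -> ctn (fun t => cos (f t)).
Proof. intros Hf; apply (ctn_comp cos f Hf); intros t; apply continuous_cos. Qed.

Lemma ctn_sin (f : R -> R) : ctn f -> ctn (fun t => sin (f t)).
Proof. intros Hf; apply (ctn_comp sin f Hf); intros t; apply continuous_sin. Qed.

Lemma ctn_derive (f df : R -> R) : (forall t, is_derive f t (df t)) -> ctn f.
Proof. intros H t; apply (ex_derive_continuous f t); eexists; apply H. Qed.

Lemma ctn_continuity (f : R -> R) : ctn f -> continuity f.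
Proof. intros H t; apply continuity_pt_filterlim, H. Qed.

Ltac cts := first [ assumption | lazymatch goal with
  | |- ctn (fun t => t) => apply ctn_id
  | |- ctn (fun _ => ?k) => apply ctn_const
  | |- ctn (fun t => @?f t + @?g t) => apply (ctn_plus f g); cts
  | |- ctn (fun t => @?f t - @?g t) => apply (ctn_minus f g); cts
  | |- ctn (fun t => @?f t * @?g t) => apply (ctn_mult f g); cts
  | |- ctn (fun t => @?f t / ?k) => apply (ctn_mult f (fun _ => / k)); cts
  | |- ctn (fun t => - @?f t) => apply (ctn_opp f); cts
  | |- ctn (fun t => @?f t ^ ?n) => apply (ctn_pow f n); cts
  | |- ctn (fun t => sqrt (@?f t)) => apply (ctn_sqrt f); cts
  | |- ctn (fun t => Rabs (@?f t)) => apply (ctn_abs f); cts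
  | |- ctn (fun t => cos (@?f t)) => apply (ctn_cos f); cts
  | |- ctn (fun t => sin (@?f t)) => apply (ctn_sin f); cts
  | _ => idtac
  end ].

(** * Rules for derivatives *)

Lemma der_plus (f g : R -> R) (t a b : R) : is_derive f t a -> is_derive g t b ->
  is_derive (fun u => f u + g u) t (a + b).
Proof. intros H K; exact (is_derive_plus f g t a b H K). Qed.

Lemma der_minus (f g : R -> R) (t a b : R) : is_derive f t a -> is_derive g t b ->
  is_derive (fun u => f u - g u) t (a - b).
Proof. intros H K; exact (is_derive_minus f g t a b H K). Qed.

Lemma der_opp (f : R -> R) (t a : R) : is_derive f t a -> is_derive (fun u => - f u) t (- a).
Proof. intros H; exact (is_derive_opp f t a H). Qed.

Lemma der_mult (f g : R -> R) (t a b : R) : is_derive f t a -> is_derive g t b ->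
  is_derive (fun u => f u * g u) t (a * g t + f t * b).
Proof.
  intros H K; apply is_derive_Reals.
  exact (derivable_pt_lim_mult f g t a b (proj1 (is_derive_Reals _ _ _) H)
           (proj1 (is_derive_Reals _ _ _) K)).
Qed.

Lemma der_const (k t : R) : is_derive (fun _ => k) t 0.
Proof. exact (is_derive_const (V := R_NormedModule) k t). Qed.

Lemma der_id (t : R) : is_derive (fun u => u) t 1.
Proof. exact (is_derive_id (K := R_AbsRing) t). Qed.

Lemma der_comp (g f : R -> R) (t a b : R) : is_derive g (f t) b -> is_derive f t a ->
  is_derive (fun u => g (f u)) t (a * b).
Proof. intros H K; exact (is_derive_comp g f t b a H K). Qed.

Lemma der_cos (f : R -> R) (t a : R) : is_derive f t a ->
  is_derive (fun u => cos (f u)) t (a * - sin (f t)).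
Proof. apply der_comp, is_derive_cos. Qed.

Lemma der_sin (f : R -> R) (t a : R) : is_derive f t a ->
  is_derive (fun u => sin (f u)) t (a * cos (f t)).
Proof. apply der_comp, is_derive_sin. Qed.

Lemma der_sqr (f : R -> R) (t a : R) : is_derive f t a ->
  is_derive (fun u => f u ^ 2) t (2 * f t * a).
Proof.
  intros H. replace (2 * f t * a) with (a * f t + f t * a) by ring.
  apply (is_derive_ext (fun u => f u * f u)); [intros u; change (f u * f u = f u ^ 2); ring|].
  now apply der_mult.
Qed.

Lemma der_eq (f : R -> R) (t a b : R) : is_derive f t a -> a = b -> is_derive f t b.
Proof. now intros H <-. Qed.

Ltac der_go := first [ eassumption | lazymatch goal with
  | |- is_derive (fun t => t) _ _ => apply der_id
  | |- is_derive (fun _ => ?k) _ _ => apply der_const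
  | |- is_derive (fun t => @?f t + @?g t) _ _ => eapply (der_plus f g); der_go
  | |- is_derive (fun t => @?f t - @?g t) _ _ => eapply (der_minus f g); der_go
  | |- is_derive (fun t => @?f t * @?g t) _ _ => eapply (der_mult f g); der_go
  | |- is_derive (fun t => @?f t / ?k) _ _ => eapply (der_mult f (fun _ => / k)); der_go
  | |- is_derive (fun t => - @?f t) _ _ => eapply (der_opp f); der_go
  | |- is_derive (fun t => @?f t ^ 2) _ _ => eapply (der_sqr f); der_go
  | |- is_derive (fun t => cos (@?f t)) _ _ => eapply (der_cos f); der_go
  | |- is_derive (fun t => sin (@?f t)) _ _ => eapply (der_sin f); der_go
  end ].

Ltac der := eapply der_eq; [der_go|].

(** * Integrals of continuous functions and monotonicity *)

Lemma ctn_ex_RInt (f : R -> R) (a b : R) : ctn f -> ex_RInt f a b.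
Proof. intros H; apply (ex_RInt_continuous (V := R_CompleteNormedModule)); intros; apply H. Qed.

Lemma RInt_ctn_le (f g : R -> R) (a b : R) : ctn f -> ctn g -> a <= b ->
  (forall t, a < t < b -> f t <= g t) -> RInt f a b <= RInt g a b.
Proof. intros; apply RInt_le; auto using ctn_ex_RInt. Qed.

Lemma RInt_ctn_plus (f g : R -> R) (a b : R) : ctn f -> ctn g ->
  RInt (fun t => f t + g t) a b = RInt f a b + RInt g a b.
Proof.
  intros; exact (RInt_plus f g a b (ctn_ex_RInt _ _ _ H) (ctn_ex_RInt _ _ _ H0)).
Qed.

Lemma RInt_ctn_scal (f : R -> R) (k a b : R) : ctn f ->
  RInt (fun t => k * f t) a b = k * RInt f a b.
Proof. intros; exact (RInt_scal f a b k (ctn_ex_RInt _ _ _ H)). Qed.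

Lemma RInt_R_const (k a b : R) : RInt (fun _ => k) a b = k * (b - a).
Proof. rewrite RInt_const. unfold scal; simpl; unfold mult; simpl; ring. Qed.

Lemma RInt_ctn_Chasles (f : R -> R) (a b c : R) : ctn f ->
  RInt f a b + RInt f b c = RInt f a c.
Proof.
  intros; exact (RInt_Chasles f a b c (ctn_ex_RInt _ _ _ H) (ctn_ex_RInt _ _ _ H)).
Qed.

Lemma RInt_R_point (f : R -> R) (a : R) : RInt f a a = 0.
Proof. exact (RInt_point a f). Qed.

Lemma RInt_ctn_ge0 (f : R -> R) (a b : R) : ctn f -> a <= b ->
  (forall t, a < t < b -> 0 <= f t) -> 0 <= RInt f a b.
Proof.
  intros Hf Hab H. apply RInt_ge_0; auto using ctn_ex_RInt.
Qed.

Lemma is_derive_RInt_ctn (f : R -> R) (a t : R) : ctn f ->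
  is_derive (fun u => RInt f a u) t (f t).
Proof.
  intros Hf. apply (is_derive_RInt f (fun u => RInt f a u) a t).
  - apply filter_forall; intros u. apply (RInt_correct f a u). now apply ctn_ex_RInt.
  - apply Hf.
Qed.

Lemma RInt_comp_ctn (f g dg : R -> R) (a b : R) : ctn f ->
  (forall t, is_derive g t (dg t)) -> ctn dg ->
  RInt (fun t => dg t * f (g t)) a b = RInt f (g a) (g b).
Proof.
  intros Hf Hg Hdg.
  exact (RInt_comp f g dg a b (fun x _ => Hf (g x)) (fun x _ => conj (Hg x) (Hdg x))).
Qed.

Lemma der_locally_constant (f : R -> R) (k t r : R) : 0 < r ->
  (forall u, t - r < u < t + r -> f u = k) -> is_derive f t 0.
Proof.
  intros Hr H. apply (is_derive_ext_loc (fun _ => k)); [|apply der_const].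
  exists (mkposreal _ Hr). intros u Hu.
  unfold ball in Hu; simpl in Hu; unfold AbsRing_ball, abs, minus, plus, opp in Hu; simpl in Hu.
  apply Rabs_def2 in Hu. symmetry. apply H. lra.
Qed.

Lemma nonincreasing_of_derive (f df : R -> R) (a b : R) : a <= b ->
  (forall t, a < t < b -> is_derive f t (df t)) ->
  (forall t, a <= t <= b -> continuity_pt f t) ->
  (forall t, a < t < b -> df t <= 0) -> f b <= f a.
Proof.
  intros Hab Hd Hc Hn.
  destruct (Rle_lt_or_eq_dec a b Hab) as [Hlt|<-]; [|lra].
  set (pr := fun t (H : a < t < b) => exist (fun l => derivable_pt_lim f t l) (df t)
              (proj1 (is_derive_Reals f t (df t)) (Hd t H)) : derivable_pt f t).
  destruct (MVT f id a b pr (fun t _ => derivable_pt_id t) Hlt Hc) as [c [Hc1 H]].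
  - intros t _; apply derivable_continuous_pt, derivable_pt_id.
  - rewrite derive_pt_id in H.
    assert (E : derive_pt f c (pr c Hc1) = df c) by reflexivity.
    rewrite E in H. unfold id in H. specialize (Hn c Hc1). nra.
Qed.

Lemma constant_of_derive (f : R -> R) (a b : R) : a <= b ->
  (forall t, a < t < b -> is_derive f t 0) ->
  (forall t, a <= t <= b -> continuity_pt f t) -> f b = f a.
Proof.
  intros Hab Hd Hc. apply Rle_antisym.
  - apply (nonincreasing_of_derive f (fun _ => 0)); auto; intros; lra.
  - apply Ropp_le_cancel.
    apply (nonincreasing_of_derive (fun t => - f t) (fun _ => - 0)); auto.
    + intros t Ht. apply der_opp, Hd, Ht.
    + intros t Ht. apply continuity_pt_opp, Hc, Ht.
    + intros; lra.
Qed.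

(** The primitive from [a] is squeezed between 0 and the whole integral, so it vanishes identically;
    its derivative is [f]. *)
Lemma RInt_ctn_eq0 (f : R -> R) (a b : R) : ctn f -> a <= b ->
  (forall t, a <= t <= b -> 0 <= f t) -> RInt f a b <= 0 ->
  forall t, a < t < b -> f t = 0.
Proof.
  intros Hf Hab Hp Hi t Ht.
  assert (HF : forall u, a <= u <= b -> RInt f a u = 0).
  { intros u Hu. apply Rle_antisym.
    - assert (0 <= RInt f u b) by (apply RInt_ctn_ge0; auto; try lra; intros; apply Hp; lra).
      assert (H1 := RInt_ctn_Chasles f a u b Hf). lra.
    - apply RInt_ctn_ge0; auto; try lra. intros; apply Hp; lra. }
  assert (H1 := is_derive_RInt_ctn f a t Hf).
  assert (H2 : is_derive (fun u => RInt f a u) t 0).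
  { apply (der_locally_constant _ 0 t (Rmin (t - a) (b - t))); [apply Rmin_pos; lra|].
    assert (H3 := Rmin_l (t - a) (b - t)). assert (H4 := Rmin_r (t - a) (b - t)).
    intros u Hu. apply HF. lra. }
  apply is_derive_unique in H1. apply is_derive_unique in H2. congruence.
Qed.

(** The tangent line of the concave root. It bounds the length of a variation to second order
    without differentiating under the integral. *)
Lemma sqrt_1px_le (x : R) : -1 <= x -> sqrt (1 + x) <= 1 + x / 2.
Proof.
  intros H. rewrite <- (sqrt_square (1 + x / 2)) by lra.
  apply sqrt_le_1_alt. nra.
Qed.

(** * Gluing *)

Definition glue (m : R) (f g : R -> R) (t : R) : R := if Rle_dec t m then f t else g t.

Lemma is_derive_glue (m : R) (f g df dg : R -> R) :
  (forall t, is_derive f t (df t)) -> (forall t, is_derive g t (dg t)) ->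
  f m = g m -> df m = dg m ->
  forall t, is_derive (glue m f g) t (glue m df dg t).
Proof.
  intros Hf Hg E Ed t. apply is_derive_Reals. intros eps Heps.
  destruct (proj1 (is_derive_Reals _ _ _) (Hf t) eps Heps) as [d1 H1].
  destruct (proj1 (is_derive_Reals _ _ _) (Hg t) eps Heps) as [d2 H2].
  unfold glue. destruct (Rle_dec t m) as [Ht|Ht]; [destruct (Req_dec t m) as [->|Hn]|].
  - assert (Hd : 0 < Rmin d1 d2) by (apply Rmin_pos; apply cond_pos).
    exists (mkposreal _ Hd); intros h Hh Hlt; simpl in Hlt.
    assert (B1 := Rmin_l d1 d2). assert (B2 := Rmin_r d1 d2).
    destruct (Rle_dec (m + h) m).
    + apply H1; auto; lra.
    + rewrite E, Ed. apply H2; auto; lra.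
  - assert (Hd : 0 < Rmin d1 (m - t)) by (apply Rmin_pos; [apply cond_pos|lra]).
    exists (mkposreal _ Hd); intros h Hh Hlt; simpl in Hlt.
    assert (B1 := Rmin_l d1 (m - t)). assert (B2 := Rmin_r d1 (m - t)).
    assert (B3 := Rle_abs h).
    destruct (Rle_dec (t + h) m); [|lra]. apply H1; auto; lra.
  - assert (Hd : 0 < Rmin d2 (t - m)) by (apply Rmin_pos; [apply cond_pos|lra]).
    exists (mkposreal _ Hd); intros h Hh Hlt; simpl in Hlt.
    assert (B1 := Rmin_l d2 (t - m)). assert (B2 := Rmin_r d2 (t - m)).
    assert (B3 := Rle_abs (- h)). rewrite Rabs_Ropp in B3.
    destruct (Rle_dec (t + h) m); [lra|]. apply H2; auto; lra.
Qed.

Lemma ctn_glue (m : R) (f g : R -> R) : ctn f -> ctn g -> f m = g m -> ctn (glue m f g).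
Proof.
  intros Hf Hg E t. apply continuity_pt_filterlim.
  assert (Cf : continuity_pt f t) by apply continuity_pt_filterlim, Hf.
  assert (Cg : continuity_pt g t) by apply continuity_pt_filterlim, Hg.
  intros eps Heps.
  destruct (Cf eps Heps) as [d1 [D1 H1]]. destruct (Cg eps Heps) as [d2 [D2 H2]].
  unfold glue, dist in *; simpl in *; unfold Rdist in *.
  destruct (Rle_dec t m) as [Ht|Ht]; [destruct (Req_dec t m) as [->|Hn]|].
  - exists (Rmin d1 d2); split; [apply Rmin_pos; auto|]. intros x [Hx Hlt].
    assert (B1 := Rmin_l d1 d2). assert (B2 := Rmin_r d1 d2).
    destruct (Rle_dec x m).
    + apply H1; split; auto; lra.
    + rewrite E. apply H2; split; auto; lra.
  - exists (Rmin d1 (m - t)); split; [apply Rmin_pos; auto; lra|]. intros x [Hx Hlt].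
    assert (B1 := Rmin_l d1 (m-t)). assert (B2 := Rmin_r d1 (m-t)). assert (B3 := Rle_abs (x - t)).
    destruct (Rle_dec x m); [|lra]. apply H1; split; auto; lra.
  - exists (Rmin d2 (t - m)); split; [apply Rmin_pos; auto; lra|]. intros x [Hx Hlt].
    assert (B1 := Rmin_l d2 (t-m)). assert (B2 := Rmin_r d2 (t-m)).
    assert (B3 := Rle_abs (-(x - t))). rewrite Rabs_Ropp in B3.
    destruct (Rle_dec x m); [lra|]. apply H2; split; auto; lra.
Qed.

(** * Curves in R^4 with their velocity *)

(** Carrying the velocity as a second function lets explicit curves be treated by symbolic
    differentiation; [Derive] only appears at the interface with [C1curve] and [len]. *)
Definition C1with (c v : R -> P4) : Prop :=
  ((forall t, is_derive (fun s => qc0 (c s)) t (qc0 (v t))) /\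
   (forall t, is_derive (fun s => qc1 (c s)) t (qc1 (v t))) /\
   (forall t, is_derive (fun s => qc2 (c s)) t (qc2 (v t))) /\
   (forall t, is_derive (fun s => qc3 (c s)) t (qc3 (v t)))) /\
  (ctn (fun t => qc0 (v t)) /\ ctn (fun t => qc1 (v t)) /\
   ctn (fun t => qc2 (v t)) /\ ctn (fun t => qc3 (v t))).

Lemma C1with_velocity (c v : R -> P4) : C1with c v -> forall t, velocity c t = v t.
Proof.
  intros [(H0 & H1 & H2 & H3) _] t. unfold velocity.
  replace (Derive (fun s => qc0 (c s)) t) with (qc0 (v t)) by (symmetry; apply is_derive_unique, H0).
  replace (Derive (fun s => qc1 (c s)) t) with (qc1 (v t)) by (symmetry; apply is_derive_unique, H1).
  replace (Derive (fun s => qc2 (c s)) t) with (qc2 (v t)) by (symmetry; apply is_derive_unique, H2).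
  replace (Derive (fun s => qc3 (c s)) t) with (qc3 (v t)) by (symmetry; apply is_derive_unique, H3).
  now destruct (v t).
Qed.

Lemma C1with_C1curve (c v : R -> P4) : C1with c v -> C1curve c.
Proof.
  intros [(H0 & H1 & H2 & H3) (K0 & K1 & K2 & K3)] t.
  assert (G : forall f df : R -> R, (forall t, is_derive f t (df t)) -> ctn df ->
            ex_derive f t /\ continuous (Derive f) t).
  { intros f df Hf Hc; split; [eexists; apply Hf|].
    apply (continuous_ext df); [|apply Hc].
    intros u; symmetry; apply is_derive_unique, Hf. }
  destruct (G _ _ H0 K0), (G _ _ H1 K1), (G _ _ H2 K2), (G _ _ H3 K3). tauto.
Qed.

Lemma C1curve_C1with (c : R -> P4) : C1curve c -> C1with c (velocity c).
Proof.
  intros H. unfold C1with, velocity, ctn; simpl.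
  refine (conj (conj _ (conj _ (conj _ _))) (conj _ (conj _ (conj _ _)))); intros t;
    destruct (H t) as (h0 & k0 & h1 & k1 & h2 & k2 & h3 & k3); auto;
    now apply Derive_correct.
Qed.

Lemma is_derive_sumsq (f0 f1 f2 f3 : R -> R) (t d0 d1 d2 d3 d : R) :
  is_derive f0 t d0 -> is_derive f1 t d1 -> is_derive f2 t d2 -> is_derive f3 t d3 ->
  d = 2 * (f0 t * d0 + f1 t * d1 + f2 t * d2 + f3 t * d3) ->
  is_derive (fun u => f0 u ^ 2 + f1 u ^ 2 + f2 u ^ 2 + f3 u ^ 2) t d.
Proof.
  intros H0 H1 H2 H3 ->. der. simpl; ring.
Qed.

(** [la0] to [la3] are the real, i, j and k components of the quaternion conj(x) v. For x on S^3 and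
    v tangent, [la0] vanishes and the others are the left-trivialised velocity. *)
Definition la0 (x v : P4) : R :=
  qc0 x * qc0 v + qc1 x * qc1 v + qc2 x * qc2 v + qc3 x * qc3 v.
Definition la1 (x v : P4) : R :=
  qc0 x * qc1 v - qc1 x * qc0 v - qc2 x * qc3 v + qc3 x * qc2 v.
Definition la2 (x v : P4) : R :=
  qc0 x * qc2 v - qc2 x * qc0 v - qc3 x * qc1 v + qc1 x * qc3 v.
Definition la3 (x v : P4) : R :=
  qc0 x * qc3 v - qc3 x * qc0 v - qc1 x * qc2 v + qc2 x * qc1 v.

Lemma speed2E (I1 I3 : R) (x v : P4) :
  speed2 I1 I3 x v = 4 * (I1 * (la1 x v ^ 2 + la2 x v ^ 2) + I3 * la3 x v ^ 2).
Proof. unfold speed2, la1, la2, la3. ring. Qed.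

Lemma speed2_ge0 (I1 I3 : R) (x v : P4) : 0 < I1 -> 0 < I3 -> 0 <= speed2 I1 I3 x v.
Proof.
  intros H1 H3. rewrite speed2E.
  assert (A := pow2_ge_0 (la1 x v)). assert (B := pow2_ge_0 (la2 x v)).
  assert (C := pow2_ge_0 (la3 x v)). nra.
Qed.

Section Along.
Variables (c v : R -> P4).
Hypothesis Hcv : C1with c v.

Lemma C1with_ctn0 : ctn (fun t => qc0 (c t)).
Proof. destruct Hcv as [(H0 & H1 & H2 & H3) _]; exact (ctn_derive _ _ H0). Qed.
Lemma C1with_ctn1 : ctn (fun t => qc1 (c t)).
Proof. destruct Hcv as [(H0 & H1 & H2 & H3) _]; exact (ctn_derive _ _ H1). Qed.
Lemma C1with_ctn2 : ctn (fun t => qc2 (c t)).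
Proof. destruct Hcv as [(H0 & H1 & H2 & H3) _]; exact (ctn_derive _ _ H2). Qed.
Lemma C1with_ctn3 : ctn (fun t => qc3 (c t)).
Proof. destruct Hcv as [(H0 & H1 & H2 & H3) _]; exact (ctn_derive _ _ H3). Qed.

Lemma ctn_la1 : ctn (fun t => la1 (c t) (v t)).
Proof.
  destruct Hcv as [_ (K0 & K1 & K2 & K3)].
  assert (A0 := C1with_ctn0). assert (A1 := C1with_ctn1).
  assert (A2 := C1with_ctn2). assert (A3 := C1with_ctn3). unfold la1; cts.
Qed.
Lemma ctn_la2 : ctn (fun t => la2 (c t) (v t)).
Proof.
  destruct Hcv as [_ (K0 & K1 & K2 & K3)].
  assert (A0 := C1with_ctn0). assert (A1 := C1with_ctn1).
  assert (A2 := C1with_ctn2). assert (A3 := C1with_ctn3). unfold la2; cts.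
Qed.
Lemma ctn_la3 : ctn (fun t => la3 (c t) (v t)).
Proof.
  destruct Hcv as [_ (K0 & K1 & K2 & K3)].
  assert (A0 := C1with_ctn0). assert (A1 := C1with_ctn1).
  assert (A2 := C1with_ctn2). assert (A3 := C1with_ctn3). unfold la3; cts.
Qed.

Lemma ctn_speed2 (I1 I3 : R) : ctn (fun t => speed2 I1 I3 (c t) (v t)).
Proof.
  assert (A1 := ctn_la1). assert (A2 := ctn_la2). assert (A3 := ctn_la3).
  assert (G : ctn (fun u => 4 * (I1 * (la1 (c u) (v u) ^ 2 + la2 (c u) (v u) ^ 2) +
                                 I3 * la3 (c u) (v u) ^ 2))) by cts.
  intros t. apply (continuous_ext _ _ t (fun u => eq_sym (speed2E I1 I3 (c u) (v u))) (G t)).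
Qed.

Lemma lenE (I1 I3 a b : R) :
  len I1 I3 c a b = RInt (fun t => sqrt (speed2 I1 I3 (c t) (v t))) a b.
Proof.
  unfold len, speed. apply RInt_ext. intros t _.
  now rewrite (C1with_velocity _ _ Hcv).
Qed.

Lemma ctn_sqrt_speed2 (I1 I3 : R) : ctn (fun t => sqrt (speed2 I1 I3 (c t) (v t))).
Proof. apply ctn_sqrt, ctn_speed2. Qed.

Lemma len_Chasles (I1 I3 a b d : R) :
  len I1 I3 c a b + len I1 I3 c b d = len I1 I3 c a d.
Proof. rewrite !lenE. apply RInt_ctn_Chasles, ctn_sqrt_speed2. Qed.

(** The curve is assumed to lie on S^3 only over [[a, b]], so tangency is read off at interior
    times, where the squared norm is locally constant. *)
Lemma la0_interior (a b t : R) : (forall u, a <= u <= b -> onS3 (c u)) -> a < t < b ->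
  la0 (c t) (v t) = 0.
Proof.
  intros HS Ht. destruct Hcv as [(H0 & H1 & H2 & H3) _].
  set (nn := fun u => qc0 (c u) ^ 2 + qc1 (c u) ^ 2 + qc2 (c u) ^ 2 + qc3 (c u) ^ 2).
  assert (D1 : is_derive nn t (2 * la0 (c t) (v t))).
  { refine (is_derive_sumsq _ _ _ _ t _ _ _ _ _ (H0 t) (H1 t) (H2 t) (H3 t) _).
    unfold la0; ring. }
  assert (D2 : is_derive nn t 0).
  { apply (der_locally_constant _ 1 t (Rmin (t - a) (b - t))); [apply Rmin_pos; lra|].
    assert (H5 := Rmin_l (t - a) (b - t)). assert (H6 := Rmin_r (t - a) (b - t)).
    intros u Hu. apply HS. lra. }
  apply is_derive_unique in D1. apply is_derive_unique in D2. lra.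
Qed.

End Along.

(** * Lower bounds for lengths *)

Lemma der_acos (f : R -> R) (t a : R) : is_derive f t a -> -1 < f t < 1 ->
  is_derive (fun u => acos (f u)) t (a * (-1 / sqrt (1 - (f t) ^ 2))).
Proof.
  intros H Hf. apply der_comp; auto.
  apply is_derive_Reals. replace ((f t) ^ 2) with (Rsqr (f t)) by (unfold Rsqr; ring).
  rewrite <- (derive_pt_acos (f t) Hf).
  destruct (derivable_pt_acos (f t) Hf) as [l Hl]. exact Hl.
Qed.

(* Cauchy-Schwarz against the gradient of the height function of the round sphere. *)
Lemma height_velocity_bound (q v : P4) (C S d N : R) :
  onS3 q -> la0 q v = 0 -> C ^ 2 + S ^ 2 = 1 ->
  la1 q v ^ 2 + la2 q v ^ 2 + (la3 q v - d) ^ 2 <= N ^ 2 ->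
  let X := qc0 q * C + qc3 q * S in
  (qc0 v * C + qc3 v * S + d * (qc3 q * C - qc0 q * S)) ^ 2 <= (1 - X ^ 2) * N ^ 2.
Proof.
  intros Hq H0 HCS HN X. unfold onS3 in Hq.
  (* Up to sign these are the imaginary components of conj(q) (C + S k), whose real part is [X]. *)
  set (u1 := qc1 q * C + qc2 q * S). set (u2 := qc2 q * C - qc1 q * S).
  set (u3 := qc3 q * C - qc0 q * S).
  assert (Hu : u1 ^ 2 + u2 ^ 2 + u3 ^ 2 = 1 - X ^ 2).
  { unfold u1, u2, u3, X.
    transitivity ((qc0 q ^ 2 + qc1 q ^ 2 + qc2 q ^ 2 + qc3 q ^ 2) * (C ^ 2 + S ^ 2)
                  - (qc0 q * C + qc3 q * S) ^ 2); [ring|rewrite Hq, HCS; ring]. }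
  assert (E0 : qc0 v = - (qc1 q * la1 q v + qc2 q * la2 q v + qc3 q * la3 q v)).
  { transitivity (qc0 v * (qc0 q ^ 2 + qc1 q ^ 2 + qc2 q ^ 2 + qc3 q ^ 2)); [rewrite Hq; ring|].
    transitivity (qc0 q * la0 q v - (qc1 q * la1 q v + qc2 q * la2 q v + qc3 q * la3 q v));
      [unfold la0, la1, la2, la3; ring|rewrite H0; ring]. }
  assert (E3 : qc3 v = qc0 q * la3 q v + qc1 q * la2 q v - qc2 q * la1 q v).
  { transitivity (qc3 v * (qc0 q ^ 2 + qc1 q ^ 2 + qc2 q ^ 2 + qc3 q ^ 2)); [rewrite Hq; ring|].
    transitivity (qc3 q * la0 q v + (qc0 q * la3 q v + qc1 q * la2 q v - qc2 q * la1 q v));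
      [unfold la0, la1, la2, la3; ring|rewrite H0; ring]. }
  set (a1 := la1 q v) in *. set (a2 := la2 q v) in *. set (a3 := la3 q v) in *.
  replace (qc0 v * C + qc3 v * S + d * u3)
    with (- (a1 * u1 + a2 * u2 + (a3 - d) * u3))
    by (rewrite E0, E3; unfold u1, u2, u3; ring).
  rewrite <- Hu.
  assert (CS : (a1 * u1 + a2 * u2 + (a3 - d) * u3) ^ 2 <=
     (u1 ^ 2 + u2 ^ 2 + u3 ^ 2) * (a1 ^ 2 + a2 ^ 2 + (a3 - d) ^ 2)).
  { assert (P1 := pow2_ge_0 (a1 * u2 - a2 * u1)).
    assert (P2 := pow2_ge_0 (a1 * u3 - (a3 - d) * u1)).
    assert (P3 := pow2_ge_0 (a2 * u3 - (a3 - d) * u2)). nra. }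
  assert (P := pow2_ge_0 u1). assert (P' := pow2_ge_0 u2). assert (P'' := pow2_ge_0 u3).
  replace ((- (a1 * u1 + a2 * u2 + (a3 - d) * u3)) ^ 2)
    with ((a1 * u1 + a2 * u2 + (a3 - d) * u3) ^ 2) by ring.
  eapply Rle_trans; [exact CS|]. apply Rmult_le_compat_l; [lra|exact HN].
Qed.

(* The scaling by [cos e < 1] keeps [acos] differentiable along the whole curve,
   even where the rotated height is 1, e.g. at the starting point. *)
Lemma round_length_bound (c v : R -> P4) (a b : R) (th dth N : R -> R) :
  C1with c v -> a <= b -> (forall t, a <= t <= b -> onS3 (c t)) -> c a = idP ->
  (forall t, is_derive th t (dth t)) -> th a = 0 -> ctn N ->
  (forall t, a < t < b -> 0 <= N t) ->
  (forall t, a < t < b ->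
     la1 (c t) (v t) ^ 2 + la2 (c t) (v t) ^ 2 + (la3 (c t) (v t) - dth t) ^ 2 <= N t ^ 2) ->
  RInt N a b <= PI ->
  cos (RInt N a b) <= qc0 (c b) * cos (th b) + qc3 (c b) * sin (th b).
Proof.
  intros Hcv Hab HS Ha Hth Hth0 HN HNp Hle HPI.
  set (X := fun t => qc0 (c t) * cos (th t) + qc3 (c t) * sin (th t)).
  set (dX := fun t => qc0 (v t) * cos (th t) + qc3 (v t) * sin (th t)
                      + dth t * (qc3 (c t) * cos (th t) - qc0 (c t) * sin (th t))).
  assert (HdX : forall t, is_derive X t (dX t)).
  { intros t. destruct Hcv as [(H0 & H1 & H2 & H3) _].
    specialize (H0 t); specialize (H3 t); specialize (Hth t).
    unfold X. eapply der_eq.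
    - eapply der_plus; eapply der_mult; [exact H0|apply der_cos; exact Hth|exact H3|apply der_sin; exact Hth].
    - unfold dX; simpl; ring. }
  assert (CS : forall t, cos (th t) ^ 2 + sin (th t) ^ 2 = 1).
  { intros t. assert (H := sin2_cos2 (th t)). unfold Rsqr in H. lra. }
  assert (HX1 : forall t, a <= t <= b -> X t ^ 2 <= 1).
  { intros t Ht. assert (H := HS t Ht). assert (K := CS t). unfold X, onS3 in *.
    assert (Q := pow2_ge_0 (qc0 (c t) * sin (th t) - qc3 (c t) * cos (th t))).
    assert (Q1 := pow2_ge_0 (qc1 (c t))). assert (Q2 := pow2_ge_0 (qc2 (c t))).
    assert (E : (qc0 (c t) * cos (th t) + qc3 (c t) * sin (th t)) ^ 2 +
      (qc0 (c t) * sin (th t) - qc3 (c t) * cos (th t)) ^ 2 =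
      (qc0 (c t) ^ 2 + qc3 (c t) ^ 2) * (cos (th t) ^ 2 + sin (th t) ^ 2)) by ring.
    rewrite K in E. lra. }
  assert (HXa : X a = 1) by (unfold X; rewrite Ha, Hth0, cos_0, sin_0; simpl; ring).
  fold (X b). set (l := RInt N a b) in *.
  assert (Hl0 : 0 <= l) by (apply RInt_ctn_ge0; auto).
  assert (HXb : -1 <= X b <= 1) by (assert (H := HX1 b); nra).
  assert (main : forall e, 0 < e -> e < PI / 2 -> e + l <= PI -> cos (e + l) <= cos e * X b).
  { intros e He1 He2 He3.
    assert (Kp : 0 < cos e) by (apply cos_gt_0; lra).
    assert (K1 : cos e < 1).
    { rewrite <- cos_0. apply cos_decreasing_1; lra. }
    set (k := cos e) in *.
    assert (HkX : forall t, a <= t <= b -> -1 < k * X t < 1).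
    { intros t Ht. assert (H := HX1 t Ht). assert (-1 <= X t <= 1) by nra. nra. }
    (* [acos (k * X)] starts at [e], and by the Cauchy-Schwarz bound it grows no faster than the
       integral of [N]. *)
    set (F := fun t => acos (k * X t) - RInt N a t).
    assert (HF : F b <= F a).
    { apply (nonincreasing_of_derive F
        (fun t => k * dX t * (-1 / sqrt (1 - (k * X t) ^ 2)) - N t)); auto.
      - intros t Ht. unfold F. apply der_minus; [|now apply is_derive_RInt_ctn].
        apply (der_acos (fun u => k * X u)); [|apply HkX; lra].
        eapply der_eq; [eapply der_mult; [apply der_const|apply HdX]|cbv beta; ring].
      - intros t Ht. apply continuity_pt_filterlim. apply (ex_derive_continuous F t).
        eexists. unfold F. apply der_minus; [|now apply is_derive_RInt_ctn].
        apply (der_acos (fun u => k * X u)); [|apply HkX; lra].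
        eapply der_mult; [apply der_const|apply HdX].
      - intros t Ht. assert (Hk := HkX t ltac:(lra)).
        assert (Hs : 0 < 1 - (k * X t) ^ 2) by nra.
        assert (Hq := height_velocity_bound (c t) (v t) (cos (th t)) (sin (th t)) (dth t) (N t)
          (HS t ltac:(lra)) (la0_interior c v Hcv a b t HS Ht) (CS t) (Hle t Ht)).
        cbv zeta in Hq. fold (X t) (dX t) in Hq.
        assert (Hsq := sqrt_lt_R0 _ Hs). set (w := sqrt (1 - (k * X t) ^ 2)) in *.
        assert (Hw : w ^ 2 = 1 - (k * X t) ^ 2) by (unfold w; rewrite pow2_sqrt; lra).
        assert (HNt := HNp t Ht).
        assert (B : - (k * dX t) <= N t * w).
        { assert (HX1t := HX1 t ltac:(lra)).
          assert (B2 : (k * dX t) ^ 2 <= (N t * w) ^ 2).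
          { assert (E1 : (k * dX t) ^ 2 <= k ^ 2 * ((1 - X t ^ 2) * N t ^ 2)).
            { replace ((k * dX t) ^ 2) with (k ^ 2 * dX t ^ 2) by ring.
              apply Rmult_le_compat_l; [apply pow2_ge_0|exact Hq]. }
            replace ((N t * w) ^ 2) with (N t ^ 2 * (1 - (k * X t) ^ 2)) by (rewrite <- Hw; ring).
            assert (HN2 := pow2_ge_0 (N t)).
            assert (k ^ 2 <= 1) by nra.
            eapply Rle_trans; [exact E1|].
            replace (k ^ 2 * ((1 - X t ^ 2) * N t ^ 2)) with
              (N t ^ 2 * (k ^ 2 - (k * X t) ^ 2)) by ring.
            apply Rmult_le_compat_l; lra. }
          assert (0 <= N t * w) by (apply Rmult_le_pos; lra).
          apply Rabs_le_between. apply Rsqr_incr_0_var; auto.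
          rewrite <- Rsqr_abs. unfold Rsqr. nra. }
        assert (k * dX t * (-1 / w) <= N t); [|lra].
        apply (Rmult_le_reg_r w); auto. 
        replace (k * dX t * (-1 / w) * w) with (- (k * dX t)) by (field; lra). exact B. }
    unfold F in HF. rewrite HXa, RInt_R_point, Rmult_1_r in HF.
    unfold k in HF at 2. rewrite acos_cos in HF by lra. fold l in HF.
    assert (Hb := HkX b ltac:(lra)). assert (Ab := acos_bound (k * X b)).
    rewrite <- (cos_acos (k * X b)) by lra.
    apply cos_decr_1; lra. }
  destruct (Rle_lt_or_eq_dec l PI HPI) as [Hlt | ->]; [|rewrite cos_PI; lra].
  destruct (Rle_lt_dec (cos l) (X b)) as [|Hgt]; [assumption|exfalso].
  set (D := cos l - X b) in *. assert (HD : 0 < D) by (unfold D; lra).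
  assert (HP := PI_RGT_0). assert (P3 : 3 < PI) by (assert (H := PI2_3_2); lra).
  (* [main] yields [cos e * D <= sin e * sin l <= e], while [e <= 1 < PI / 3] gives [cos e >= / 2];
     so [e <= D / 4] is contradictory. The term [PI - l] keeps [e + l] within [PI]. *)
  set (e := Rmin (Rmin 1 (D / 4)) (PI - l)).
  assert (e1 : e <= 1) by (eapply Rle_trans; [apply Rmin_l|apply Rmin_l]).
  assert (e2 : e <= D / 4) by (eapply Rle_trans; [apply Rmin_l|apply Rmin_r]).
  assert (e3 : e <= PI - l) by apply Rmin_r.
  assert (e0 : 0 < e) by (repeat apply Rmin_pos; lra).
  assert (M := main e e0 ltac:(lra) ltac:(lra)).
  rewrite cos_plus in M.
  assert (Hce : / 2 <= cos e).
  { assert (E := cos_PI3). unfold Rdiv in E; rewrite Rmult_1_l in E. rewrite <- E.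
    apply cos_decr_1; lra. }
  assert (Hse : sin e <= e) by (left; apply sin_lt_x; lra).
  assert (Hs0 : 0 <= sin e) by (apply sin_ge_0; lra).
  assert (Hsl : sin l <= 1) by apply SIN_bound.
  assert (Hsl0 : 0 <= sin l) by (apply sin_ge_0; lra).
  assert (sin e * sin l <= e) by nra.
  assert (cos e * D <= e) by (unfold D; lra). nra.
Qed.

Lemma le_sqrt_of_sqr (x y : R) : x ^ 2 <= y -> x <= sqrt y.
Proof.
  intros H. destruct (Rle_lt_dec x 0) as [Hx|Hx].
  - eapply Rle_trans; [exact Hx|apply sqrt_pos].
  - rewrite <- (sqrt_pow2 x) by lra. now apply sqrt_le_1_alt.
Qed.

(* The nonnegative root of [(1 - beta^2) N^2 + 2 beta a3 N = P + a3^2]. *)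
Definition lightlike (beta P a3 : R) : R :=
  (- beta * a3 + sqrt (a3 ^ 2 + (1 - beta ^ 2) * P)) / (1 - beta ^ 2).

Lemma lightlike_spec (beta P a3 : R) : beta ^ 2 < 1 -> 0 <= P ->
  0 <= lightlike beta P a3 /\
  P + (a3 - beta * lightlike beta P a3) ^ 2 = lightlike beta P a3 ^ 2.
Proof.
  intros Hb HP. unfold lightlike. set (k := 1 - beta ^ 2) in *.
  assert (Hk : 0 < k) by (unfold k; lra).
  assert (Hs : 0 <= a3 ^ 2 + k * P) by (assert (H := pow2_ge_0 a3); nra).
  assert (E := pow2_sqrt _ Hs). assert (Hp := sqrt_pos (a3 ^ 2 + k * P)).
  set (w := sqrt (a3 ^ 2 + k * P)) in *.
  split.
  - apply Rmult_le_pos; [|left; now apply Rinv_0_lt_compat].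
    assert (B : (beta * a3) ^ 2 <= w ^ 2).
    { rewrite E. assert (H := pow2_ge_0 a3). unfold k. nra. }
    nra.
  - assert (Hk2 : beta ^ 2 = 1 - k) by (unfold k; ring).
    set (N := (- beta * a3 + w) / k).
    assert (EN : k * N = - beta * a3 + w) by (unfold N; field; lra).
    assert (EQ : k * (k * N ^ 2 + 2 * beta * a3 * N - P - a3 ^ 2) = 0).
    { replace (k * (k * N ^ 2 + 2 * beta * a3 * N - P - a3 ^ 2)) with
        ((k * N) ^ 2 + 2 * beta * a3 * (k * N) - k * P - k * a3 ^ 2) by ring.
      rewrite EN. replace ((- beta * a3 + w) ^ 2 + 2 * beta * a3 * (- beta * a3 + w) - k * P - k * a3 ^ 2)
        with (w ^ 2 - beta ^ 2 * a3 ^ 2 - k * P - k * a3 ^ 2) by ring.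
      rewrite E, Hk2. ring. }
    apply Rmult_integral in EQ. destruct EQ as [EQ|EQ]; [lra|].
    replace (P + (a3 - beta * N) ^ 2) with (P + a3 ^ 2 - 2 * beta * a3 * N + beta ^ 2 * N ^ 2) by ring.
    rewrite Hk2. lra.
Qed.

(* The stretched fibre norm dominates every Lorentzian combination
   [P + (a3 - D)^2 - D^2/|eta|]. *)
Lemma stretched_norm_bound (eta s beta P a3 N : R) : -1 < eta <= 0 -> beta ^ 2 <= (eta * s) ^ 2 ->
  P + (a3 - beta * N) ^ 2 = N ^ 2 ->
  (1 + eta) * (1 + eta * s ^ 2) * N ^ 2 <= (1 + eta) * P + a3 ^ 2.
Proof.
  intros He Hb E.
  destruct (Req_dec eta 0) as [->|Hn].
  - assert (beta = 0) by nra. subst. nra.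
  - set (D := beta * N) in *.
    assert (HD : - eta * (eta * s ^ 2 * N ^ 2) <= - D ^ 2).
    { unfold D. assert (H := pow2_ge_0 N).
      replace (- eta * (eta * s ^ 2 * N ^ 2)) with (- ((eta * s) ^ 2 * N ^ 2)) by ring.
      replace (- (beta * N) ^ 2) with (- (beta ^ 2 * N ^ 2)) by ring.
      apply Ropp_le_contravar. now apply Rmult_le_compat_r. }
    assert (HN : (1 + eta) * (1 + eta * s ^ 2) * N ^ 2 =
      (1 + eta) * (P + (a3 - D) ^ 2 + eta * s ^ 2 * N ^ 2)).
    { rewrite E. ring. }
    rewrite HN. apply (Rmult_le_reg_l (- eta)); [lra|].
    replace (- eta * ((1 + eta) * (P + (a3 - D) ^ 2 + eta * s ^ 2 * N ^ 2))) with
      ((1 + eta) * (- eta * (P + (a3 - D) ^ 2) + (- eta * (eta * s ^ 2 * N ^ 2)))) by ring.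
    apply (Rle_trans _ ((1 + eta) * (- eta * (P + (a3 - D) ^ 2) + - D ^ 2))).
    + apply Rmult_le_compat_l; lra.
    (* The gap is exactly this square; equality holds for [D = eta * a3 / (1 + eta)], the rotation
       rate of the geodesics themselves. *)
    + assert (H := pow2_ge_0 (eta * a3 - (1 + eta) * D)). nra.
Qed.

Lemma one_plus_pos (eta s : R) : -1 < eta -> -1 <= s <= 1 -> 0 < 1 + eta * s ^ 2.
Proof.
  intros He Hs. assert (A : 0 <= s ^ 2) by apply pow2_ge_0. assert (B : s ^ 2 <= 1) by nra.
  destruct (Rle_lt_dec 0 eta); nra.
Qed.

Section Bounds.
Variables (I1 I3 eta : R).
Hypotheses (HI3 : 0 < I3) (HI : I1 = I3 * (1 + eta)) (Heta : -1 < eta).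

Lemma sqrt_coeff (k : R) : 0 <= k -> (2 * sqrt I1 * sqrt k) ^ 2 = 4 * I1 * k.
Proof.
  intros Hk. assert (0 <= I1) by (rewrite HI; nra).
  replace ((2 * sqrt I1 * sqrt k) ^ 2) with (4 * sqrt I1 ^ 2 * sqrt k ^ 2) by ring.
  rewrite !pow2_sqrt; auto.
Qed.

(** With [theta' = beta N] the total rotation is [beta * l], so [l] is the only unknown. The rate
    [beta] stays free up to [|eta| s] and is tuned later to the endpoint. *)
Lemma length_bound_stretched (s beta : R) (c v : R -> P4) (a b : R) :
  eta <= 0 -> 0 <= s <= 1 -> beta ^ 2 <= (eta * s) ^ 2 ->
  C1with c v -> a <= b -> (forall t, a <= t <= b -> onS3 (c t)) -> c a = idP ->
  exists l, 0 <= l /\ 2 * sqrt I1 * sqrt (1 + eta * s ^ 2) * l <= len I1 I3 c a b /\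
    (l <= PI -> cos l <= qc0 (c b) * cos (beta * l) + qc3 (c b) * sin (beta * l)).
Proof.
  intros He Hs Hb Hcv Hab HS Ha.
  assert (Hb1 : beta ^ 2 < 1).
  { eapply Rle_lt_trans; [exact Hb|].
    assert (-1 < eta * s) by nra. assert (eta * s <= 0) by nra. nra. }
  set (P := fun t => la1 (c t) (v t) ^ 2 + la2 (c t) (v t) ^ 2).
  set (N := fun t => lightlike beta (P t) (la3 (c t) (v t))).
  assert (A1 := ctn_la1 c v Hcv). assert (A2 := ctn_la2 c v Hcv). assert (A3 := ctn_la3 c v Hcv).
  assert (HN : ctn N) by (unfold N, lightlike, P; cts).
  assert (HP : forall t, 0 <= P t).
  { intros t; unfold P. assert (H := pow2_ge_0 (la1 (c t) (v t))).
    assert (K := pow2_ge_0 (la2 (c t) (v t))). lra. }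
  assert (HNs := fun t => lightlike_spec beta (P t) (la3 (c t) (v t)) Hb1 (HP t)).
  assert (Hk : 0 < 1 + eta * s ^ 2) by (apply one_plus_pos; lra).
  exists (RInt N a b). split; [|split].
  - apply RInt_ctn_ge0; auto. intros; apply HNs.
  - rewrite (lenE c v Hcv), <- RInt_ctn_scal by auto.
    apply RInt_ctn_le; auto; [cts|apply ctn_sqrt_speed2; auto|].
    intros t _. destruct (HNs t) as [HN0 HN1]. apply le_sqrt_of_sqr.
    replace ((2 * sqrt I1 * sqrt (1 + eta * s ^ 2) * N t) ^ 2) with
      ((2 * sqrt I1 * sqrt (1 + eta * s ^ 2)) ^ 2 * N t ^ 2) by ring.
    rewrite sqrt_coeff, speed2E by lra.
    assert (B := stretched_norm_bound eta s beta (P t) (la3 (c t) (v t)) (N t) (conj Heta He) Hb HN1).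
    fold (P t). rewrite HI. nra.
  - intros Hl.
    assert (R := round_length_bound c v a b (fun t => beta * RInt N a t) (fun t => beta * N t) N
      Hcv Hab HS Ha).
    cbv beta in R. apply R; auto.
    + intros t. eapply der_eq; [eapply der_mult; [apply der_const|now apply is_derive_RInt_ctn]|cbv beta; ring].
    + rewrite RInt_R_point; ring.
    + intros t _; apply HNs.
    + intros t _. destruct (HNs t) as [_ HN1]. fold (P t). apply Req_le, HN1.
Qed.

(** The total rotation [th] is not controlled, so it is paid for at the rate [s]. This is the weight
    for which Cauchy-Schwarz is an equality along the geodesic of parameter [s], where
    [|theta'| = eta s N]. *)
Lemma length_bound_shrunk (s : R) (c v : R -> P4) (a b : R) :
  0 < eta -> 0 <= s ->
  C1with c v -> a <= b -> (forall t, a <= t <= b -> onS3 (c t)) -> c a = idP ->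
  exists l th, 0 <= l /\
    2 * sqrt I1 * (l + s * Rabs th) <= len I1 I3 c a b * sqrt (1 + eta * s ^ 2) /\
    (l <= PI -> cos l <= qc0 (c b) * cos th + qc3 (c b) * sin th).
Proof.
  intros He Hs Hcv Hab HS Ha.
  set (P := fun t => la1 (c t) (v t) ^ 2 + la2 (c t) (v t) ^ 2).
  set (a3 := fun t => la3 (c t) (v t)).
  (* The minimizer of [P + (a3 - d)^2 + d^2 / eta], that is, the horizontal lift to the product with
     the line. *)
  set (d := fun t => eta / (1 + eta) * a3 t).
  set (N := fun t => sqrt (P t + (a3 t / (1 + eta)) ^ 2)).
  assert (A1 := ctn_la1 c v Hcv). assert (A2 := ctn_la2 c v Hcv). assert (A3 := ctn_la3 c v Hcv).
  fold a3 in A3.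
  assert (Hd : ctn d) by (unfold d; cts).
  assert (HN : ctn N) by (unfold N, P; cts).
  assert (HP : forall t, 0 <= P t).
  { intros t; unfold P. assert (H := pow2_ge_0 (la1 (c t) (v t))).
    assert (K := pow2_ge_0 (la2 (c t) (v t))). lra. }
  assert (HN0 : forall t, 0 <= N t) by (intros; apply sqrt_pos).
  assert (HN2 : forall t, N t ^ 2 = P t + (a3 t / (1 + eta)) ^ 2).
  { intros t; unfold N; rewrite pow2_sqrt; auto.
    assert (H := HP t). assert (K := pow2_ge_0 (a3 t / (1 + eta))). lra. }
  assert (Hk : 0 < 1 + eta * s ^ 2) by (assert (H := pow2_ge_0 s); nra).
  assert (Hth : Rabs (RInt d a b) <= RInt (fun t => Rabs (d t)) a b)
    by (apply abs_RInt_le; auto using ctn_ex_RInt).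
  exists (RInt N a b), (RInt d a b). split; [|split].
  - apply RInt_ctn_ge0; auto.
  - rewrite (lenE c v Hcv).
    apply (Rle_trans _ (2 * sqrt I1 * (RInt N a b + s * RInt (fun t => Rabs (d t)) a b))).
    { apply Rmult_le_compat_l; [assert (H := sqrt_pos I1); lra|].
      apply Rplus_le_compat_l, Rmult_le_compat_l; auto. }
    rewrite <- (RInt_ctn_scal (fun t => Rabs (d t)) s) by cts.
    rewrite <- RInt_ctn_plus by cts. rewrite <- RInt_ctn_scal by cts.
    rewrite (Rmult_comm (RInt _ _ _)), <- RInt_ctn_scal by (apply ctn_sqrt_speed2; auto).
    assert (G := ctn_sqrt_speed2 c v Hcv I1 I3).
    apply RInt_ctn_le; auto; [cts|cts|].
    intros t _.
    rewrite <- sqrt_mult; [|lra|apply speed2_ge0; auto; rewrite HI; nra].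
    apply le_sqrt_of_sqr.
    assert (HI1 : 0 <= I1) by (rewrite HI; nra).
    replace ((2 * sqrt I1 * (N t + s * Rabs (d t))) ^ 2) with
      (4 * sqrt I1 ^ 2 * (N t + s * Rabs (d t)) ^ 2) by ring.
    rewrite pow2_sqrt by auto. rewrite speed2E. fold (P t) (a3 t).
    assert (Hdd : Rabs (d t) ^ 2 = eta ^ 2 * (a3 t / (1 + eta)) ^ 2).
    { rewrite pow2_abs. unfold d. field. lra. }
    (* Cauchy-Schwarz for (N, |d|/sqrt eta) and (1, sqrt eta * s) *)
    assert (CS : eta * (N t + s * Rabs (d t)) ^ 2 <= (1 + eta * s ^ 2) * (eta * N t ^ 2 + Rabs (d t) ^ 2)).
    { assert (H := pow2_ge_0 (eta * s * N t - Rabs (d t))). nra. }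
    rewrite Hdd, HN2 in CS.
    assert (CS' : (N t + s * Rabs (d t)) ^ 2 <= (1 + eta * s ^ 2) * (P t + (1 + eta) * (a3 t / (1 + eta)) ^ 2)).
    { apply (Rmult_le_reg_l eta); auto. lra. }
    replace ((1 + eta) * (a3 t / (1 + eta)) ^ 2) with (a3 t ^ 2 / (1 + eta)) in CS' by (field; lra).
    rewrite HI.
    replace ((1 + eta * s ^ 2) * (4 * (I3 * (1 + eta) * P t + I3 * a3 t ^ 2))) with
      (4 * (I3 * (1 + eta)) * ((1 + eta * s ^ 2) * (P t + a3 t ^ 2 / (1 + eta)))) by (field; lra).
    apply Rmult_le_compat_l; [nra|exact CS'].
  - intros Hl.
    apply (round_length_bound c v a b (fun t => RInt d a t) d N Hcv Hab HS Ha); auto.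
    + intros t. now apply is_derive_RInt_ctn.
    + apply RInt_R_point.
    + intros t _. rewrite HN2. fold (P t) (a3 t). unfold d. apply Req_le. field. lra.
Qed.

End Bounds.

(** * Trigonometric inequalities for a scaled angle *)

Lemma scal_between (s t : R) : 0 <= s <= 1 -> 0 <= t -> 0 <= s * t <= t.
Proof. intros; split; nra. Qed.

Lemma scal_sin_le (s w : R) : 0 <= s <= 1 -> 0 <= w <= PI / 2 -> s * sin w <= sin (s * w).
Proof.
  intros Hs Hw. assert (HP := PI_RGT_0).
  assert (H : s * sin w - sin (s * w) <= s * sin 0 - sin (s * 0)).
  { assert (D : forall t, is_derive (fun t => s * sin t - sin (s * t)) t (s * (cos t - cos (s * t)))).
    { intros t. der. ring. }
    apply (nonincreasing_of_derive (fun t => s * sin t - sin (s * t))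
             (fun t => s * (cos t - cos (s * t)))); auto; try lra.
    - intros t _. apply continuity_pt_filterlim. exact (ctn_derive _ _ D t).
    - intros t Ht. assert (cos t <= cos (s * t)) by (assert (B := scal_between s t Hs ltac:(lra)); apply cos_decr_1; lra). nra. }
  rewrite Rmult_0_r, sin_0 in H. lra.
Qed.

(** Convexity of the tangent, [tan (s u) <= s tan u], cleared of denominators so that [u = PI / 2]
    is allowed. *)
Lemma tan_scal_le (s u : R) : 0 <= s <= 1 -> 0 <= u <= PI / 2 ->
  cos u * sin (s * u) <= s * sin u * cos (s * u).
Proof.
  intros Hs Hu. assert (HP := PI_RGT_0).
  assert (H : cos u * sin (s * u) - s * sin u * cos (s * u) <=
              cos 0 * sin (s * 0) - s * sin 0 * cos (s * 0)).
  { assert (D : forall t, is_derive (fun t => cos t * sin (s * t) - s * sin t * cos (s * t)) t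
                  (- (1 - s ^ 2) * (sin t * sin (s * t)))).
    { intros t. der. ring. }
    apply (nonincreasing_of_derive _ _ 0 u (proj1 Hu) (fun t _ => D t)).
    - intros t _. apply continuity_pt_filterlim. exact (ctn_derive _ _ D t).
    - intros t Ht. assert (0 <= sin t) by (apply sin_ge_0; lra).
      assert (0 <= sin (s * t)) by (assert (B := scal_between s t Hs ltac:(lra)); apply sin_ge_0; lra).
      assert (0 <= sin t * sin (s * t)) by (apply Rmult_le_pos; auto).
      assert (0 <= 1 - s ^ 2) by nra. nra. }
  rewrite Rmult_0_r, sin_0 in H. lra.
Qed.

(* The round distance [acos (rho cos f)] to the points of a great circle is convex in
   the angle [f] over a quarter turn; this is its supporting line of slope [s] at [f0]. *)
Lemma round_distance_support (s tau rho f0 u : R) :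
  0 <= s <= 1 -> 0 <= tau <= PI / 2 -> 0 <= f0 -> 0 <= rho ->
  rho * cos f0 = cos tau -> rho * sin f0 = s * sin tau ->
  0 <= f0 + u <= PI / 2 -> f0 <= PI / 2 ->
  rho * cos (f0 + u) <= cos (tau + s * u).
Proof.
  intros Hs Ht Hf Hr Hc Hsn Hu Hf2. assert (HP := PI_RGT_0).
  assert (Hst : 0 <= sin tau) by (apply sin_ge_0; lra).
  assert (Hct : 0 <= cos tau) by (apply cos_ge_0; lra).
  assert (Hpos : 0 <= rho * cos (f0 + u)) by (apply Rmult_le_pos; auto; apply cos_ge_0; lra).
  assert (E : rho * cos (f0 + u) = cos tau * cos u - s * sin tau * sin u)
    by (rewrite cos_plus, <- Hc, <- Hsn; ring).
  rewrite E in *. rewrite cos_plus.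
  destruct (Rle_lt_dec u 0) as [Hu0|Hu0].
  - set (w := - u). replace u with (- w) by (unfold w; ring).
    replace (s * - w) with (- (s * w)) by ring.
    rewrite !cos_neg, !sin_neg.
    assert (Hw : 0 <= w <= PI / 2) by (unfold w; lra).
    assert (A := scal_sin_le s w Hs Hw).
    assert (B : cos w <= cos (s * w))
      by (assert (K := scal_between s w Hs ltac:(lra)); apply cos_decr_1; lra). nra.
  (* Here [cos u = 0] and the division below fails; but [f0] must then be 0, so
     [s * sin tau = 0]. *)
  - destruct (Req_dec u (PI / 2)) as [Hu1|Hu1].
    + assert (f0 = 0) by lra. subst f0. rewrite sin_0, Rmult_0_r in Hsn.
      subst u. rewrite cos_PI2, sin_PI2. symmetry in Hsn.
      assert (Hspi : 0 <= cos (s * (PI / 2))) 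
        by (assert (K := scal_between s (PI / 2) Hs ltac:(lra)); apply cos_ge_0; lra).
      apply Rmult_integral in Hsn. destruct Hsn as [->|H0].
      * replace (0 * (PI / 2)) with 0 by ring. rewrite cos_0, sin_0. lra.
      * rewrite H0. nra.
    + assert (Hcu : 0 < cos u) by (apply cos_gt_0; lra).
      assert (A := tan_scal_le s u Hs ltac:(lra)).
      apply (Rmult_le_reg_r (cos u)); auto.
      assert (B : cos u <= cos (s * u))
        by (assert (K := scal_between s u Hs ltac:(lra)); apply cos_decr_1; lra).
      assert (K : s * sin tau * sin u * (cos (s * u) - cos u) <= cos tau * cos u * (cos (s * u) - cos u))
        by (apply Rmult_le_compat_r; lra).
      nra.
Qed.

(** An arbitrary angle is folded into [[0, PI]] by [acos (cos x)], and [e] records whether a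
    reflection took place. *)
Lemma acos_cos_sin (x : R) : exists e, (e = 1 \/ e = -1) /\ sin x = e * sin (acos (cos x)).
Proof.
  assert (Hb := COS_bound x). assert (Ha := acos_bound (cos x)).
  set (y := acos (cos x)) in *. assert (E : cos y = cos x) by (apply cos_acos; lra).
  assert (Hy : 0 <= sin y) by (apply sin_ge_0; lra).
  assert (A := sin2_cos2 x). assert (B := sin2_cos2 y). rewrite E in B. unfold Rsqr in *.
  assert (F : (sin x - sin y) * (sin x + sin y) = 0) by lra.
  apply Rmult_integral in F. destruct F; [exists 1|exists (-1)]; lra.
Qed.

(** * Comparison of a competitor with the explicit geodesic *)

Section Minimality.
Variables (I1 I3 eta : R).
Hypotheses (HI3 : 0 < I3) (HI : I1 = I3 * (1 + eta)) (Heta : -1 < eta).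

(** Here [rho e^{i f0} = cos tau + i s sin tau], so the geodesic of parameter [s] ends with z of
    modulus [rho] and argument [f0 + eta s tau]. The competitor ends with the same modulus and with
    an argument [ak] at least as far from 0. Only z of its endpoint enters, so one statement serves
    all lifts. *)
Theorem length_lower_bound (s tau rho f0 ak : R) (c v : R -> P4) (a b : R) :
  0 <= s <= 1 -> 0 < tau <= PI -> 0 <= rho -> 0 <= f0 <= PI ->
  rho * cos f0 = cos tau -> rho * sin f0 = s * sin tau ->
  0 <= f0 + eta * s * tau -> (0 < eta -> f0 + eta * s * tau <= PI / 2) ->
  cos ak <= cos (f0 + eta * s * tau) ->
  C1with c v -> a <= b -> (forall t, a <= t <= b -> onS3 (c t)) -> c a = idP ->
  qc0 (c b) = rho * cos ak -> qc3 (c b) = rho * sin ak ->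
  2 * sqrt I1 * sqrt (1 + eta * s ^ 2) * tau <= len I1 I3 c a b.
Proof.
  intros Hs Ht Hr Hf Hc Hsn Hal Hal2 Hak Hcv Hab HS Ha E0 E3.
  assert (HP := PI_RGT_0).
  assert (Hk : 0 < 1 + eta * s ^ 2) by (apply one_plus_pos; lra).
  assert (Hsq := sqrt_lt_R0 _ Hk). assert (Hsi := sqrt_pos I1).
  set (al := f0 + eta * s * tau) in *.
  assert (Hst : 0 <= sin tau) by (apply sin_ge_0; lra).
  destruct (Rle_lt_dec eta 0) as [He|He].
  - assert (Hcb := COS_bound ak). assert (Hah := acos_bound (cos ak)).
    destruct (acos_cos_sin ak) as [e [He1 Hes]].
    set (ah := acos (cos ak)) in *. assert (Ec : cos ah = cos ak) by (apply cos_acos; lra).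
    assert (Hst0 : 0 <= s * tau) by (apply Rmult_le_pos; lra).
    assert (Hale : al <= f0) by (unfold al; nra).
    assert (Hahl : al <= ah).
    { destruct (Rle_lt_dec al ah); auto. assert (cos al < cos ah) by (apply cos_decreasing_1; lra). lra. }
    assert (Fin : forall beta, beta ^ 2 <= (eta * s) ^ 2 ->
      (forall l, 0 <= l -> l < tau -> l <= PI ->
         cos l <= qc0 (c b) * cos (beta * l) + qc3 (c b) * sin (beta * l) -> False) ->
      2 * sqrt I1 * sqrt (1 + eta * s ^ 2) * tau <= len I1 I3 c a b).
    { intros beta Hb HF.
      destruct (length_bound_stretched I1 I3 eta HI3 HI Heta s beta c v a b He Hs Hb Hcv Hab HS Ha)
        as [l [Hl [Hlen Hl2]]].
      destruct (Rlt_le_dec l tau) as [Hlt|Hge].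
      - exfalso. apply (HF l); try apply Hl2; lra.
      - eapply Rle_trans; [|exact Hlen]. apply Rmult_le_compat_l; auto.
        apply Rmult_le_pos; lra. }
    destruct (Rle_lt_dec f0 ah) as [Hfa|Hfa].
    (* The endpoint is at least as far out as [f0], so the unrotated round distance already
       suffices. *)
    + apply (Fin 0); [rewrite pow_i by lia; apply pow2_ge_0|].
      intros l Hl0 Hlt HlP H. rewrite Rmult_0_l, cos_0, sin_0, E0, <- Ec in H.
      assert (cos ah <= cos f0) by (apply cos_decr_1; lra).
      assert (cos tau < cos l) by (apply cos_decreasing_1; lra). nra.
    (* The rate at which the comparison argument, starting from [ah], reaches [f0] exactly at
       [l = tau]. It is at most [|eta| s] because [ah] is at least the argument of the geodesic; [e]
       below supplies the direction. *)
    + set (bb := (f0 - ah) / tau).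
      assert (Hbt : bb * tau = f0 - ah) by (unfold bb; field; lra).
      assert (Hb0 : 0 < bb) by (unfold bb; apply Rdiv_lt_0_compat; lra).
      assert (Hb1 : bb <= - (eta * s)).
      { apply (Rmult_le_reg_r tau); [lra|]. rewrite Hbt. unfold al in Hahl. lra. }
      assert (Hb2 : bb < 1) by nra.
      apply (Fin (- e * bb)).
      { replace ((- e * bb) ^ 2) with (e ^ 2 * bb ^ 2) by ring.
        replace (e ^ 2) with 1 by (destruct He1; subst; ring).
        rewrite Rmult_1_l. replace ((eta * s) ^ 2) with ((- (eta * s)) ^ 2) by ring.
        apply pow_incr. lra. }
      intros l Hl0 Hlt HlP H.
      assert (H' : cos l <= rho * cos (ah + bb * l)).
      { eapply Rle_trans; [exact H|]. rewrite E0, E3, Hes, <- Ec, cos_plus. apply Req_le.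
        destruct He1; subst e.
        - replace (- (1) * bb * l) with (- (bb * l)) by ring. rewrite cos_neg, sin_neg. ring.
        - replace (- (-1) * bb * l) with (bb * l) by ring. ring. }
      set (w := tau - l). assert (Hw : 0 < w <= tau) by (unfold w; lra).
      replace (ah + bb * l) with (f0 - bb * w) in H'
        by (unfold w; rewrite Rmult_minus_distr_l, Hbt; ring).
      rewrite cos_minus in H'.
      replace (rho * (cos f0 * cos (bb * w) + sin f0 * sin (bb * w))) with
        (rho * cos f0 * cos (bb * w) + rho * sin f0 * sin (bb * w)) in H' by ring.
      rewrite Hc, Hsn in H'.
      assert (Hbw : 0 < bb * w < w).
      { split; [apply Rmult_lt_0_compat; lra|].
        rewrite <- (Rmult_1_l w) at 2. apply Rmult_lt_compat_r; lra. }
      assert (Hsb : 0 <= sin (bb * w)) by (apply sin_ge_0; lra).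
      (* At [l = 0] the factor [sin l], which makes the later identity strict, vanishes, and so does
         [sin w] when [tau = PI]. *)
      destruct (Req_dec l 0) as [->|Hln].
      * replace w with tau in * by (unfold w; ring). rewrite cos_0 in H'.
        assert (cos (tau - bb * tau) < 1).
        { rewrite <- cos_0. apply cos_decreasing_1; lra. }
        rewrite cos_minus in H0.
        assert (B := scal_between s (sin tau * sin (bb * tau)) Hs ltac:(apply Rmult_le_pos; auto)). lra.
      * assert (Hw2 : w < tau) by (unfold w; lra).
        assert (Hsw : 0 < sin w) by (apply sin_gt_0; lra).
        assert (Hsl : 0 < sin l) by (apply sin_gt_0; lra).
        assert (Hcc : cos w < cos (bb * w)) by (apply cos_decreasing_1; lra).
        assert (El : cos l = cos tau * cos w + sin tau * sin w)
          by (replace l with (tau - w) by (unfold w; ring); apply cos_minus).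
        assert (Esl : sin l = sin tau * cos w - cos tau * sin w)
          by (replace l with (tau - w) by (unfold w; ring); apply sin_minus).
        assert (K : 0 <= 1 - cos w * cos (bb * w) - s * sin w * sin (bb * w)).
        { assert (B := COS_bound (w - bb * w)). rewrite cos_minus in B.
          assert (B' := scal_between s (sin w * sin (bb * w)) Hs ltac:(apply Rmult_le_pos; lra)). lra. }
        (* Multiplied by [sin w], the deficit becomes a sum of two terms of visible sign, the first
           one strictly positive. *)
        assert (I : sin w * (cos l - (cos tau * cos (bb * w) + s * sin tau * sin (bb * w))) =
           sin l * (cos (bb * w) - cos w) +
           sin tau * (1 - cos w * cos (bb * w) - s * sin w * sin (bb * w))).
        { rewrite El, Esl. assert (S2 := sin2_cos2 w). unfold Rsqr in S2.
          replace 1 with (sin w * sin w + cos w * cos w). ring. }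
        assert (0 < sin l * (cos (bb * w) - cos w)) by (apply Rmult_lt_0_compat; lra).
        assert (0 <= sin tau * (1 - cos w * cos (bb * w) - s * sin w * sin (bb * w)))
          by (apply Rmult_le_pos; auto).
        assert (sin w * (cos l - (cos tau * cos (bb * w) + s * sin tau * sin (bb * w))) <= sin w * 0)
          by (apply Rmult_le_compat_l; lra).
        lra.
  - specialize (Hal2 He).
    destruct (length_bound_shrunk I1 I3 eta HI3 HI Heta s c v a b He (proj1 Hs) Hcv Hab HS Ha)
      as (l & th & Hl & Hlen & Hl2).
    assert (Hest : 0 <= eta * s * tau) by (repeat apply Rmult_le_pos; lra).
    assert (Hf2 : f0 <= PI / 2) by (unfold al in Hal2; lra).
    (* [f0 <= PI / 2] makes [cos tau = rho cos f0] nonnegative. *)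
    assert (Htau : tau <= PI / 2).
    { destruct (Rle_lt_dec tau (PI / 2)); auto.
      assert (cos tau < 0) by (apply cos_lt_0; lra).
      assert (0 <= rho * cos f0) by (apply Rmult_le_pos; auto; apply cos_ge_0; lra). lra. }
    assert (Goal1 : tau * (1 + eta * s ^ 2) <= l + s * Rabs th).
    { assert (Hab0 := Rabs_pos th).
      assert (Eq : tau * (1 + eta * s ^ 2) = tau + s * (al - f0)) by (unfold al; ring).
      rewrite Eq.
      destruct (Rle_lt_dec l PI) as [HlP|HlP].
      2:{ assert (s * (al - f0) <= 1 * (PI / 2)) by (apply Rmult_le_compat; lra || (unfold al; lra)).
          assert (0 <= s * Rabs th) by (apply Rmult_le_pos; lra). lra. }
      specialize (Hl2 HlP).
      set (f := ak - th) in *.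
      assert (Hfb := COS_bound f). assert (Hfh := acos_bound (cos f)).
      destruct (acos_cos_sin f) as [e [He1 Hes]].
      set (fh := acos (cos f)) in *. assert (Ec : cos fh = cos f) by (apply cos_acos; lra).
      assert (Hl3 : cos l <= rho * cos fh).
      { eapply Rle_trans; [exact Hl2|]. rewrite Ec, E0, E3. unfold f. rewrite cos_minus.
        apply Req_le; ring. }
      (* Triangle inequality for folded angles: [ak = th + f], and the distance of [ak] from 0 is at
         least [al]. *)
      assert (Htf : al <= Rabs th + fh).
      { destruct (Rle_lt_dec al (Rabs th + fh)) as [|Hlt]; auto. exfalso.
        assert (Hcos : cos al < cos (Rabs th + fh)) by (apply cos_decreasing_1; lra).
        assert (Hge : cos (Rabs th + fh) <= cos ak).
        { replace ak with (th + f) by (unfold f; ring). rewrite !cos_plus, Hes, Ec.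
          assert (Hsf : 0 <= sin fh) by (apply sin_ge_0; lra).
          assert (Hsa : 0 <= sin (Rabs th)) by (apply sin_ge_0; lra).
          assert (Ect : cos (Rabs th) = cos th)
            by (unfold Rabs; destruct (Rcase_abs th); auto using cos_neg).
          rewrite Ect.
          assert (sin th = sin (Rabs th) \/ sin th = - sin (Rabs th)) as [->| ->].
          { unfold Rabs; destruct (Rcase_abs th); auto. right. rewrite sin_neg. ring. }
          - assert (0 <= sin (Rabs th) * sin fh) by (apply Rmult_le_pos; auto). destruct He1; subst e; nra.
          - assert (0 <= sin (Rabs th) * sin fh) by (apply Rmult_le_pos; auto). destruct He1; subst e; nra. }
        lra. }
      destruct (Rle_lt_dec fh (PI / 2)) as [Hfh2|Hfh2].
      - assert (A := round_distance_support s tau rho f0 (fh - f0) Hs ltac:(lra) (proj1 Hf) Hr Hc Hsn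
          ltac:(lra) Hf2).
        replace (f0 + (fh - f0)) with fh in A by ring.
        assert (B : tau + s * (fh - f0) <= l).
        { destruct (Rle_lt_dec (tau + s * (fh - f0)) l) as [|Hlt]; auto. exfalso.
          assert (cos (tau + s * (fh - f0)) < cos l).
          { assert (s * (fh - f0) <= s * (PI / 2)) by (apply Rmult_le_compat_l; lra).
            assert (B := scal_between s (PI / 2) Hs ltac:(lra)). apply cos_decreasing_1; lra. }
          lra. }
        assert (s * (al - Rabs th) <= s * fh) by (apply Rmult_le_compat_l; lra). lra.
      (* Past the quarter turn [cos fh < 0] forces [l >= PI / 2], and the supporting line is used at
         its far end [PI / 2]. *)
      - assert (A := round_distance_support s tau rho f0 (PI / 2 - f0) Hs ltac:(lra) (proj1 Hf) Hr Hc Hsn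
          ltac:(lra) Hf2).
        replace (f0 + (PI / 2 - f0)) with (PI / 2) in A by ring. rewrite cos_PI2, Rmult_0_r in A.
        assert (B : tau + s * (PI / 2 - f0) <= PI / 2).
        { destruct (Rle_lt_dec (tau + s * (PI / 2 - f0)) (PI / 2)) as [|Hlt]; auto. exfalso.
          assert (cos (tau + s * (PI / 2 - f0)) < 0) 
            by (assert (B := scal_between s (PI / 2 - f0) Hs ltac:(lra)); apply cos_lt_0; lra).
          lra. }
        assert (C : PI / 2 <= l).
        { destruct (Rle_lt_dec (PI / 2) l) as [|Hlt]; auto. exfalso.
          assert (0 < cos l) by (apply cos_gt_0; lra).
          assert (cos fh < 0) by (apply cos_lt_0; lra). nra. }
        assert (s * (al - f0) <= s * (PI / 2 - f0)) by (apply Rmult_le_compat_l; lra).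
        assert (0 <= s * Rabs th) by (apply Rmult_le_pos; lra). lra. }
    apply (Rmult_le_reg_r (sqrt (1 + eta * s ^ 2))); auto.
    eapply Rle_trans; [|exact Hlen].
    replace (2 * sqrt I1 * sqrt (1 + eta * s ^ 2) * tau * sqrt (1 + eta * s ^ 2)) with
      (2 * sqrt I1 * (tau * sqrt (1 + eta * s ^ 2) ^ 2)) by ring.
    rewrite pow2_sqrt by lra. apply Rmult_le_compat_l; lra.
Qed.

End Minimality.

(** * Isometries *)

Lemma P4_eq (x y : P4) : qc0 x = qc0 y -> qc1 x = qc1 y -> qc2 x = qc2 y -> qc3 x = qc3 y -> x = y.
Proof. destruct x, y; simpl; intros; subst; reflexivity. Qed.

Lemma cos2_sin2 (x : R) : cos x ^ 2 + sin x ^ 2 = 1.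
Proof. assert (H := sin2_cos2 x). unfold Rsqr in H. lra. Qed.

Definition qscal (k : R) (x : P4) : P4 := mkP4 (k * qc0 x) (k * qc1 x) (k * qc2 x) (k * qc3 x).

Definition qadd (x y : P4) : P4 :=
  mkP4 (qc0 x + qc0 y) (qc1 x + qc1 y) (qc2 x + qc2 y) (qc3 x + qc3 y).

Definition qmul (n x : P4) : P4 :=
  mkP4 (qc0 n * qc0 x - qc1 n * qc1 x - qc2 n * qc2 x - qc3 n * qc3 x)
       (qc0 n * qc1 x + qc1 n * qc0 x + qc2 n * qc3 x - qc3 n * qc2 x)
       (qc0 n * qc2 x - qc1 n * qc3 x + qc2 n * qc0 x + qc3 n * qc1 x)
       (qc0 n * qc3 x + qc1 n * qc2 x - qc2 n * qc1 x + qc3 n * qc0 x).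

Definition qconj (x : P4) : P4 := mkP4 (qc0 x) (- qc1 x) (- qc2 x) (- qc3 x).

(** The map (z, w) -> (e^{ia} z, e^{ib} w). As quaternions it is left multiplication by exp((a+b)/2
    k) followed by right multiplication by exp((a-b)/2 k); the deck group consists of such maps. *)
Definition torus (a b : R) (x : P4) : P4 :=
  mkP4 (cos a * qc0 x - sin a * qc3 x) (cos b * qc1 x - sin b * qc2 x)
       (sin b * qc1 x + cos b * qc2 x) (sin a * qc0 x + cos a * qc3 x).

Lemma act_torus (p q k : Z) (x : P4) :
  act p q k x = torus (2 * PI * IZR k / IZR p) (2 * PI * IZR (k * q) / IZR p) x.
Proof. reflexivity. Qed.

Lemma torus_onS3 (a b : R) (x : P4) : onS3 (torus a b x) <-> onS3 x.
Proof.
  unfold onS3, torus; simpl qc0; simpl qc1; simpl qc2; simpl qc3.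
  replace ((cos a * qc0 x - sin a * qc3 x) ^ 2 + (cos b * qc1 x - sin b * qc2 x) ^ 2 +
   (sin b * qc1 x + cos b * qc2 x) ^ 2 + (sin a * qc0 x + cos a * qc3 x) ^ 2) with
   ((cos a ^ 2 + sin a ^ 2) * (qc0 x ^ 2 + qc3 x ^ 2) +
    (cos b ^ 2 + sin b ^ 2) * (qc1 x ^ 2 + qc2 x ^ 2)) by ring.
  rewrite !cos2_sin2. split; intros H; lra.
Qed.

Lemma qmul_onS3 (n x : P4) : onS3 n -> onS3 x -> onS3 (qmul n x).
Proof.
  unfold onS3, qmul; simpl qc0; simpl qc1; simpl qc2; simpl qc3. intros Hn Hx.
  transitivity ((qc0 n ^ 2 + qc1 n ^ 2 + qc2 n ^ 2 + qc3 n ^ 2) *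
                (qc0 x ^ 2 + qc1 x ^ 2 + qc2 x ^ 2 + qc3 x ^ 2)); [ring|].
  rewrite Hn, Hx; ring.
Qed.

(** The left factor does not change the trivialised velocity; the right one rotates its first two
    components by the angle [a - b] and fixes the third. The equal weights [I1] make this an
    isometry. *)
Lemma torus_la (a b : R) (x v : P4) :
  la3 (torus a b x) (torus a b v) = la3 x v /\
  la1 (torus a b x) (torus a b v) ^ 2 + la2 (torus a b x) (torus a b v) ^ 2 =
    la1 x v ^ 2 + la2 x v ^ 2.
Proof.
  assert (Ea := cos2_sin2 a). assert (Eb := cos2_sin2 b).
  assert (E : la1 (torus a b x) (torus a b v) =
     cos (a - b) * la1 x v + sin (a - b) * la2 x v /\
     la2 (torus a b x) (torus a b v) =
     cos (a - b) * la2 x v - sin (a - b) * la1 x v).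
  { rewrite cos_minus, sin_minus. unfold la1, la2, torus; simpl. split; ring. }
  destruct E as [-> ->]. assert (Eab := cos2_sin2 (a - b)). split.
  - transitivity ((cos a ^ 2 + sin a ^ 2) * (qc0 x * qc3 v - qc3 x * qc0 v) -
                  (cos b ^ 2 + sin b ^ 2) * (qc1 x * qc2 v - qc2 x * qc1 v)).
    + unfold la3, torus; simpl; ring.
    + rewrite Ea, Eb; unfold la3; ring.
  - transitivity ((cos (a - b) ^ 2 + sin (a - b) ^ 2) * (la1 x v ^ 2 + la2 x v ^ 2)); [ring|].
    rewrite Eab; ring.
Qed.

Lemma torus_speed2 (I1 I3 a b : R) (x v : P4) :
  speed2 I1 I3 (torus a b x) (torus a b v) = speed2 I1 I3 x v.
Proof. rewrite !speed2E. destruct (torus_la a b x v) as [-> ->]. reflexivity. Qed.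

Lemma qmul_la (n x v : P4) : onS3 n ->
  la1 (qmul n x) (qmul n v) = la1 x v /\ la2 (qmul n x) (qmul n v) = la2 x v /\
  la3 (qmul n x) (qmul n v) = la3 x v.
Proof.
  unfold onS3; intros Hn. set (m := qc0 n ^ 2 + qc1 n ^ 2 + qc2 n ^ 2 + qc3 n ^ 2) in *.
  repeat split.
  - transitivity (m * la1 x v); [unfold m, la1, qmul; simpl; ring|rewrite Hn; ring].
  - transitivity (m * la2 x v); [unfold m, la2, qmul; simpl; ring|rewrite Hn; ring].
  - transitivity (m * la3 x v); [unfold m, la3, qmul; simpl; ring|rewrite Hn; ring].
Qed.

Lemma qmul_speed2 (I1 I3 : R) (n x v : P4) : onS3 n ->
  speed2 I1 I3 (qmul n x) (qmul n v) = speed2 I1 I3 x v.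
Proof. intros Hn. rewrite !speed2E. destruct (qmul_la n x v Hn) as [-> [-> ->]]. reflexivity. Qed.

Lemma C1with_torus (a b : R) (c v : R -> P4) : C1with c v ->
  C1with (fun t => torus a b (c t)) (fun t => torus a b (v t)).
Proof.
  intros [(H0 & H1 & H2 & H3) (K0 & K1 & K2 & K3)].
  refine (conj (conj _ (conj _ (conj _ _))) (conj _ (conj _ (conj _ _)))); simpl; try cts;
    intros t; specialize (H0 t); specialize (H1 t); specialize (H2 t); specialize (H3 t); der; ring.
Qed.

Lemma C1with_qmul (n : P4) (c v : R -> P4) : C1with c v ->
  C1with (fun t => qmul n (c t)) (fun t => qmul n (v t)).
Proof.
  intros [(H0 & H1 & H2 & H3) (K0 & K1 & K2 & K3)].
  refine (conj (conj _ (conj _ (conj _ _))) (conj _ (conj _ (conj _ _)))); simpl; try cts;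
    intros t; specialize (H0 t); specialize (H1 t); specialize (H2 t); specialize (H3 t); der; ring.
Qed.

Lemma len_torus (I1 I3 a b : R) (c v : R -> P4) (t0 t1 : R) : C1with c v ->
  len I1 I3 (fun t => torus a b (c t)) t0 t1 = len I1 I3 c t0 t1.
Proof.
  intros H. rewrite (lenE _ _ (C1with_torus a b c v H)), (lenE _ _ H).
  apply RInt_ext. intros t _. now rewrite torus_speed2.
Qed.

Lemma len_qmul (I1 I3 : R) (n : P4) (c v : R -> P4) (t0 t1 : R) : C1with c v -> onS3 n ->
  len I1 I3 (fun t => qmul n (c t)) t0 t1 = len I1 I3 c t0 t1.
Proof.
  intros H Hn. rewrite (lenE _ _ (C1with_qmul n c v H)), (lenE _ _ H).
  apply RInt_ext. intros t _. now rewrite qmul_speed2.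
Qed.

Lemma len_ge0 (I1 I3 : R) (c v : R -> P4) (a b : R) : C1with c v -> a <= b -> 0 <= len I1 I3 c a b.
Proof.
  intros H Hab. rewrite (lenE _ _ H). apply RInt_ctn_ge0; auto; [now apply ctn_sqrt_speed2|].
  intros; apply sqrt_pos.
Qed.

(** * Concatenation *)

Lemma speed2_qscal (I1 I3 k : R) (x v : P4) :
  speed2 I1 I3 x (qscal k v) = k ^ 2 * speed2 I1 I3 x v.
Proof. rewrite !speed2E. unfold la1, la2, la3, qscal; simpl; ring. Qed.

(* Both pieces are reparametrised to reach the junction with zero velocity, so that
   the corner does not prevent the concatenation from being C^1. *)
Lemma concat_curves (I1 I3 : R) (c1 v1 c2 v2 : R -> P4) (a1 b1 a2 b2 : R) :
  C1with c1 v1 -> C1with c2 v2 -> a1 <= b1 -> a2 <= b2 ->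
  (forall t, a1 <= t <= b1 -> onS3 (c1 t)) -> (forall t, a2 <= t <= b2 -> onS3 (c2 t)) ->
  c1 b1 = c2 a2 ->
  exists c, admissible c 0 2 (c1 a1) (c2 b2) /\
    len I1 I3 c 0 2 = len I1 I3 c1 a1 b1 + len I1 I3 c2 a2 b2.
Proof.
  intros H1 H2 Hab1 Hab2 S1 S2 E.
  set (h1 := fun t => b1 - (b1 - a1) * (1 - t) ^ 2).
  set (dh1 := fun t => 2 * (b1 - a1) * (1 - t)).
  set (h2 := fun t => a2 + (b2 - a2) * (t - 1) ^ 2).
  set (dh2 := fun t => 2 * (b2 - a2) * (t - 1)).
  assert (D1 : forall t, is_derive h1 t (dh1 t)) by (intros t; unfold h1, dh1; der; ring).
  assert (D2 : forall t, is_derive h2 t (dh2 t)) by (intros t; unfold h2, dh2; der; ring).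
  assert (K1 : ctn dh1) by (unfold dh1; cts). assert (K2 : ctn dh2) by (unfold dh2; cts).
  assert (L1 := ctn_derive _ _ D1). assert (L2 := ctn_derive _ _ D2).
  assert (h11 : h1 1 = b1) by (unfold h1; ring). assert (h21 : h2 1 = a2) by (unfold h2; ring).
  assert (d11 : dh1 1 = 0) by (unfold dh1; ring). assert (d21 : dh2 1 = 0) by (unfold dh2; ring).
  set (gl := fun (pr : P4 -> R) => glue 1 (fun t => pr (c1 (h1 t))) (fun t => pr (c2 (h2 t)))).
  set (dgl := fun (pr : P4 -> R) => glue 1 (fun t => dh1 t * pr (v1 (h1 t))) (fun t => dh2 t * pr (v2 (h2 t)))).
  set (c := fun t => mkP4 (gl qc0 t) (gl qc1 t) (gl qc2 t) (gl qc3 t)).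
  set (v := fun t => mkP4 (dgl qc0 t) (dgl qc1 t) (dgl qc2 t) (dgl qc3 t)).
  assert (Gd : forall pr : P4 -> R,
     (forall t, is_derive (fun s => pr (c1 s)) t (pr (v1 t))) ->
     (forall t, is_derive (fun s => pr (c2 s)) t (pr (v2 t))) ->
     forall t, is_derive (gl pr) t (dgl pr t)).
  { intros pr A B. apply is_derive_glue.
    - intros t. apply (der_comp (fun s => pr (c1 s)) h1); auto.
    - intros t. apply (der_comp (fun s => pr (c2 s)) h2); auto.
    - now rewrite h11, h21, E.
    - rewrite d11, d21; ring. }
  assert (Gc : forall pr : P4 -> R, ctn (fun t => pr (v1 t)) -> ctn (fun t => pr (v2 t)) -> ctn (dgl pr)).
  { intros pr A B. apply ctn_glue.
    - apply ctn_mult; auto. apply (ctn_comp (fun s => pr (v1 s)) h1); auto.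
    - apply ctn_mult; auto. apply (ctn_comp (fun s => pr (v2 s)) h2); auto.
    - rewrite d11, d21; ring. }
  assert (Hcv : C1with c v).
  { destruct H1 as [(A0 & A1 & A2 & A3) (B0 & B1 & B2 & B3)].
    destruct H2 as [(A0' & A1' & A2' & A3') (B0' & B1' & B2' & B3')].
    refine (conj (conj _ (conj _ (conj _ _))) (conj _ (conj _ (conj _ _)))).
    - exact (Gd qc0 A0 A0').
    - exact (Gd qc1 A1 A1').
    - exact (Gd qc2 A2 A2').
    - exact (Gd qc3 A3 A3').
    - exact (Gc qc0 B0 B0').
    - exact (Gc qc1 B1 B1').
    - exact (Gc qc2 B2 B2').
    - exact (Gc qc3 B3 B3'). }
  assert (Ecl : forall t, t <= 1 -> c t = c1 (h1 t) /\ v t = qscal (dh1 t) (v1 (h1 t))).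
  { intros t Ht. unfold c, v, gl, dgl, glue. destruct (Rle_dec t 1); [|lra].
    destruct (c1 (h1 t)); split; reflexivity. }
  assert (Ecr : forall t, 1 < t -> c t = c2 (h2 t) /\ v t = qscal (dh2 t) (v2 (h2 t))).
  { intros t Ht. unfold c, v, gl, dgl, glue. destruct (Rle_dec t 1); [lra|].
    destruct (c2 (h2 t)); split; reflexivity. }
  exists c. split.
  - split; [lra|]. split; [exact (C1with_C1curve c v Hcv)|]. split; [|split].
    + intros t Ht. destruct (Rle_lt_dec t 1) as [Hl|Hg].
      * destruct (Ecl t Hl) as [-> _]. apply S1. unfold h1.
        assert (0 <= (1 - t) ^ 2 <= 1) by (split; nra). split; nra.
      * destruct (Ecr t Hg) as [-> _]. apply S2. unfold h2.
        assert (0 <= (t - 1) ^ 2 <= 1) by (split; nra). split; nra.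
    + destruct (Ecl 0 ltac:(lra)) as [-> _]. f_equal. unfold h1; ring.
    + destruct (Ecr 2 ltac:(lra)) as [-> _]. f_equal. unfold h2; ring.
  - rewrite (lenE c v Hcv), (lenE c1 v1 H1), (lenE c2 v2 H2).
    rewrite <- (RInt_ctn_Chasles _ 0 1 2) by (now apply ctn_sqrt_speed2).
    f_equal.
    + rewrite (RInt_ext _ (fun t => dh1 t * sqrt (speed2 I1 I3 (c1 (h1 t)) (v1 (h1 t))))).
      * rewrite (RInt_comp_ctn (fun t => sqrt (speed2 I1 I3 (c1 t) (v1 t))) h1 dh1) by
          (auto; now apply ctn_sqrt_speed2).
        f_equal; [unfold h1; ring|exact h11].
      * intros t Ht. rewrite Rmin_left, Rmax_right in Ht by lra.
        destruct (Ecl t ltac:(lra)) as [-> ->]. rewrite speed2_qscal.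
        assert (0 <= dh1 t) by (unfold dh1; nra).
        rewrite sqrt_mult_alt by apply pow2_ge_0. rewrite sqrt_pow2 by auto. reflexivity.
    + rewrite (RInt_ext _ (fun t => dh2 t * sqrt (speed2 I1 I3 (c2 (h2 t)) (v2 (h2 t))))).
      * rewrite (RInt_comp_ctn (fun t => sqrt (speed2 I1 I3 (c2 t) (v2 t))) h2 dh2) by
          (auto; now apply ctn_sqrt_speed2).
        f_equal; [exact h21|unfold h2; ring].
      * intros t Ht. rewrite Rmin_left, Rmax_right in Ht by lra.
        destruct (Ecr t ltac:(lra)) as [-> ->]. rewrite speed2_qscal.
        assert (0 <= dh2 t) by (unfold dh2; nra).
        rewrite sqrt_mult_alt by apply pow2_ge_0. rewrite sqrt_pow2 by auto. reflexivity.
Qed.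

(** A shorter curve to a lift of the point at [t'], continued by the corresponding translate of the
    remaining piece of [g], would be shorter at [t]. *)
Lemma minimizingL_prefix (p q : Z) (I1 I3 : R) (g v : R -> P4) (t t' : R) :
  C1with g v -> (forall u, 0 <= u -> onS3 (g u)) -> 0 <= t' <= t ->
  minimizingL p q I1 I3 g t -> minimizingL p q I1 I3 g t'.
Proof.
  intros Hg HS Ht Hm k c a b (Hab & Hc & Hcs & Ha & Hb).
  set (th := 2 * PI * IZR k / IZR p). set (ph := 2 * PI * IZR (k * q) / IZR p).
  destruct (concat_curves I1 I3 c (velocity c) (fun u => torus th ph (g u)) (fun u => torus th ph (v u))
    a b t' t (C1curve_C1with c Hc) (C1with_torus th ph g v Hg) Hab (proj2 Ht) Hcs) as [d [Hd Hl]].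
  - intros u Hu. apply torus_onS3, HS; lra.
  - exact Hb.
  - rewrite Ha in Hd. assert (M := Hm k d 0 2 Hd). rewrite Hl in M.
    rewrite (len_torus I1 I3 th ph g v t' t Hg) in M.
    rewrite <- (len_Chasles g v Hg I1 I3 0 t' t) in M. lra.
Qed.

(** * First variation along Killing fields *)

Definition qi : P4 := mkP4 0 1 0 0.
Definition qj : P4 := mkP4 0 0 1 0.
Definition qk : P4 := mkP4 0 0 0 1.

Definition unit_axis (n : P4) : Prop := n = qi \/ n = qj \/ n = qk.

(** The metric as an inner product. For [w = qmul n x], the Killing field of left translations, its
    value on the velocity is the Noether momentum along [n]. *)
Definition bform (I1 I3 : R) (x v w : P4) : R :=
  4 * (I1 * (la1 x v * la1 x w + la2 x v * la2 x w) + I3 * (la3 x v * la3 x w)).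

Lemma speed2_add (I1 I3 k : R) (x v w : P4) :
  speed2 I1 I3 x (qadd v (qscal k w)) =
  speed2 I1 I3 x v + 2 * k * bform I1 I3 x v w + k ^ 2 * speed2 I1 I3 x w.
Proof. unfold bform. rewrite !speed2E. unfold la1, la2, la3, qadd, qscal; simpl; ring. Qed.

(** The exponential exp(f n) of a unit imaginary quaternion. *)
Definition qrot (n : P4) (f : R) : P4 :=
  mkP4 (cos f) (sin f * qc1 n) (sin f * qc2 n) (sin f * qc3 n).

Lemma qrot_onS3 (n : P4) (f : R) : unit_axis n -> onS3 (qrot n f).
Proof.
  intros [->|[->| ->]]; assert (H := cos2_sin2 f); unfold onS3, qrot; simpl in *; lra.
Qed.

Lemma la_axis (n x : P4) : unit_axis n -> onS3 x ->
  la1 x (qmul n x) ^ 2 + la2 x (qmul n x) ^ 2 + la3 x (qmul n x) ^ 2 = 1.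
Proof.
  unfold onS3; intros Hn Hx.
  transitivity ((qc0 x ^ 2 + qc1 x ^ 2 + qc2 x ^ 2 + qc3 x ^ 2) ^ 2); [|rewrite Hx; ring].
  destruct Hn as [->|[->| ->]]; unfold la1, la2, la3, qmul; simpl; ring.
Qed.

(** [n] commutes with exp(f n), so up to the left translation by exp(f n), an isometry, the velocity
    only gains the multiple f' of the Killing field. *)
Lemma C1with_variation (n : P4) (c v : R -> P4) (f df : R -> R) :
  unit_axis n -> C1with c v -> (forall t, is_derive f t (df t)) -> ctn df ->
  C1with (fun t => qmul (qrot n (f t)) (c t))
         (fun t => qmul (qrot n (f t)) (qadd (v t) (qscal (df t) (qmul n (c t))))).
Proof.
  intros Hn Hcv Hf Hdf. assert (Cf := ctn_derive f df Hf).
  assert (A0 := C1with_ctn0 c v Hcv). assert (A1 := C1with_ctn1 c v Hcv).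
  assert (A2 := C1with_ctn2 c v Hcv). assert (A3 := C1with_ctn3 c v Hcv).
  destruct Hcv as [(H0 & H1 & H2 & H3) (K0 & K1 & K2 & K3)].
  refine (conj (conj _ (conj _ (conj _ _))) (conj _ (conj _ (conj _ _)))); simpl; try cts;
    intros t; specialize (H0 t); specialize (H1 t); specialize (H2 t); specialize (H3 t);
    specialize (Hf t); (der; destruct Hn as [->|[->| ->]]; simpl; ring).
Qed.

Lemma ctn_bform (I1 I3 : R) (n : P4) (c v : R -> P4) : C1with c v ->
  ctn (fun t => bform I1 I3 (c t) (v t) (qmul n (c t))).
Proof.
  intros Hcv.
  assert (A1 := ctn_la1 c v Hcv). assert (A2 := ctn_la2 c v Hcv). assert (A3 := ctn_la3 c v Hcv).
  assert (B0 := C1with_ctn0 c v Hcv). assert (B1 := C1with_ctn1 c v Hcv).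
  assert (B2 := C1with_ctn2 c v Hcv). assert (B3 := C1with_ctn3 c v Hcv).
  unfold bform. cts; unfold la1, la2, la3, qmul; cbn [qc0 qc1 qc2 qc3]; cts.
Qed.

Lemma speed2_of_unit_speed (I1 I3 : R) (c : R -> P4) (t : R) : 0 < I1 -> 0 < I3 ->
  speed I1 I3 c t = 1 -> speed2 I1 I3 (c t) (velocity c t) = 1.
Proof.
  intros H1 H3 E. unfold speed in E.
  rewrite <- (pow2_sqrt (speed2 I1 I3 (c t) (velocity c t))) by (now apply speed2_ge0).
  rewrite E; ring.
Qed.

Lemma unit_speed_len (I1 I3 : R) (c v : R -> P4) (a b : R) : C1with c v -> a <= b ->
  (forall t, a <= t <= b -> speed2 I1 I3 (c t) (v t) = 1) -> len I1 I3 c a b = b - a.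
Proof.
  intros Hcv Hab Hsp. rewrite (lenE c v Hcv). rewrite (RInt_ext _ (fun _ => 1)).
  - rewrite RInt_R_const. apply Rmult_1_l.
  - intros t Ht. rewrite Rmin_left, Rmax_right in Ht by lra. rewrite Hsp by lra. apply sqrt_1.
Qed.

Section Variation.
Variables (I1 I3 : R).
Hypotheses (HI1 : 0 < I1) (HI3 : 0 < I3).

(** The tangent line of the root keeps the exact first-order term. The Killing field has unit round
    length, so its squared Berger length is at most [4 (I1 + I3)], half of which remains in the
    quadratic term. *)
Lemma variation_length (n : P4) (c v : R -> P4) (f df : R -> R) (a b : R) :
  unit_axis n -> C1with c v -> (forall t, is_derive f t (df t)) -> ctn df -> a <= b ->
  (forall t, a <= t <= b -> onS3 (c t)) ->
  (forall t, a <= t <= b -> speed2 I1 I3 (c t) (v t) = 1) ->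
  len I1 I3 (fun t => qmul (qrot n (f t)) (c t)) a b <=
  (b - a) + RInt (fun t => df t * bform I1 I3 (c t) (v t) (qmul n (c t))) a b
          + 2 * (I1 + I3) * RInt (fun t => df t ^ 2) a b.
Proof.
  intros Hn Hcv Hf Hdf Hab HS Hsp.
  assert (Hv := C1with_variation n c v f df Hn Hcv Hf Hdf).
  assert (Hm := ctn_bform I1 I3 n c v Hcv).
  rewrite (lenE _ _ Hv).
  assert (E1 := RInt_R_const 1 a b). rewrite Rmult_1_l in E1. rewrite <- E1.
  rewrite <- RInt_ctn_plus by cts. rewrite <- RInt_ctn_scal by cts. rewrite <- RInt_ctn_plus by cts.
  apply RInt_ctn_le; auto; [now apply ctn_sqrt_speed2|cts|].
  intros t Ht. rewrite qmul_speed2 by now apply qrot_onS3.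
  assert (G := speed2_ge0 I1 I3 (c t) (qadd (v t) (qscal (df t) (qmul n (c t)))) HI1 HI3).
  assert (L := la_axis n (c t) Hn (HS t ltac:(lra))).
  rewrite speed2_add, Hsp in * by lra.
  set (m := bform I1 I3 (c t) (v t) (qmul n (c t))) in *.
  assert (B : speed2 I1 I3 (c t) (qmul n (c t)) <= 4 * (I1 + I3)).
  { rewrite speed2E. assert (P1 := pow2_ge_0 (la1 (c t) (qmul n (c t)))).
    assert (P2 := pow2_ge_0 (la2 (c t) (qmul n (c t)))).
    assert (P3 := pow2_ge_0 (la3 (c t) (qmul n (c t)))). nra. }
  set (k := speed2 I1 I3 (c t) (qmul n (c t))) in *.
  assert (Hd := pow2_ge_0 (df t)).
  replace (1 + 2 * df t * m + df t ^ 2 * k) with (1 + (2 * df t * m + df t ^ 2 * k)) by ring.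
  eapply Rle_trans; [apply sqrt_1px_le; lra|]. nra.
Qed.

(* The test function [f' = m - mean m] turns the first-order condition into
   [int (m - mean m)^2 = 0]. *)
Lemma momentum_locally_constant (n : P4) (c v : R -> P4) (a b : R) :
  unit_axis n -> C1with c v -> a < b ->
  (forall t, a <= t <= b -> onS3 (c t)) ->
  (forall t, a <= t <= b -> speed2 I1 I3 (c t) (v t) = 1) ->
  (forall d a' b', admissible d a' b' (c a) (c b) -> len I1 I3 c a b <= len I1 I3 d a' b') ->
  exists k, forall t, a < t < b -> bform I1 I3 (c t) (v t) (qmul n (c t)) = k.
Proof.
  intros Hn Hcv Hab HS Hsp Hmin.
  set (m := fun t => bform I1 I3 (c t) (v t) (qmul n (c t))).
  assert (Hm : ctn m) by now apply ctn_bform.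
  set (k := RInt m a b / (b - a)). exists k. fold m.
  set (d := fun t => m t - k). assert (Hd : ctn d) by (unfold d; cts).
  assert (Id : RInt d a b = 0).
  { assert (E : RInt m a b = RInt d a b + RInt (fun _ => k) a b).
    { rewrite <- RInt_ctn_plus by cts. apply RInt_ext. intros t _. unfold d.
      change (m t = m t - k + k). ring. }
    assert (Ek : k * (b - a) = RInt m a b)
      by (unfold k, Rdiv; rewrite Rmult_assoc, Rinv_l by lra; apply Rmult_1_r).
    rewrite RInt_R_const, Ek in E. lra. }
  set (A := RInt (fun t => d t ^ 2) a b).
  assert (Edm : RInt (fun t => d t * m t) a b = A).
  { assert (E : RInt (fun t => d t * m t) a b = A + k * RInt d a b).
    { unfold A. rewrite <- RInt_ctn_scal by cts. rewrite <- RInt_ctn_plus by cts.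
      apply RInt_ext. intros t _. unfold d. change ((m t - k) * m t = (m t - k) ^ 2 + k * (m t - k)). ring. }
    rewrite Id in E. lra. }
  assert (Len : len I1 I3 c a b = b - a) by (apply (unit_speed_len I1 I3 c v); auto; lra).
  assert (Var : forall e, 0 < e -> 0 <= - e * A + e ^ 2 * (2 * (I1 + I3) * A)).
  { intros e He.
    assert (Df : forall t, is_derive (fun u => - e * RInt d a u) t (- e * d t)).
    { intros t. eapply der_eq; [eapply der_mult; [apply der_const|now apply is_derive_RInt_ctn]|cbv beta; ring]. }
    assert (Ce : ctn (fun t => - e * d t)) by cts.
    assert (L := variation_length n c v _ _ a b Hn Hcv Df Ce ltac:(lra) HS Hsp).
    assert (E1 : RInt (fun t => - e * d t * bform I1 I3 (c t) (v t) (qmul n (c t))) a b = - e * A).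
    { rewrite <- Edm, <- RInt_ctn_scal by cts. apply RInt_ext. intros t _.
      change (- e * d t * m t = - e * (d t * m t)). ring. }
    assert (E2 : RInt (fun t => (- e * d t) ^ 2) a b = e ^ 2 * A).
    { unfold A. rewrite <- RInt_ctn_scal by cts. apply RInt_ext. intros t _.
      change ((- e * d t) ^ 2 = e ^ 2 * d t ^ 2). ring. }
    cbv beta in L. rewrite E1, E2 in L.
    set (ce := fun t => qmul (qrot n (- e * RInt d a t)) (c t)) in *.
    (* The angle vanishes at [a], and also at [b] because [d] has mean zero, so both endpoints are
       kept. *)
    assert (Adm : admissible ce a b (c a) (c b)).
    { assert (Id0 : forall x, qmul (qrot n 0) x = x).
      { intros x. apply P4_eq; unfold qrot, qmul; simpl; rewrite cos_0, sin_0; ring. }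
      split; [lra|]. split; [|split; [|split]].
      - exact (C1with_C1curve _ _ (C1with_variation n c v _ _ Hn Hcv Df Ce)).
      - intros t Ht. apply qmul_onS3; [now apply qrot_onS3|now apply HS].
      - unfold ce. rewrite RInt_R_point, Rmult_0_r. apply Id0.
      - unfold ce. rewrite Id, Rmult_0_r. apply Id0. }
    assert (M := Hmin ce a b Adm). rewrite Len in M. lra. }
  assert (A0 : A <= 0).
  { set (K := 2 * (I1 + I3)) in *. assert (HK : 0 < K) by (unfold K; lra).
    (* This [e] minimizes [- e + e^2 K], with value [- 1 / (4 K)]. *)
    assert (V := Var (/ (2 * K)) ltac:(apply Rinv_0_lt_compat; lra)).
    replace (- / (2 * K) * A + (/ (2 * K)) ^ 2 * (K * A)) with (- (A * / (4 * K))) in V by (field; lra).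
    assert (0 < / (4 * K)) by (apply Rinv_0_lt_compat; lra). nra. }
  intros t Ht.
  assert (Z := RInt_ctn_eq0 (fun t => d t ^ 2) a b ltac:(cts) ltac:(lra)
    (fun u _ => pow2_ge_0 (d u)) A0 t Ht). cbv beta in Z.
  assert (d t = 0) by nra. unfold d in H. change (m t = k). lra.
Qed.

End Variation.

(** * The geodesic equation *)

(* With the conserved left momentum [M] (a pure quaternion), geodesics solve the linear
   equation [x' = M x + eta m3 x k]. *)
Definition geo_rhs (eta : R) (M x : P4) : P4 := qadd (qmul M x) (qscal (eta * qc3 M) (qmul x qk)).

(** The last clause says that the k component of conj(x) M x equals that of M. It holds at the
    identity and is propagated by the flow, but the linear equation at a single point does not give
    it. *)
Definition geo (eta : R) (M : P4) (c v : R -> P4) : Prop :=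
  forall t, onS3 (c t) /\ v t = geo_rhs eta M (c t) /\ la3 (c t) (v t) = (1 + eta) * qc3 M.

Lemma geo_la (eta : R) (M x : P4) : qc0 M = 0 -> onS3 x ->
  la1 x (geo_rhs eta M x) = la1 x (qmul M x) /\ la2 x (geo_rhs eta M x) = la2 x (qmul M x) /\
  la3 x (geo_rhs eta M x) = la3 x (qmul M x) + eta * qc3 M.
Proof.
  intros HM Hx. unfold onS3 in Hx. repeat split.
  - unfold la1, geo_rhs, qadd, qscal, qmul; simpl; ring.
  - unfold la2, geo_rhs, qadd, qscal, qmul; simpl; ring.
  - transitivity (la3 x (qmul M x) + eta * qc3 M * (qc0 x ^ 2 + qc1 x ^ 2 + qc2 x ^ 2 + qc3 x ^ 2)).
    + unfold la3, geo_rhs, qadd, qscal, qmul; simpl; ring.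
    + rewrite Hx; ring.
Qed.

(** [la1], [la2], [la3] of [x] and [M x] are the coordinates of conj(x) M x, and conjugation by a
    unit quaternion preserves inner products. *)
Lemma adjoint_dot (M n x : P4) : qc0 M = 0 -> qc0 n = 0 -> onS3 x ->
  la1 x (qmul M x) * la1 x (qmul n x) + la2 x (qmul M x) * la2 x (qmul n x) +
  la3 x (qmul M x) * la3 x (qmul n x) = la0 M n.
Proof.
  intros HM Hn Hx. unfold onS3 in Hx.
  transitivity ((qc0 x ^ 2 + qc1 x ^ 2 + qc2 x ^ 2 + qc3 x ^ 2) ^ 2 * la0 M n); [|rewrite Hx; ring].
  unfold la0, la1, la2, la3, qmul; simpl. rewrite HM, Hn. ring.
Qed.

(** The length of the momentum vector for unit speed when [s] is the cosine of its angle with the k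
    axis; the parameter is [tau = frequency I1 eta s * t]. *)
Definition frequency (I1 eta s : R) : R := / (2 * sqrt I1 * sqrt (1 + eta * s ^ 2)).

(* The unit-speed geodesic [exp(t M) exp(t eta m3 k)] with
   [M = omega (r cos psi, r sin psi, s)]; in the coordinates (z, w) it reads
   [z = (cos tau + i s sin tau) e^{i d}], [w = r sin tau e^{i (psi - d)}]. *)
Definition geodesic (I1 eta s psi t : R) : P4 :=
  let r := sqrt (1 - s ^ 2) in
  let tau := frequency I1 eta s * t in
  let d := eta * s * tau in
  mkP4 (cos tau * cos d - s * sin tau * sin d) (r * sin tau * cos (psi - d))
       (r * sin tau * sin (psi - d)) (cos tau * sin d + s * sin tau * cos d).

Definition geodesic_momentum (I1 eta s psi : R) : P4 :=
  mkP4 0 (frequency I1 eta s * sqrt (1 - s ^ 2) * cos psi)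
         (frequency I1 eta s * sqrt (1 - s ^ 2) * sin psi) (frequency I1 eta s * s).

Definition geodesic_velocity (I1 eta s psi t : R) : P4 :=
  geo_rhs eta (geodesic_momentum I1 eta s psi) (geodesic I1 eta s psi t).

Section Geodesics.
Variables (I1 I3 eta : R).
Hypotheses (HI3 : 0 < I3) (HI : I1 = I3 * (1 + eta)) (Heta : -1 < eta).

Lemma geo_momentum (M n x v : P4) : qc0 M = 0 -> qc0 n = 0 -> onS3 x ->
  v = geo_rhs eta M x -> la3 x v = (1 + eta) * qc3 M ->
  bform I1 I3 x v (qmul n x) = 4 * I1 * la0 M n.
Proof.
  intros HM Hn Hx -> H3. destruct (geo_la eta M x HM Hx) as (E1 & E2 & E3).
  unfold bform. rewrite <- (adjoint_dot M n x HM Hn Hx), E1, E2, H3, HI.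
  assert (la3 x (qmul M x) = qc3 M) by lra. rewrite H. ring.
Qed.

Lemma geo_speed2 (M x v : P4) : qc0 M = 0 -> onS3 x ->
  v = geo_rhs eta M x -> la3 x v = (1 + eta) * qc3 M ->
  speed2 I1 I3 x v = 4 * I1 * (qc1 M ^ 2 + qc2 M ^ 2 + (1 + eta) * qc3 M ^ 2).
Proof.
  intros HM Hx -> H3. destruct (geo_la eta M x HM Hx) as (E1 & E2 & E3).
  rewrite speed2E. assert (A := adjoint_dot M M x HM HM Hx). unfold la0 in A. rewrite HM in A.
  rewrite E1, E2, H3, HI.
  assert (B : la3 x (qmul M x) = qc3 M) by lra. rewrite B in A.
  transitivity (4 * (I3 * (1 + eta)) * (la1 x (qmul M x) * la1 x (qmul M x) + la2 x (qmul M x) * la2 x (qmul M x)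
     + qc3 M * qc3 M) + 4 * I3 * (1 + eta) * eta * qc3 M ^ 2); [ring|rewrite A; ring].
Qed.

Notation omega := (frequency I1 eta).
Notation geod := (geodesic I1 eta).
Notation geodM := (geodesic_momentum I1 eta).
Notation geodv := (geodesic_velocity I1 eta).

Lemma I1_pos : 0 < I1.
Proof. rewrite HI; apply Rmult_lt_0_compat; lra. Qed.

Lemma omega_pos (s : R) : -1 <= s <= 1 -> 0 < omega s.
Proof.
  intros Hs. unfold frequency. apply Rinv_0_lt_compat.
  assert (H := one_plus_pos eta s Heta Hs). assert (H2 := I1_pos).
  apply sqrt_lt_R0 in H. apply sqrt_lt_R0 in H2. apply Rmult_lt_0_compat; lra.
Qed.

Lemma omega_sqr (s : R) : -1 <= s <= 1 -> 4 * I1 * (omega s ^ 2 * (1 + eta * s ^ 2)) = 1.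
Proof.
  intros Hs. unfold frequency.
  assert (H := one_plus_pos eta s Heta Hs). assert (H2 := I1_pos).
  assert (E := sqrt_coeff I1 I3 eta HI3 HI Heta (1 + eta * s ^ 2) ltac:(lra)).
  assert (K := sqrt_lt_R0 _ H). assert (K2 := sqrt_lt_R0 _ H2).
  rewrite pow_inv, E. field. lra.
Qed.

Lemma geod_0 (s psi : R) : geod s psi 0 = idP.
Proof.
  unfold geodesic, idP. cbv zeta. replace (omega s * 0) with 0 by ring.
  replace (eta * s * 0) with 0 by ring. rewrite cos_0, sin_0. apply P4_eq; simpl; ring.
Qed.

Lemma ctn_geod (s psi : R) : ctn (fun t => qc0 (geod s psi t)) /\ ctn (fun t => qc1 (geod s psi t)) /\
  ctn (fun t => qc2 (geod s psi t)) /\ ctn (fun t => qc3 (geod s psi t)).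
Proof. unfold geodesic; simpl. repeat split; cts. Qed.

Lemma geod_C1 (s psi : R) : -1 <= s <= 1 -> C1with (geod s psi) (geodv s psi).
Proof.
  intros Hs. destruct (ctn_geod s psi) as (C0 & C1 & C2 & C3).
  assert (Hr : sqrt (1 - s ^ 2) ^ 2 = 1 - s ^ 2) by (apply pow2_sqrt; nra).
  assert (Hp := cos2_sin2 psi).
  refine (conj (conj _ (conj _ (conj _ _))) (conj _ (conj _ (conj _ _))));
    try (unfold geodesic_velocity, geo_rhs, qadd, qscal, qmul; simpl; cts; fail);
    intros t; unfold geodesic, geodesic_velocity, geo_rhs, qadd, qscal, qmul, geodesic_momentum, geodesic; simpl; der;
    rewrite ?cos_minus, ?sin_minus;
    set (r := sqrt (1 - s * (s * 1))) in *; set (ta := omega s * t);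
    set (ct := cos ta); set (st := sin ta); set (cd := cos (eta * s * ta)); set (sd := sin (eta * s * ta)).
  - transitivity (- omega s * (cos psi ^ 2 + sin psi ^ 2) * r ^ 2 * st * cd
                  - omega s * s * (1 + eta) * (ct * sd + s * st * cd)); [|unfold r; ring].
    unfold r. fold (s ^ 2). rewrite Hp, Hr. ring.
  - ring.
  - ring.
  - transitivity (- omega s * (cos psi ^ 2 + sin psi ^ 2) * r ^ 2 * st * sd
                  + omega s * s * (1 + eta) * (ct * cd - s * st * sd)); [|unfold r; ring].
    unfold r. fold (s ^ 2). rewrite Hp, Hr. ring.
Qed.

Lemma geod_geo (s psi : R) : -1 <= s <= 1 -> geo eta (geodM s psi) (geod s psi) (geodv s psi).
Proof.
  intros Hs t.
  assert (Hr : sqrt (1 - s ^ 2) ^ 2 = 1 - s ^ 2) by (apply pow2_sqrt; nra).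
  assert (Hp := cos2_sin2 psi).
  assert (HS : onS3 (geod s psi t)).
  { unfold onS3, geodesic; cbv zeta; cbn [qc0 qc1 qc2 qc3].
    set (ta := omega s * t). set (d := eta * s * ta). set (r := sqrt (1 - s ^ 2)) in *.
    transitivity ((cos ta ^ 2 + s ^ 2 * sin ta ^ 2) * (cos d ^ 2 + sin d ^ 2) +
       r ^ 2 * sin ta ^ 2 * (cos (psi - d) ^ 2 + sin (psi - d) ^ 2)); [ring|].
    rewrite !cos2_sin2, Hr. assert (E := cos2_sin2 ta). lra. }
  split; [exact HS|]. split; [reflexivity|].
  unfold geodesic_velocity. destruct (geo_la eta (geodM s psi) (geod s psi t) eq_refl HS) as (_ & _ & ->).
  simpl (qc3 (geodM s psi)).
  assert (E : la3 (geod s psi t) (qmul (geodM s psi) (geod s psi t)) = omega s * s); [|rewrite E; ring].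
  unfold onS3 in HS. 
  unfold la3, qmul, geodesic_momentum, geodesic in *; cbv zeta in *; cbn [qc0 qc1 qc2 qc3] in *.
  set (ta := omega s * t) in *. set (d := eta * s * ta) in *. set (r := sqrt (1 - s ^ 2)) in *.
  assert (Hd := cos2_sin2 d). assert (Ht := cos2_sin2 ta).
  rewrite cos_minus, sin_minus in *.
  set (cp := cos psi) in *. set (sp := sin psi) in *. set (cd := cos d) in *. set (sd := sin d) in *.
  set (ct := cos ta) in *. set (st := sin ta) in *. set (o := omega s) in *.
  clearbody cp sp cd sd ct st o r. clear - Hr Hp Hd Ht.
  transitivity (o * s * ((ct ^ 2 + s ^ 2 * st ^ 2) * (cd ^ 2 + sd ^ 2)
     - r ^ 2 * st ^ 2 * (cp ^ 2 + sp ^ 2) * (cd ^ 2 + sd ^ 2)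
     + 2 * r ^ 2 * st ^ 2 * (cp ^ 2 + sp ^ 2) * (cd ^ 2 + sd ^ 2))); [ring|].
  rewrite Hd, Hp, Hr. replace (ct ^ 2) with (1 - st ^ 2) by lra. ring.
Qed.

Lemma geod_speed2 (s psi t : R) : -1 <= s <= 1 ->
  speed2 I1 I3 (geod s psi t) (geodv s psi t) = 1.
Proof.
  intros Hs. destruct (geod_geo s psi Hs t) as (A & B & C).
  rewrite (geo_speed2 (geodM s psi) _ _ eq_refl A B C).
  assert (Hr : sqrt (1 - s ^ 2) ^ 2 = 1 - s ^ 2) by (apply pow2_sqrt; nra).
  transitivity (4 * I1 * (omega s ^ 2 * (1 + eta * s ^ 2))); [|now apply omega_sqr].
  unfold geodesic_momentum; cbn [qc0 qc1 qc2 qc3].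
  transitivity (4 * I1 * omega s ^ 2 * (sqrt (1 - s ^ 2) ^ 2 * (cos psi ^ 2 + sin psi ^ 2) + (1 + eta) * s ^ 2));
    [ring|]. rewrite Hr, cos2_sin2. ring.
Qed.

Lemma geod_len (s psi a b : R) : -1 <= s <= 1 -> a <= b -> len I1 I3 (geod s psi) a b = b - a.
Proof.
  intros Hs Hab. apply (unit_speed_len _ _ _ (geodv s psi)); auto using geod_C1, geod_speed2.
Qed.

(* [|g - c|^2] is constant because [x -> M x] and [x -> x k] are skew. *)
Lemma geo_unique (M : P4) (g vg c vc : R -> P4) : qc0 M = 0 -> C1with g vg -> C1with c vc ->
  (forall t, 0 < t -> vg t = geo_rhs eta M (g t)) -> (forall t, vc t = geo_rhs eta M (c t)) ->
  g 0 = c 0 -> forall t, 0 <= t -> g t = c t.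
Proof.
  intros HM Hg Hc Eg Ec E0 t Ht.
  assert (A0 := C1with_ctn0 g vg Hg). assert (A1 := C1with_ctn1 g vg Hg).
  assert (A2 := C1with_ctn2 g vg Hg). assert (A3 := C1with_ctn3 g vg Hg).
  assert (B0 := C1with_ctn0 c vc Hc). assert (B1 := C1with_ctn1 c vc Hc).
  assert (B2 := C1with_ctn2 c vc Hc). assert (B3 := C1with_ctn3 c vc Hc).
  set (D := fun t => (qc0 (g t) - qc0 (c t)) ^ 2 + (qc1 (g t) - qc1 (c t)) ^ 2 +
                     (qc2 (g t) - qc2 (c t)) ^ 2 + (qc3 (g t) - qc3 (c t)) ^ 2).
  assert (HD : D t = D 0).
  { apply constant_of_derive; auto.
    - intros u Hu. destruct Hg as [(H0 & H1 & H2 & H3) _]. destruct Hc as [(K0 & K1 & K2 & K3) _].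
      specialize (H0 u); specialize (H1 u); specialize (H2 u); specialize (H3 u).
      specialize (K0 u); specialize (K1 u); specialize (K2 u); specialize (K3 u).
      rewrite Eg in H0, H1, H2, H3 by lra. rewrite Ec in K0, K1, K2, K3.
      unfold D. der. unfold geo_rhs, qadd, qscal, qmul; simpl. rewrite HM. ring.
    - intros u _. apply continuity_pt_filterlim.
      assert (CD : ctn D) by (unfold D; cts). apply CD. }
  assert (HD0 : D 0 = 0) by (unfold D; rewrite E0; ring).
  rewrite HD0 in HD. unfold D in HD.
  assert (P0 := pow2_ge_0 (qc0 (g t) - qc0 (c t))). assert (P1 := pow2_ge_0 (qc1 (g t) - qc1 (c t))).
  assert (P2 := pow2_ge_0 (qc2 (g t) - qc2 (c t))). assert (P3 := pow2_ge_0 (qc3 (g t) - qc3 (c t))).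
  assert (Z : forall x, x ^ 2 = 0 -> x = 0) by (intros x Hx; nra).
  apply P4_eq; apply Rminus_diag_uniq, Z; lra.
Qed.

End Geodesics.

Lemma polar_upper (x y : R) : 0 <= y ->
  exists rho f, 0 <= rho /\ 0 <= f <= PI /\ rho * cos f = x /\ rho * sin f = y.
Proof.
  intros Hy. set (rho := sqrt (x ^ 2 + y ^ 2)).
  assert (Hp : 0 <= x ^ 2 + y ^ 2) by (assert (A := pow2_ge_0 x); assert (B := pow2_ge_0 y); lra).
  assert (Hr2 : rho ^ 2 = x ^ 2 + y ^ 2) by (apply pow2_sqrt; auto).
  assert (Hr := sqrt_pos (x ^ 2 + y ^ 2)). fold rho in Hr.
  destruct (Req_dec rho 0) as [H0|H0].
  - exists 0, 0. rewrite H0 in Hr2. assert (HP := PI_RGT_0).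
    assert (x = 0) by nra. assert (y = 0) by nra. repeat split; lra.
  - exists rho, (acos (x / rho)). assert (Hrp : 0 < rho) by lra.
    assert (Hb : -1 <= x / rho <= 1).
    { split; apply (Rmult_le_reg_r rho); auto; unfold Rdiv; rewrite Rmult_assoc, Rinv_l by lra; nra. }
    assert (E : rho * cos (acos (x / rho)) = x) by (rewrite cos_acos by lra; field; lra).
    assert (A := acos_bound (x / rho)). set (f := acos (x / rho)) in *.
    repeat split; try lra.
    assert (S : 0 <= rho * sin f) by (apply Rmult_le_pos; auto; apply sin_ge_0; lra).
    assert (C := cos2_sin2 f).
    assert (S2 : (rho * sin f) ^ 2 = y ^ 2).
    { transitivity (rho ^ 2 * (cos f ^ 2 + sin f ^ 2) - (rho * cos f) ^ 2); [ring|].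
      rewrite C, E, Hr2. ring. }
    nra.
Qed.

Lemma polar (x y : R) : exists rho f, 0 <= rho /\ rho * cos f = x /\ rho * sin f = y.
Proof.
  destruct (Rle_lt_dec 0 y) as [Hy|Hy].
  - destruct (polar_upper x y Hy) as (r & f & Hr & _ & H1 & H2). exists r, f; auto.
  - destruct (polar_upper x (- y) ltac:(lra)) as (r & f & Hr & _ & H1 & H2).
    exists r, (- f). rewrite cos_neg, sin_neg. repeat split; auto. lra.
Qed.

(** * Local minimality of the explicit geodesics *)

Section Classification.
Variables (I1 I3 eta : R).
Hypotheses (HI3 : 0 < I3) (HI : I1 = I3 * (1 + eta)) (Heta : -1 < eta).

Notation geod := (geodesic I1 eta).
Notation geodv := (geodesic_velocity I1 eta).
Notation geodM := (geodesic_momentum I1 eta).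
Notation omega := (frequency I1 eta).

(** z equals (cos tau + i s sin tau) e^{i eta s tau}, and changing the sign of [s] conjugates it.
    The sign [sg] therefore reduces every estimate to a nonnegative parameter. *)
Lemma geod_polar (s psi t sg rho f0 : R) : sg * sg = 1 ->
  rho * cos f0 = cos (omega s * t) -> rho * sin f0 = sg * s * sin (omega s * t) ->
  let al := f0 + eta * (sg * s) * (omega s * t) in
  qc0 (geod s psi t) = rho * cos al /\ qc3 (geod s psi t) = sg * (rho * sin al).
Proof.
  intros Hsg Hc Hs al. unfold al, geodesic; cbv zeta; cbn [qc0 qc3].
  set (ta := omega s * t) in *.
  replace (eta * (sg * s) * ta) with (sg * (eta * s * ta)) by ring.
  set (d := eta * s * ta).
  assert (Hd : cos (sg * d) = cos d /\ sin (sg * d) = sg * sin d).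
  { assert (E : (sg - 1) * (sg + 1) = 0) by lra.
    apply Rmult_integral in E. destruct E as [E|E].
    - replace sg with 1 by lra. rewrite !Rmult_1_l; auto.
    - replace sg with (-1) by lra. replace (-1 * d) with (- d) by ring.
      rewrite cos_neg, sin_neg. split; ring. }
  destruct Hd as [Ec Es]. rewrite cos_plus, sin_plus, Ec, Es, <- Hc.
  replace (s * sin ta) with (sg * (rho * sin f0)) by (rewrite Hs; ring [Hsg]).
  split; ring [Hsg].
Qed.

(** The translated curve is again a geodesic with the same [s] and a rotated phase. Since the lower
    bound reads only z, the new phase need not be computed. *)
Lemma geod_translate (s psi t1 t2 : R) : -1 <= s <= 1 ->
  qc0 (qmul (qconj (geod s psi t1)) (geod s psi t2)) = qc0 (geod s psi (t2 - t1)) /\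
  qc3 (qmul (qconj (geod s psi t1)) (geod s psi t2)) = qc3 (geod s psi (t2 - t1)).
Proof.
  intros Hs. assert (Hr : sqrt (1 - s ^ 2) ^ 2 = 1 - s ^ 2) by (apply pow2_sqrt; nra).
  unfold qmul, qconj, geodesic; cbv zeta; cbn [qc0 qc1 qc2 qc3].
  replace (omega s * (t2 - t1)) with (omega s * t2 - omega s * t1) by ring.
  set (a := omega s * t1). set (b := omega s * t2).
  replace (eta * s * (b - a)) with (eta * s * b - eta * s * a) by ring.
  set (d := eta * s * a). set (e := eta * s * b). set (r := sqrt (1 - s ^ 2)) in *.
  assert (Hp := cos2_sin2 psi).
  rewrite !cos_minus, !sin_minus.
  set (ca := cos a). set (sa := sin a). set (cb := cos b). set (sb := sin b).
  set (cd := cos d). set (sd := sin d). set (ce := cos e). set (se := sin e).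
  set (cp := cos psi) in *. set (sp := sin psi) in *.
  clearbody ca sa cb sb cd sd ce se cp sp r. clear - Hr Hp.
  assert (K : r ^ 2 * (cp ^ 2 + sp ^ 2) = 1 - s ^ 2) by (rewrite Hp, Hr; ring).
  split.
  - transitivity ((ca * cb + s ^ 2 * sa * sb) * (cd * ce + sd * se) + s * (ca * sb - sa * cb) * (cd * - se + sd * ce)
       + r ^ 2 * (cp ^ 2 + sp ^ 2) * sa * sb * (cd * ce + sd * se)); [ring|rewrite K; ring].
  - transitivity ((ca * cb + s ^ 2 * sa * sb) * (cd * se - sd * ce) + s * (ca * sb - sa * cb) * (cd * ce + sd * se)
       + r ^ 2 * (cp ^ 2 + sp ^ 2) * sa * sb * (cd * se - sd * ce)); [ring|rewrite K; ring].
Qed.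

Lemma omega_inv (s t : R) : -1 <= s <= 1 ->
  2 * sqrt I1 * sqrt (1 + eta * s ^ 2) * (omega s * t) = t.
Proof.
  intros Hs. assert (H := omega_pos I1 I3 eta HI3 HI Heta s Hs). unfold frequency in *.
  assert (2 * sqrt I1 * sqrt (1 + eta * s ^ 2) <> 0).
  { intros E. rewrite E, Rinv_0 in H. lra. }
  field. repeat split; intros E; rewrite E in *; lra.
Qed.

Lemma geod_lower_bound (s psi t sg rho f0 : R) (c v : R -> P4) (a b ak : R) :
  -1 <= s <= 1 -> sg * sg = 1 -> 0 <= sg * s ->
  let tau := omega s * t in let al := f0 + eta * (sg * s) * tau in
  0 < tau <= PI -> 0 <= rho -> 0 <= f0 <= PI ->
  rho * cos f0 = cos tau -> rho * sin f0 = sg * s * sin tau ->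
  0 <= al -> (0 < eta -> al <= PI / 2) -> cos ak <= cos al ->
  C1with c v -> a <= b -> (forall u, a <= u <= b -> onS3 (c u)) -> c a = idP ->
  qc0 (c b) = rho * cos ak -> qc3 (c b) = rho * sin ak ->
  t <= len I1 I3 c a b.
Proof.
  intros Hs Hsg Hss tau al Ht Hr Hf Hc Hsn Hal Hal2 Hak Hcv Hab HS Ha E0 E3.
  rewrite <- (omega_inv s t Hs). fold tau.
  assert (Es : (sg * s) ^ 2 = s ^ 2) by (transitivity (sg * sg * s ^ 2); [ring|rewrite Hsg; ring]).
  rewrite <- Es.
  apply (length_lower_bound I1 I3 eta HI3 HI Heta (sg * s) tau rho f0 ak c v a b); auto.
  split; auto. nra.
Qed.

Lemma sign_ex (s : R) : exists sg, sg * sg = 1 /\ 0 <= sg * s /\ (sg = 1 \/ sg = -1).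
Proof. destruct (Rle_lt_dec 0 s); [exists 1|exists (-1)]; repeat split; lra. Qed.

Lemma polar_sign (sg rho al : R) : sg = 1 \/ sg = -1 ->
  rho * cos al = rho * cos (sg * al) /\ sg * (rho * sin al) = rho * sin (sg * al).
Proof.
  intros [->| ->].
  - rewrite !Rmult_1_l; auto.
  - replace (-1 * al) with (- al) by ring. rewrite cos_neg, sin_neg. split; ring.
Qed.

(** For short times [s tau <= f0 <= tau], whence the argument lies between [(1 + eta) s tau] and
    [(1 + |eta|) tau <= PI / 4], inside the range of the lower bound for both signs of [eta]. *)
Lemma geod_short_minimal (s psi t : R) (c v : R -> P4) (a b : R) : -1 <= s <= 1 ->
  0 <= t -> omega s * t <= PI / (4 * (1 + Rabs eta)) ->
  C1with c v -> a <= b -> (forall u, a <= u <= b -> onS3 (c u)) -> c a = idP ->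
  qc0 (c b) = qc0 (geod s psi t) -> qc3 (c b) = qc3 (geod s psi t) ->
  t <= len I1 I3 c a b.
Proof.
  intros Hs Ht Hsm Hcv Hab HS Ha E0 E3. assert (HP := PI_RGT_0).
  destruct (Req_dec t 0) as [->|Ht0]; [apply (len_ge0 I1 I3 c v); auto|].
  assert (Ho := omega_pos I1 I3 eta HI3 HI Heta s Hs).
  set (tau := omega s * t) in *. assert (Htau : 0 < tau) by (apply Rmult_lt_0_compat; lra).
  assert (Hab0 := Rabs_pos eta).
  assert (Hsm2 : (1 + Rabs eta) * tau <= PI / 4).
  { apply (Rmult_le_compat_l (1 + Rabs eta)) in Hsm; [|lra].
    eapply Rle_trans; [exact Hsm|]. apply Req_le. field. lra. }
  assert (Ht4 : tau <= PI / 4) by nra.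
  destruct (sign_ex s) as (sg & Hsg & Hss & Hsg1).
  set (s' := sg * s) in *. assert (Hs' : 0 <= s' <= 1) by (split; auto; unfold s'; destruct Hsg1; subst; lra).
  assert (Hst : 0 < sin tau) by (apply sin_gt_0; lra).
  assert (Hct : 0 < cos tau) by (apply cos_gt_0; lra).
  destruct (polar_upper (cos tau) (s' * sin tau)) as (rho & f0 & Hr & Hf & Hc & Hsn);
    [apply Rmult_le_pos; lra|].
  assert (Hr0 : 0 < rho).
  { destruct (Req_dec rho 0) as [H|H]; [rewrite H, Rmult_0_l in Hc; lra|lra]. }
  assert (Hsb := scal_between s' tau Hs' ltac:(lra)).
  (* [tan f0 = s' tan tau], compared with [tan (s' tau)]. *)
  assert (F1 : s' * tau <= f0).
  { destruct (Rle_lt_dec (s' * tau) f0) as [|Hlt]; auto. exfalso.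
    assert (A := tan_scal_le s' tau Hs' ltac:(lra)).
    assert (B : 0 < sin (s' * tau - f0)) by (apply sin_gt_0; lra).
    rewrite sin_minus in B.
    assert (C : rho * (sin (s' * tau) * cos f0 - cos (s' * tau) * sin f0) <= 0).
    { replace (rho * (sin (s' * tau) * cos f0 - cos (s' * tau) * sin f0)) with
        (sin (s' * tau) * (rho * cos f0) - cos (s' * tau) * (rho * sin f0)) by ring.
      rewrite Hc, Hsn. lra. }
    assert (0 < rho * (sin (s' * tau) * cos f0 - cos (s' * tau) * sin f0)) by (apply Rmult_lt_0_compat; auto).
    lra. }
  assert (F2 : f0 <= tau).
  { destruct (Rle_lt_dec f0 tau) as [|Hlt]; auto. exfalso.
    assert (B : 0 < sin (f0 - tau)) by (apply sin_gt_0; lra). rewrite sin_minus in B.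
    assert (D : rho * (sin f0 * cos tau - cos f0 * sin tau) <= 0).
    { replace (rho * (sin f0 * cos tau - cos f0 * sin tau)) with
        ((rho * sin f0) * cos tau - (rho * cos f0) * sin tau) by ring.
      rewrite Hc, Hsn. assert (0 < sin tau * cos tau) by (apply Rmult_lt_0_compat; auto). nra. }
    assert (0 < rho * (sin f0 * cos tau - cos f0 * sin tau)) by (apply Rmult_lt_0_compat; auto). lra. }
  destruct (geod_polar s psi t sg rho f0 Hsg Hc Hsn) as [G0 G3]. fold tau s' in G0, G3.
  set (al := f0 + eta * s' * tau) in *.
  destruct (polar_sign sg rho al Hsg1) as [P0 P3].
  assert (Hal : 0 <= al).
  { unfold al. replace (f0 + eta * s' * tau) with ((f0 - s' * tau) + (1 + eta) * (s' * tau)) by ring.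
    assert (0 <= (1 + eta) * (s' * tau)) by (apply Rmult_le_pos; lra). lra. }
  apply (geod_lower_bound s psi t sg rho f0 c v a b (sg * al)); auto; fold tau s' al; try lra.
  - intros He. rewrite Rabs_right in Hsm2 by lra. unfold al.
    assert (eta * (s' * tau) <= eta * tau) by (apply Rmult_le_compat_l; lra). lra.
  - apply Req_le. destruct Hsg1 as [->| ->]; [now rewrite Rmult_1_l|].
    replace (-1 * al) with (- al) by ring. apply cos_neg.
Qed.

Lemma geod_unit_geodesic (s psi : R) : -1 <= s <= 1 -> unit_geodesic I1 I3 (geod s psi).
Proof.
  intros Hs. assert (HC := geod_C1 I1 eta s psi Hs).
  assert (HS : forall t, onS3 (geod s psi t)) by (intros t; apply (geod_geo I1 eta s psi Hs t)).
  split; [exact (C1with_C1curve _ _ HC)|]. split; [apply geod_0|]. split; [auto|]. split.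
  - intros t _. unfold speed. rewrite (C1with_velocity _ _ HC), (geod_speed2 I1 I3 eta HI3 HI Heta) by auto.
    apply sqrt_1.
  - intros t0 _. assert (Ho := omega_pos I1 I3 eta HI3 HI Heta s Hs).
    assert (Hab0 := Rabs_pos eta). assert (HP := PI_RGT_0).
    set (B := PI / (4 * (1 + Rabs eta))).
    assert (HB : 0 < B) by (apply Rdiv_lt_0_compat; lra).
    (* Half the admissible span, because [s1] and [s2] may lie on opposite sides of [t0]. *)
    exists (B / omega s / 2). split.
    { apply Rdiv_lt_0_compat; [apply Rdiv_lt_0_compat; auto|lra]. }
    intros s1 s2 H1 H12 Hl Hu c a b (Hab & Hcc & Hcs & Ha & Hb).
    rewrite (geod_len I1 I3 eta HI3 HI Heta s psi s1 s2 Hs H12).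
    set (n := qconj (geod s psi s1)).
    assert (Hn : onS3 n).
    { assert (H := HS s1). unfold n, onS3, qconj in *. cbn [qc0 qc1 qc2 qc3]. rewrite <- H. ring. }
    assert (Hcw := C1curve_C1with c Hcc).
    rewrite <- (len_qmul I1 I3 n c _ a b Hcw Hn).
    destruct (geod_translate s psi s1 s2 Hs) as [T0 T3].
    apply (geod_short_minimal s psi (s2 - s1) _ _ a b Hs ltac:(lra)) with (2 := C1with_qmul n c _ Hcw);
      auto; fold B.
    + apply (Rle_trans _ (omega s * (B / omega s))); [apply Rmult_le_compat_l; lra|].
      apply Req_le. field. lra.
    + intros u Hu'. apply qmul_onS3; auto.
    + rewrite Ha. unfold n. assert (H := HS s1). unfold onS3 in H.
      apply P4_eq; unfold qmul, qconj, idP; cbn [qc0 qc1 qc2 qc3]; [rewrite <- H| | |]; ring.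
    + rewrite Hb. exact T0.
    + rewrite Hb. exact T3.
Qed.

(** * Classification of the unit-speed geodesics *)

Lemma momentum_constant (g : R -> P4) (n : P4) : unit_geodesic I1 I3 g -> unit_axis n ->
  forall t, 0 <= t -> bform I1 I3 (g t) (velocity g t) (qmul n (g t)) =
                      bform I1 I3 (g 0) (velocity g 0) (qmul n (g 0)).
Proof.
  intros (HC & H0 & HS & Hsp & Hloc) Hn t Ht.
  assert (Hg := C1curve_C1with g HC). assert (HI1 := I1_pos I1 I3 eta HI3 HI Heta).
  assert (Hsp2 : forall u, 0 <= u -> speed2 I1 I3 (g u) (velocity g u) = 1).
  { intros u Hu. apply speed2_of_unit_speed; auto. }
  set (m := fun u => bform I1 I3 (g u) (velocity g u) (qmul n (g u))).
  change (m t = m 0).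
  assert (Hm : ctn m) by now apply ctn_bform.
  apply constant_of_derive; auto.
  2:{ intros u _. apply continuity_pt_filterlim, Hm. }
  intros u Hu. destruct (Hloc u ltac:(lra)) as (eps & He & Hmin).
  (* The window stays inside the neighbourhood of local minimality and inside positive times, where
     [g] is controlled. *)
  set (r := Rmin (eps / 2) (u / 2)).
  assert (R0 : 0 < r) by (apply Rmin_pos; lra).
  assert (R1 : r <= eps / 2) by apply Rmin_l. assert (R2 : r <= u / 2) by apply Rmin_r.
  destruct (momentum_locally_constant I1 I3 HI1 HI3 n g (velocity g) (u - r) (u + r) Hn Hg)
    as [k Hk]; try lra.
  - intros x Hx; apply HS; lra.
  - intros x Hx; apply Hsp2; lra.
  - intros d a' b' Hd. apply (Hmin (u - r) (u + r)); auto; lra.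
  - apply (der_locally_constant m k u r R0). intros y Hy. apply Hk. lra.
Qed.

(** The three pairings say that conj(x) M x = (a1, a2, a3 / (1 + eta)). Hence conj(x) w differs from
    it only by eta a3 / (1 + eta) along k; multiplying by x gives the equation. *)
Lemma momentum_to_ode (x w M : P4) : onS3 x -> la0 x w = 0 -> qc0 M = 0 ->
  (forall n, unit_axis n -> bform I1 I3 x w (qmul n x) = 4 * I1 * la0 M n) ->
  w = qadd (qmul M x) (qscal (eta * (la3 x w / (1 + eta))) (qmul x qk)) /\
  la3 x (qmul M x) = la3 x w / (1 + eta).
Proof.
  intros Hx H0 HM Hn. assert (HI1 := I1_pos I1 I3 eta HI3 HI Heta).
  set (h := la3 x w / (1 + eta)).
  assert (E3 : la3 x w = (1 + eta) * h) by (unfold h; field; lra).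
  assert (Hn' : forall n, unit_axis n ->
     la1 x w * la1 x (qmul n x) + la2 x w * la2 x (qmul n x) + h * la3 x (qmul n x) = la0 M n).
  { intros n H. specialize (Hn n H). unfold bform in Hn. rewrite E3 in Hn.
    apply (Rmult_eq_reg_l (4 * I1)); [|lra]. rewrite <- Hn, HI. ring. }
  assert (M1 := Hn' qi (or_introl eq_refl)). assert (M2 := Hn' qj (or_intror (or_introl eq_refl))).
  assert (M3 := Hn' qk (or_intror (or_intror eq_refl))). clear Hn Hn'.
  set (a1 := la1 x w) in *. set (a2 := la2 x w) in *.
  assert (N1 : qc1 M = a1 * la1 x (qmul qi x) + a2 * la2 x (qmul qi x) + h * la3 x (qmul qi x))
    by (rewrite M1; unfold la0, qi; simpl; ring).
  assert (N2 : qc2 M = a1 * la1 x (qmul qj x) + a2 * la2 x (qmul qj x) + h * la3 x (qmul qj x))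
    by (rewrite M2; unfold la0, qj; simpl; ring).
  assert (N3 : qc3 M = a1 * la1 x (qmul qk x) + a2 * la2 x (qmul qk x) + h * la3 x (qmul qk x))
    by (rewrite M3; unfold la0, qk; simpl; ring).
  clear M1 M2 M3.
  unfold onS3 in Hx. set (nn := qc0 x ^ 2 + qc1 x ^ 2 + qc2 x ^ 2 + qc3 x ^ 2) in *.
  assert (W : w = mkP4 (- (qc1 x * a1 + qc2 x * a2 + qc3 x * ((1 + eta) * h)))
                       (qc0 x * a1 + qc2 x * ((1 + eta) * h) - qc3 x * a2)
                       (qc0 x * a2 + qc3 x * a1 - qc1 x * ((1 + eta) * h))
                       (qc0 x * ((1 + eta) * h) + qc1 x * a2 - qc2 x * a1)).
  { rewrite <- E3. unfold a1, a2.
    apply P4_eq; cbn [qc0 qc1 qc2 qc3].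
    - transitivity (nn * qc0 w - qc0 x * la0 x w); [rewrite Hx, H0; ring|unfold nn, la0, la1, la2, la3; ring].
    - transitivity (nn * qc1 w - qc1 x * la0 x w); [rewrite Hx, H0; ring|unfold nn, la0, la1, la2, la3; ring].
    - transitivity (nn * qc2 w - qc2 x * la0 x w); [rewrite Hx, H0; ring|unfold nn, la0, la1, la2, la3; ring].
    - transitivity (nn * qc3 w - qc3 x * la0 x w); [rewrite Hx, H0; ring|unfold nn, la0, la1, la2, la3; ring]. }
  assert (MX : qmul M x = mkP4 (- (qc1 x * a1 + qc2 x * a2 + qc3 x * h))
                       (qc0 x * a1 + qc2 x * h - qc3 x * a2)
                       (qc0 x * a2 + qc3 x * a1 - qc1 x * h)
                       (qc0 x * h + qc1 x * a2 - qc2 x * a1)).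
  { apply P4_eq; unfold qmul at 1; cbn [qc0 qc1 qc2 qc3]; rewrite HM, N1, N2, N3.
    - transitivity (nn * (- (qc1 x * a1 + qc2 x * a2 + qc3 x * h))); [|rewrite Hx; ring].
      unfold nn, la1, la2, la3, qmul, qi, qj, qk; cbn [qc0 qc1 qc2 qc3]; ring.
    - transitivity (nn * (qc0 x * a1 + qc2 x * h - qc3 x * a2)); [|rewrite Hx; ring].
      unfold nn, la1, la2, la3, qmul, qi, qj, qk; cbn [qc0 qc1 qc2 qc3]; ring.
    - transitivity (nn * (qc0 x * a2 + qc3 x * a1 - qc1 x * h)); [|rewrite Hx; ring].
      unfold nn, la1, la2, la3, qmul, qi, qj, qk; cbn [qc0 qc1 qc2 qc3]; ring.
    - transitivity (nn * (qc0 x * h + qc1 x * a2 - qc2 x * a1)); [|rewrite Hx; ring].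
      unfold nn, la1, la2, la3, qmul, qi, qj, qk; cbn [qc0 qc1 qc2 qc3]; ring. }
  split.
  - rewrite W at 1. rewrite MX. unfold qadd, qscal, qmul, qk; cbn [qc0 qc1 qc2 qc3].
    apply P4_eq; cbn [qc0 qc1 qc2 qc3]; ring.
  - rewrite MX. transitivity (nn * h); [|rewrite Hx; ring].
    unfold la3, nn; cbn [qc0 qc1 qc2 qc3]; ring.
Qed.

Theorem unit_geodesic_classification (g : R -> P4) : unit_geodesic I1 I3 g ->
  exists s psi, -1 <= s <= 1 /\ forall t, 0 <= t -> g t = geod s psi t.
Proof.
  intros Hug. assert (Hmom := fun n => momentum_constant g n Hug).
  destruct Hug as (HC & H0 & HS & Hsp & _).
  assert (Hg := C1curve_C1with g HC). assert (HI1 := I1_pos I1 I3 eta HI3 HI Heta).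
  set (v := velocity g) in *.
  set (m3 := qc3 (v 0) / (1 + eta)).
  set (M := mkP4 0 (qc1 (v 0)) (qc2 (v 0)) m3).
  assert (HM : forall t n, 0 <= t -> unit_axis n ->
     bform I1 I3 (g t) (v t) (qmul n (g t)) = 4 * I1 * la0 M n).
  { intros t n Ht Hn. rewrite Hmom by auto. rewrite H0. unfold bform, M, m3.
    assert (HI' : I3 = I1 / (1 + eta)) by (rewrite HI; field; lra). rewrite HI'.
    destruct Hn as [->|[->| ->]]; unfold la0, la1, la2, la3, qmul, idP, qi, qj, qk;
      cbn [qc0 qc1 qc2 qc3]; field; lra. }
  (* Time 0 is left out because tangency was obtained only at interior times; uniqueness asks for no
     more. *)
  assert (Hode : forall t, 0 < t ->
    v t = qadd (qmul M (g t)) (qscal (eta * (la3 (g t) (v t) / (1 + eta))) (qmul (g t) qk)) /\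
    la3 (g t) (qmul M (g t)) = la3 (g t) (v t) / (1 + eta)).
  { intros t Ht. apply momentum_to_ode; auto.
    - apply HS; lra.
    - apply (la0_interior g v Hg 0 (t + 1)); [intros; apply HS; lra|lra].
    - intros n Hn. apply HM; auto; lra. }
  (* The coefficient of the equation still depends on time through this body component. The
     additional right factor rotates about k and so preserves it, which makes the coefficient
     constant. *)
  set (H := fun t => la3 (g t) (qmul M (g t))).
  assert (HH : forall t, 0 <= t -> H t = m3).
  { intros t Ht. transitivity (H 0).
    - assert (B0 := C1with_ctn0 _ _ Hg). assert (B1 := C1with_ctn1 _ _ Hg).
      assert (B2 := C1with_ctn2 _ _ Hg). assert (B3 := C1with_ctn3 _ _ Hg).
      apply constant_of_derive; auto.
      + intros u Hu. destruct (Hode u ltac:(lra)) as [Hv _].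
        destruct Hg as [(A0 & A1 & A2 & A3) _].
        specialize (A0 u); specialize (A1 u); specialize (A2 u); specialize (A3 u).
        set (k := eta * (la3 (g u) (v u) / (1 + eta))) in Hv. rewrite Hv in A0, A1, A2, A3.
        unfold H, la3, qmul; cbn [qc0 qc1 qc2 qc3]. der.
        unfold qadd, qscal, qmul, M, qk; cbn [qc0 qc1 qc2 qc3]. ring.
      + intros u _. apply continuity_pt_filterlim.
        assert (CH : ctn H) by (unfold H, la3, qmul; cbn [qc0 qc1 qc2 qc3]; cts). apply CH.
    - unfold H. rewrite H0. unfold la3, qmul, idP, M; cbn [qc0 qc1 qc2 qc3]. ring. }
  assert (Hv : forall t, 0 < t -> v t = geo_rhs eta M (g t)).
  { intros t Ht. destruct (Hode t Ht) as [E1 E2].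
    rewrite <- E2 in E1. change (la3 (g t) (qmul M (g t))) with (H t) in E1.
    rewrite HH in E1 by lra. exact E1. }
  assert (HN : 4 * I1 * (qc1 (v 0) ^ 2 + qc2 (v 0) ^ 2 + (1 + eta) * m3 ^ 2) = 1).
  { assert (E2 := speed2_of_unit_speed I1 I3 g 0 HI1 HI3 (Hsp 0 ltac:(lra))). fold v in E2.
    transitivity (speed2 I1 I3 (g 0) (v 0)); [|exact E2].
    rewrite H0, speed2E. unfold m3, la1, la2, la3, idP; cbn [qc0 qc1 qc2 qc3].
    assert (HI' : I3 = I1 / (1 + eta)) by (rewrite HI; field; lra). rewrite HI'. field. lra. }
  destruct (polar (qc1 (v 0)) (qc2 (v 0))) as (r & psi & Hr & P1 & P2).
  set (o := sqrt (r ^ 2 + m3 ^ 2)).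
  assert (Er : qc1 (v 0) ^ 2 + qc2 (v 0) ^ 2 = r ^ 2).
  { rewrite <- P1, <- P2. transitivity (r ^ 2 * (cos psi ^ 2 + sin psi ^ 2)); [ring|rewrite cos2_sin2; ring]. }
  assert (Hrm : 0 < r ^ 2 + m3 ^ 2).
  { assert (A := pow2_ge_0 r). assert (B := pow2_ge_0 m3).
    destruct (Req_dec (r ^ 2 + m3 ^ 2) 0) as [Z|Z]; [|lra]. exfalso.
    assert (r ^ 2 = 0) by lra. assert (m3 ^ 2 = 0) by lra. rewrite Er, H1, H2 in HN. lra. }
  assert (Ho : 0 < o) by (apply sqrt_lt_R0; auto).
  assert (Ho2 : o ^ 2 = r ^ 2 + m3 ^ 2) by (apply pow2_sqrt; lra).
  set (s := m3 / o).
  assert (Es : o * s = m3) by (unfold s; field; lra).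
  assert (Hs2 : s ^ 2 <= 1).
  { assert (E : o ^ 2 * s ^ 2 = m3 ^ 2) by (rewrite <- Es; ring). assert (A := pow2_ge_0 r). nra. }
  assert (Hs : -1 <= s <= 1) by nra.
  assert (Hsr : o * sqrt (1 - s ^ 2) = r).
  { assert (Hq : sqrt (1 - s ^ 2) ^ 2 = 1 - s ^ 2) by (apply pow2_sqrt; lra).
    assert (Hq0 := sqrt_pos (1 - s ^ 2)).
    assert (E : (o * sqrt (1 - s ^ 2)) ^ 2 = r ^ 2).
    { transitivity (o ^ 2 * sqrt (1 - s ^ 2) ^ 2); [ring|]. rewrite Hq.
      transitivity (o ^ 2 - (o * s) ^ 2); [ring|]. rewrite Es, Ho2. ring. }
    assert (0 <= o * sqrt (1 - s ^ 2)) by (apply Rmult_le_pos; lra). nra. }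
  (* Both are the positive root of the unit-speed relation [4 I1 x^2 (1 + eta s^2) = 1]. *)
  assert (Eo : omega s = o).
  { assert (W := omega_pos I1 I3 eta HI3 HI Heta s Hs). assert (W2 := omega_sqr I1 I3 eta HI3 HI Heta s Hs).
    assert (W3 : 4 * I1 * (o ^ 2 * (1 + eta * s ^ 2)) = 1).
    { rewrite Er in HN. transitivity (4 * I1 * (r ^ 2 + (1 + eta) * m3 ^ 2)); [|exact HN].
      transitivity (4 * I1 * (o ^ 2 + eta * (o * s) ^ 2)); [ring|]. rewrite Es, Ho2. ring. }
    assert (W4 := one_plus_pos eta s Heta Hs).
    assert (E : omega s ^ 2 = o ^ 2).
    { apply (Rmult_eq_reg_r (4 * I1 * (1 + eta * s ^ 2))).
      - transitivity (4 * I1 * (omega s ^ 2 * (1 + eta * s ^ 2))); [ring|]. rewrite W2. symmetry. transitivity (4 * I1 * (o ^ 2 * (1 + eta * s ^ 2))); [ring|exact W3].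
      - assert (0 < 4 * I1 * (1 + eta * s ^ 2)) by (apply Rmult_lt_0_compat; lra). lra. }
    nra. }
  assert (EM : M = geodM s psi).
  { unfold M, geodesic_momentum. rewrite Eo, Hsr, Es, P1, P2. reflexivity. }
  exists s, psi. split; auto.
  apply (geo_unique eta M g v (geod s psi) (geodv s psi)); auto.
  - apply geod_C1; auto.
  - intros t. rewrite EM. reflexivity.
  - rewrite H0. symmetry. apply geod_0.
Qed.

End Classification.

(** * Cut times *)

Definition rotM (a : R) (M : P4) : P4 :=
  mkP4 0 (cos a * qc1 M - sin a * qc2 M) (sin a * qc1 M + cos a * qc2 M) (qc3 M).

(** The left factor of [torus a b] turns the momentum by [a + b] about the k axis; the right factor
    commutes with k and leaves the equation unchanged. *)
Lemma geo_torus (eta a b : R) (M : P4) (c v : R -> P4) : qc0 M = 0 -> geo eta M c v ->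
  geo eta (rotM (a + b) M) (fun t => torus a b (c t)) (fun t => torus a b (v t)).
Proof.
  intros HM Hg t. destruct (Hg t) as (HS & Hv & H3). split; [now apply torus_onS3|]. split.
  - rewrite Hv. assert (Ea : sin a ^ 2 = 1 - cos a ^ 2) by (assert (H := cos2_sin2 a); lra).
    assert (Eb : sin b ^ 2 = 1 - cos b ^ 2) by (assert (H := cos2_sin2 b); lra).
    unfold geo_rhs, rotM. rewrite cos_plus, sin_plus.
    apply P4_eq; unfold torus, qadd, qscal, qmul, qk; cbn [qc0 qc1 qc2 qc3]; rewrite HM; ring [Ea Eb].
  - destruct (torus_la a b (c t) (v t)) as [-> _]. exact H3.
Qed.

Lemma cos_period_Z (x : R) (k : Z) : cos (x + 2 * IZR k * PI) = cos x.
Proof.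
  destruct (Z_le_gt_dec 0 k) as [Hk|Hk].
  - rewrite <- (Z2Nat.id k Hk), <- INR_IZR_INZ. apply cos_period.
  - rewrite <- (cos_period (x + 2 * IZR k * PI) (Z.to_nat (- k))), INR_IZR_INZ, Z2Nat.id by lia.
    rewrite opp_IZR. f_equal. ring.
Qed.

(** With [b = PI j / p] and [0 <= j < p], the difference is [- 2 sin (al + b) sin b], and both sines
    are nonnegative because [al + b <= PI]. *)
Lemma cos_orbit_le (p k : Z) (al : R) : (2 <= p)%Z -> 0 <= al <= PI / IZR p ->
  cos (al + 2 * PI * IZR k / IZR p) <= cos al.
Proof.
  intros Hp Ha. assert (Hp2 : 2 <= IZR p) by (now apply IZR_le). assert (HP := PI_RGT_0).
  set (j := (k mod p)%Z). assert (Hj := Z.mod_pos_bound k p ltac:(lia)). fold j in Hj.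
  assert (Ek : k = (p * (k / p) + j)%Z) by (apply Z.div_mod; lia).
  set (b := PI * IZR j / IZR p).
  assert (Ec : cos (al + 2 * PI * IZR k / IZR p) = cos ((al + b) + b)).
  { rewrite Ek, plus_IZR, mult_IZR.
    replace (al + 2 * PI * (IZR p * IZR (k / p) + IZR j) / IZR p) with
      (((al + b) + b) + 2 * IZR (k / p) * PI) by (unfold b; field; lra).
    apply cos_period_Z. }
  rewrite Ec. replace (cos al) with (cos ((al + b) - b)) by (f_equal; ring).
  rewrite cos_plus, cos_minus.
  assert (J0 : 0 <= IZR j) by (apply IZR_le; lia).
  assert (J1 : IZR j <= IZR p - 1) by (rewrite <- minus_IZR; apply IZR_le; lia).
  assert (ip : 0 < / IZR p) by (apply Rinv_0_lt_compat; lra).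
  assert (b0 : 0 <= b) by (unfold b, Rdiv; apply Rmult_le_pos; [apply Rmult_le_pos; lra|lra]).
  assert (b1 : b <= PI - PI / IZR p).
  { replace (PI - PI / IZR p) with (PI * (IZR p - 1) / IZR p) by (field; lra).
    unfold b, Rdiv. apply Rmult_le_compat_r; [lra|]. apply Rmult_le_compat_l; lra. }
  assert (0 < PI / IZR p) by (apply Rdiv_lt_0_compat; lra).
  assert (0 <= sin b) by (apply sin_ge_0; lra).
  assert (0 <= sin (al + b)) by (apply sin_ge_0; lra).
  assert (0 <= sin (al + b) * sin b) by (apply Rmult_le_pos; auto). lra.
Qed.

Section CutTimes.
Variables (I1 I3 eta : R).
Hypotheses (HI3 : 0 < I3) (HI : I1 = I3 * (1 + eta)) (Heta : -1 < eta).

Notation geod := (geodesic I1 eta).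
Notation geodv := (geodesic_velocity I1 eta).
Notation geodM := (geodesic_momentum I1 eta).
Notation omega := (frequency I1 eta).

(* Rounding off the corner by a tent-shaped variation along a Killing field whose
   momentum jumps there. *)
Lemma corner_shortcut (M1 M2 : P4) (c1 v1 c2 v2 : R -> P4) (T t : R) :
  qc0 M1 = 0 -> qc0 M2 = 0 -> geo eta M1 c1 v1 -> geo eta M2 c2 v2 ->
  C1with c1 v1 -> C1with c2 v2 ->
  (forall u, speed2 I1 I3 (c1 u) (v1 u) = 1) -> (forall u, speed2 I1 I3 (c2 u) (v2 u) = 1) ->
  0 < T < t -> c1 T = c2 T -> M1 <> M2 ->
  exists c, admissible c 0 2 (c1 0) (c2 t) /\ len I1 I3 c 0 2 < t.
Proof.
  intros HM1 HM2 G1 G2 C1 C2 S1 S2 HT Em HM.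
  assert (HI1 := I1_pos I1 I3 eta HI3 HI Heta).
  assert (Hn : exists n, unit_axis n /\ la0 M1 n <> la0 M2 n).
  { destruct (Req_dec (qc1 M1) (qc1 M2)) as [E1|E1].
    - destruct (Req_dec (qc2 M1) (qc2 M2)) as [E2|E2].
      + destruct (Req_dec (qc3 M1) (qc3 M2)) as [E3|E3].
        * exfalso. apply HM, P4_eq; auto. now rewrite HM1, HM2.
        * exists qk. split; [right; right; reflexivity|]. unfold la0, qk; cbn [qc0 qc1 qc2 qc3].
          intros E. apply E3. lra.
      + exists qj. split; [right; left; reflexivity|]. unfold la0, qj; cbn [qc0 qc1 qc2 qc3].
        intros E. apply E2. lra.
    - exists qi. split; [left; reflexivity|]. unfold la0, qi; cbn [qc0 qc1 qc2 qc3].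
      intros E. apply E1. lra. }
  destruct Hn as (n & Hn & Hd).
  assert (Hn0 : qc0 n = 0) by (destruct Hn as [->|[->| ->]]; reflexivity).
  set (m1 := 4 * I1 * la0 M1 n). set (m2 := 4 * I1 * la0 M2 n).
  assert (B1 : forall u, bform I1 I3 (c1 u) (v1 u) (qmul n (c1 u)) = m1).
  { intros u. destruct (G1 u) as (A & B & C). now apply (geo_momentum I1 I3 eta HI). }
  assert (B2 : forall u, bform I1 I3 (c2 u) (v2 u) (qmul n (c2 u)) = m2).
  { intros u. destruct (G2 u) as (A & B & C). now apply (geo_momentum I1 I3 eta HI). }
  set (D := m1 - m2).
  assert (HD : D <> 0).
  { unfold D, m1, m2. intros E. apply Hd. apply (Rmult_eq_reg_l (4 * I1)); lra. }
  set (K := 2 * (I1 + I3) * (/ T + / (t - T))).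
  assert (iT : 0 < / T) by (apply Rinv_0_lt_compat; lra).
  assert (itT : 0 < / (t - T)) by (apply Rinv_0_lt_compat; lra).
  assert (HK : 0 < K) by (unfold K; apply Rmult_lt_0_compat; lra).
  (* The height of the tent at the corner. The length changes by at most [e D + e^2 K], whose
     minimum, attained here, is [- D^2 / (4 K)]. *)
  set (e := - D / (2 * K)).
  assert (F1 : forall u, is_derive (fun u => e * / T * u) u (e * / T)) by (intros u; der; ring).
  assert (F2 : forall u, is_derive (fun u => - (e * / (t - T)) * (u - t)) u (- (e * / (t - T))))
    by (intros u; der; ring).
  set (f1 := fun u => e * / T * u) in *. set (f2 := fun u => - (e * / (t - T)) * (u - t)) in *.
  assert (W1 := C1with_variation n c1 v1 f1 _ Hn C1 F1 (ctn_const _)).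
  assert (W2 := C1with_variation n c2 v2 f2 _ Hn C2 F2 (ctn_const _)).
  assert (L1 := variation_length I1 I3 HI1 HI3 n c1 v1 f1 _ 0 T Hn C1 F1 (ctn_const _) ltac:(lra)
    (fun u _ => proj1 (G1 u)) (fun u _ => S1 u)).
  assert (L2 := variation_length I1 I3 HI1 HI3 n c2 v2 f2 _ T t Hn C2 F2 (ctn_const _) ltac:(lra)
    (fun u _ => proj1 (G2 u)) (fun u _ => S2 u)).
  cbv beta in L1, L2.
  assert (R1 : RInt (fun u => e * / T * bform I1 I3 (c1 u) (v1 u) (qmul n (c1 u))) 0 T = e * m1).
  { rewrite (RInt_ext _ (fun _ => e * / T * m1)) by (intros u _; now rewrite B1).
    rewrite RInt_R_const. change (e * / T * m1 * (T - 0) = e * m1). field. lra. }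
  assert (R2 : RInt (fun u => - (e * / (t - T)) * bform I1 I3 (c2 u) (v2 u) (qmul n (c2 u))) T t = - e * m2).
  { rewrite (RInt_ext _ (fun _ => - (e * / (t - T)) * m2)) by (intros u _; now rewrite B2).
    rewrite RInt_R_const. change (- (e * / (t - T)) * m2 * (t - T) = - e * m2). field. lra. }
  rewrite R1, RInt_R_const in L1. rewrite R2, RInt_R_const in L2.
  set (d1 := fun u => qmul (qrot n (f1 u)) (c1 u)) in *.
  set (d2 := fun u => qmul (qrot n (f2 u)) (c2 u)) in *.
  assert (Id0 : forall x, qmul (qrot n 0) x = x).
  { intros x. apply P4_eq; unfold qrot, qmul; cbn [qc0 qc1 qc2 qc3]; rewrite cos_0, sin_0; ring. }
  destruct (concat_curves I1 I3 d1 _ d2 _ 0 T T t W1 W2) as (c & Hc & Hl); try lra.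
  - intros u _. apply qmul_onS3; [now apply qrot_onS3|apply G1].
  - intros u _. apply qmul_onS3; [now apply qrot_onS3|apply G2].
  - unfold d1, d2. rewrite Em. do 2 f_equal. unfold f1, f2. field. lra.
  - exists c. replace (d1 0) with (c1 0) in Hc
      by (unfold d1, f1; rewrite Rmult_0_r; symmetry; apply Id0).
    replace (d2 t) with (c2 t) in Hc
      by (unfold d2, f2; replace (- (e * / (t - T)) * (t - t)) with 0 by ring; symmetry; apply Id0).
    split; [exact Hc|]. rewrite Hl.
    assert (E : e * D + e ^ 2 * K < 0).
    { replace (e * D + e ^ 2 * K) with (- (D ^ 2 * / (4 * K))) by (unfold e; field; lra).
      assert (0 < D ^ 2) by (apply pow2_gt_0; auto).
      assert (0 < / (4 * K)) by (apply Rinv_0_lt_compat; lra).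
      assert (0 < D ^ 2 * / (4 * K)) by (apply Rmult_lt_0_compat; auto). lra. }
    assert (E2 : 2 * (I1 + I3) * ((e * / T) ^ 2 * (T - 0)) +
       2 * (I1 + I3) * ((- (e * / (t - T))) ^ 2 * (t - T)) = e ^ 2 * K) by (unfold K; field; lra).
    assert (E3 : e * D = e * m1 + - e * m2) by (unfold D; ring). lra.
Qed.

Lemma geod_onS3 (s psi t : R) : -1 <= s <= 1 -> onS3 (geod s psi t).
Proof. intros Hs. apply (geod_geo I1 eta s psi Hs t). Qed.

Lemma omega_opp (s : R) : omega (- s) = omega s.
Proof. unfold frequency. replace ((- s) ^ 2) with (s ^ 2) by ring. reflexivity. Qed.

(* The competitor starts with the mirror image of the geodesic and continues with its
   translate by a generator of Z_p: both meet on the wall [|arg z| = pi/p]. *)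
Lemma wall_not_minimizing (p q : Z) (s psi T t sg rho : R) : (2 <= p)%Z ->
  -1 <= s <= 1 -> sg = 1 \/ sg = -1 -> 0 < T < t ->
  qc0 (geod s psi T) = rho * cos (PI / IZR p) ->
  qc3 (geod s psi T) = sg * (rho * sin (PI / IZR p)) ->
  ~ minimizingL p q I1 I3 (geod s psi) t.
Proof.
  intros Hp Hs Hsg HT E0 E3 Hmin.
  (* The generator that turns the argument [sg PI / p] into its mirror image [- sg PI / p]. *)
  assert (Hk : exists k : Z, IZR k = - sg).
  { destruct Hsg as [->| ->]; [exists (-1)%Z|exists 1%Z]; simpl; lra. }
  destruct Hk as [k Hk].
  assert (Hp2 : 2 <= IZR p) by (now apply IZR_le).
  set (th := 2 * PI * IZR k / IZR p). set (ph := 2 * PI * IZR (k * q) / IZR p).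
  assert (Eth : th = - sg * (2 * (PI / IZR p))) by (unfold th; rewrite Hk; field; lra).
  set (tau := omega s * T). set (d := eta * s * tau).
  (* Reversing [s] changes the phase of w from [psi - d] to [psi' + d]; this [psi'] matches it with
     the translated phase [psi - d + ph]. *)
  set (psi' := psi - 2 * d + ph).
  assert (Hs' : -1 <= - s <= 1) by lra.
  assert (HP := PI_RGT_0).
  assert (Hpp : 0 < PI / IZR p <= PI / 2).
  { split; [apply Rdiv_lt_0_compat; lra|]. apply Rmult_le_compat_l; [lra|]. apply Rinv_le_contravar; lra. }
  set (a := PI / IZR p) in *.
  assert (Ea : cos th * cos a - sin th * (sg * sin a) = cos a /\
               sin th * cos a + cos th * (sg * sin a) = - sg * sin a).
  { destruct Hsg as [->| ->].
    - replace th with (- (2 * a)) by (rewrite Eth; ring). rewrite cos_neg, sin_neg, cos_2a, sin_2a.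
      assert (E := cos2_sin2 a). assert (E' : sin a ^ 2 = 1 - cos a ^ 2) by lra. split; ring [E'].
    - replace th with (2 * a) by (rewrite Eth; ring). rewrite cos_2a, sin_2a.
      assert (E := cos2_sin2 a). assert (E' : sin a ^ 2 = 1 - cos a ^ 2) by lra. split; ring [E']. }
  assert (Em : geod (- s) psi' T = torus th ph (geod s psi T)).
  { assert (N0 : qc0 (geod (- s) psi' T) = qc0 (geod s psi T) /\ qc3 (geod (- s) psi' T) = - qc3 (geod s psi T)).
    { unfold geodesic; cbv zeta; cbn [qc0 qc3]. rewrite omega_opp. fold tau.
      replace (eta * - s * tau) with (- d) by (unfold d; ring). fold d. rewrite cos_neg, sin_neg. split; ring. }
    destruct N0 as [N0 N3]. destruct Ea as [Ea0 Ea3].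
    apply P4_eq; unfold torus; cbn [qc0 qc1 qc2 qc3].
    - rewrite N0, E0, E3. transitivity (rho * (cos th * cos a - sin th * (sg * sin a))); [rewrite Ea0; ring|ring].
    - unfold geodesic; cbv zeta; cbn [qc1 qc2]. rewrite omega_opp. fold tau.
      replace (eta * - s * tau) with (- d) by (unfold d; ring). fold d.
      replace ((- s) ^ 2) with (s ^ 2) by ring.
      replace (psi' - - d) with (ph + (psi - d)) by (unfold psi'; ring). rewrite cos_plus. ring.
    - unfold geodesic; cbv zeta; cbn [qc1 qc2]. rewrite omega_opp. fold tau.
      replace (eta * - s * tau) with (- d) by (unfold d; ring). fold d.
      replace ((- s) ^ 2) with (s ^ 2) by ring.
      replace (psi' - - d) with (ph + (psi - d)) by (unfold psi'; ring). rewrite sin_plus. ring.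
    - rewrite N3, E0, E3. transitivity (rho * (sin th * cos a + cos th * (sg * sin a))); [rewrite Ea3; ring|ring]. }
  assert (Ho := omega_pos I1 I3 eta HI3 HI Heta s Hs).
  (* Opposite third components force [s = 0]; the remaining phases would then differ by a multiple
     of [2 PI], whereas they differ by [th], with [0 < |th| <= PI]. *)
  assert (HMd : geodM (- s) psi' <> rotM (th + ph) (geodM s psi)).
  { intros E.
    assert (X1 := f_equal qc1 E). assert (X2 := f_equal qc2 E). assert (X3 := f_equal qc3 E).
    unfold geodesic_momentum, rotM in X1, X2, X3. cbn [qc1 qc2 qc3] in X1, X2, X3.
    rewrite omega_opp in X1, X2, X3.
    assert (s = 0) by nra. subst s.
    replace ((- 0) ^ 2) with (0 ^ 2) in X1, X2 by ring.
    replace (1 - 0 ^ 2) with 1 in X1, X2 by ring. rewrite sqrt_1, Rmult_1_r in X1, X2.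
    assert (Y1 : cos psi' = cos (th + ph + psi)).
    { rewrite cos_plus. apply (Rmult_eq_reg_l (omega 0)); [rewrite X1; ring|lra]. }
    assert (Y2 : sin psi' = sin (th + ph + psi)).
    { rewrite sin_plus. apply (Rmult_eq_reg_l (omega 0)); [rewrite X2; ring|lra]. }
    assert (Z : cos th = 1).
    { replace th with (th + ph + psi - psi').
      - rewrite cos_minus, <- Y1, <- Y2. assert (H := cos2_sin2 psi'). lra.
      - unfold psi', d. ring. }
    assert (Z2 : cos (2 * a) = 1).
    { rewrite <- Z, Eth. destruct Hsg as [->| ->].
      - replace (- (1) * (2 * a)) with (- (2 * a)) by ring. now rewrite cos_neg.
      - f_equal. ring. }
    assert (cos (2 * a) < 1); [|lra]. rewrite <- cos_0. apply cos_decreasing_1; lra. }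
  destruct (corner_shortcut (geodM (- s) psi') (rotM (th + ph) (geodM s psi))
     (geod (- s) psi') (geodv (- s) psi')
     (fun u => torus th ph (geod s psi u)) (fun u => torus th ph (geodv s psi u)) T t)
    as (c & Hc & Hl); auto.
  - now apply geod_geo.
  - apply geo_torus; auto. now apply geod_geo.
  - now apply geod_C1.
  - apply C1with_torus. now apply geod_C1.
  - intros u. now apply geod_speed2.
  - intros u. rewrite torus_speed2. now apply geod_speed2.
  - rewrite geod_0 in Hc.
    assert (M := Hmin k c 0 2 Hc). rewrite geod_len with (I3 := I3) in M; auto; lra.
Qed.

Lemma act_0 (p q : Z) (x : P4) : act p q 0 x = x.
Proof.
  rewrite act_torus. rewrite Z.mul_0_l.
  replace (2 * PI * 0 / IZR p) with 0 by (unfold Rdiv; ring).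
  apply P4_eq; unfold torus; cbn [qc0 qc1 qc2 qc3]; rewrite cos_0, sin_0; ring.
Qed.

(** The phase [psi + PI] reverses the horizontal momentum, which is nonzero exactly for [|s| < 1];
    otherwise the two geodesics coincide and there is no corner. *)
Lemma antipode_not_minimizing (p q : Z) (s psi T t : R) : -1 < s < 1 ->
  omega s * T = PI -> 0 < T < t -> ~ minimizingL p q I1 I3 (geod s psi) t.
Proof.
  intros Hs HTo HT Hmin. assert (Hs' : -1 <= s <= 1) by lra.
  assert (Ho := omega_pos I1 I3 eta HI3 HI Heta s Hs').
  destruct (corner_shortcut (geodM s (psi + PI)) (geodM s psi) (geod s (psi + PI)) (geodv s (psi + PI))
    (geod s psi) (geodv s psi) T t) as (c & Hc & Hl); auto using geod_geo, geod_C1.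
  - intros u. now apply geod_speed2.
  - intros u. now apply geod_speed2.
  - unfold geodesic; cbv zeta. rewrite HTo, sin_PI. apply P4_eq; cbn [qc0 qc1 qc2 qc3]; ring.
  - intros E. assert (X1 := f_equal qc1 E). assert (X2 := f_equal qc2 E).
    unfold geodesic_momentum in X1, X2. cbn [qc1 qc2] in X1, X2.
    rewrite neg_cos in X1. rewrite neg_sin in X2.
    assert (Hr : 0 < sqrt (1 - s ^ 2)) by (apply sqrt_lt_R0; nra).
    assert (Hor : 0 < omega s * sqrt (1 - s ^ 2)) by (apply Rmult_lt_0_compat; auto).
    set (k := omega s * sqrt (1 - s ^ 2)) in *.
    assert (cos psi = 0) by nra. assert (sin psi = 0) by nra.
    assert (H1 := cos2_sin2 psi). rewrite H, H0 in H1. lra.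
  - rewrite geod_0 in Hc. rewrite <- (act_0 p q (geod s psi t)) in Hc.
    assert (M := Hmin 0%Z c 0 2 Hc). rewrite geod_len with (I3 := I3) in M; auto; lra.
Qed.

(* Right after [tau = pi] the fibre through [o] is beaten by the geodesics with [|s| < 1],
   which return to it exactly at [tau = pi]. *)
Lemma fibre_not_minimizing (p q : Z) (sg psi T t : R) : sg = 1 \/ sg = -1 -> eta < 0 ->
  omega sg * T = PI -> 0 < T < t -> ~ minimizingL p q I1 I3 (geod sg psi) t.
Proof.
  intros Hsg He HTo HT Hmin. assert (HP := PI_RGT_0).
  assert (Hs : -1 <= sg <= 1) by (destruct Hsg; subst; lra).
  assert (Hsg2 : sg * sg = 1) by (destruct Hsg; subst; ring).
  assert (Hsg3 : sg ^ 2 = 1) by (destruct Hsg; subst; ring).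
  assert (Ho := omega_pos I1 I3 eta HI3 HI Heta sg Hs).
  assert (HI1 := I1_pos I1 I3 eta HI3 HI Heta).
  set (x := omega sg * t / PI).
  assert (Hx : 1 < x).
  { unfold x. apply (Rmult_lt_reg_r PI); auto. unfold Rdiv. rewrite Rmult_assoc, Rinv_l by lra.
    rewrite Rmult_1_l, Rmult_1_r, <- HTo. apply Rmult_lt_compat_l; lra. }
  (* The largest decrease of the parameter for which the fibre passes the meeting point no later
     than at [t]. *)
  set (dl := (x - 1) * (1 + eta) / - eta).
  assert (Hdl : 0 < dl) by (unfold dl; apply Rdiv_lt_0_compat; [apply Rmult_lt_0_compat|]; lra).
  set (u := Rmin dl (1 / 2)).
  assert (Hu0 : 0 < u) by (apply Rmin_pos; lra).
  assert (Hu1 : u <= dl) by apply Rmin_l. assert (Hu2 : u <= 1 / 2) by apply Rmin_r.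
  set (s' := 1 - u).
  (* The geodesic with parameter [s'] returns to the fibre at angle [PI (1 + eta s')], and the fibre
     itself advances by [(1 + eta) tau]. *)
  set (t' := PI * (1 + eta * s') / (1 + eta) / omega sg).
  assert (Hpos : 0 < 1 + eta * s') by (unfold s'; nra).
  assert (Ht' : omega sg * t' = PI * (1 + eta * s') / (1 + eta)) by (unfold t'; field; lra).
  assert (Ht'0 : 0 < t').
  { unfold t'. apply Rdiv_lt_0_compat; auto. apply Rdiv_lt_0_compat; [apply Rmult_lt_0_compat|]; lra. }
  assert (Ht't : t' <= t).
  { apply (Rmult_le_reg_l (omega sg)); auto. rewrite Ht'.
    replace (omega sg * t) with (PI * x) by (unfold x; field; lra).
    unfold Rdiv. rewrite Rmult_assoc. apply Rmult_le_compat_l; [lra|].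
    apply (Rmult_le_reg_r (1 + eta)); [lra|]. rewrite Rmult_assoc, Rinv_l, Rmult_1_r by lra.
    assert (- eta * u <= - eta * dl) by (apply Rmult_le_compat_l; lra).
    replace (- eta * dl) with ((x - 1) * (1 + eta)) in H by (unfold dl; field; lra).
    unfold s'. lra. }
  assert (Hmin' := minimizingL_prefix p q I1 I3 (geod sg psi) (geodv sg psi) t t'
    (geod_C1 I1 eta sg psi Hs) (fun y _ => geod_onS3 sg psi y Hs) (conj (Rlt_le _ _ Ht'0) Ht't) Hmin).
  assert (Hss : -1 <= sg * s' <= 1) by (unfold s'; destruct Hsg; subst; lra).
  assert (Hss2 : (sg * s') ^ 2 = s' ^ 2) by (transitivity (sg * sg * s' ^ 2); [ring|rewrite Hsg2; ring]).
  assert (Ho' := omega_pos I1 I3 eta HI3 HI Heta (sg * s') Hss).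
  set (T' := PI / omega (sg * s')).
  assert (HT' : omega (sg * s') * T' = PI) by (unfold T'; field; lra).
  assert (HT'0 : 0 < T') by (unfold T'; apply Rdiv_lt_0_compat; auto).
  assert (Epoint : geod (sg * s') 0 T' = geod sg psi t').
  { destruct (geod_polar I1 eta (sg * s') 0 T' sg 1 PI Hsg2) as [A0 A3].
    - rewrite HT'; ring.
    - rewrite HT', sin_PI; ring.
    - destruct (geod_polar I1 eta sg psi t' sg 1 (omega sg * t') Hsg2) as [B0 B3].
      + ring.
      + rewrite Hsg2; ring.
      + rewrite HT' in A0, A3. rewrite Hsg2, Ht' in B0, B3.
        replace (sg * (sg * s')) with s' in A0, A3 by (rewrite <- Rmult_assoc, Hsg2; ring).
        replace (PI * (1 + eta * s') / (1 + eta) + eta * 1 * (PI * (1 + eta * s') / (1 + eta)))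
          with (PI + eta * s' * PI) in B0, B3 by (field; lra).
        apply P4_eq.
        * rewrite A0, B0; ring.
        * unfold geodesic; cbv zeta; cbn [qc1]. rewrite HT', sin_PI, Hsg3.
          replace (1 - 1) with 0 by ring. rewrite sqrt_0. ring.
        * unfold geodesic; cbv zeta; cbn [qc2]. rewrite HT', sin_PI, Hsg3.
          replace (1 - 1) with 0 by ring. rewrite sqrt_0. ring.
        * rewrite A3, B3; ring. }
  assert (Adm : admissible (geod (sg * s') 0) 0 T' idP (act p q 0 (geod sg psi t'))).
  { rewrite act_0. split; [lra|]. split; [exact (C1with_C1curve _ _ (geod_C1 I1 eta _ 0 Hss))|].
    split; [intros y _; now apply geod_onS3|]. split; [apply geod_0|exact Epoint]. }
  assert (M := Hmin' 0%Z _ 0 T' Adm).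
  rewrite !(geod_len I1 I3 eta HI3 HI Heta) in M by (auto; lra).
  assert (Q1 := omega_sqr I1 I3 eta HI3 HI Heta (sg * s') Hss).
  assert (Q2 := omega_sqr I1 I3 eta HI3 HI Heta sg Hs).
  rewrite Hss2 in Q1. rewrite Hsg3 in Q2.
  assert (A1 : T' ^ 2 = 4 * I1 * PI ^ 2 * (1 + eta * s' ^ 2)).
  { transitivity (T' ^ 2 * (4 * I1 * (omega (sg * s') ^ 2 * (1 + eta * s' ^ 2)))); [rewrite Q1; ring|].
    transitivity (4 * I1 * (omega (sg * s') * T') ^ 2 * (1 + eta * s' ^ 2)); [ring|rewrite HT'; ring]. }
  assert (A2 : t' ^ 2 = 4 * I1 * PI ^ 2 * ((1 + eta * s') ^ 2 / (1 + eta))).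
  { transitivity (t' ^ 2 * (4 * I1 * (omega sg ^ 2 * (1 + eta * 1)))); [rewrite Q2; ring|].
    transitivity (4 * I1 * (omega sg * t') ^ 2 * (1 + eta)); [ring|rewrite Ht'; field; lra]. }
  (* Times [1 + eta], the gap is exactly [- eta (1 - s')^2]. *)
  assert (A3 : 1 + eta * s' ^ 2 < (1 + eta * s') ^ 2 / (1 + eta)).
  { apply (Rmult_lt_reg_r (1 + eta)); [lra|].
    replace ((1 + eta * s') ^ 2 / (1 + eta) * (1 + eta)) with ((1 + eta * s') ^ 2) by (field; lra).
    assert (0 < - eta * (1 - s') ^ 2); [|nra].
    apply Rmult_lt_0_compat; [lra|]. unfold s'. nra. }
  assert (A4 : T' ^ 2 < t' ^ 2).
  { rewrite A1, A2. apply Rmult_lt_compat_l; auto.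
    apply Rmult_lt_0_compat; [lra|]. nra. }
  nra.
Qed.

(** Another lift of the endpoint has argument shifted by a multiple of [2 PI / p], which cannot
    increase the cosine while the argument is at most [PI / p]. As [PI / p <= PI / 2], the
    quarter-turn condition for [eta > 0] holds as well. *)
Lemma geod_minimizing (p q : Z) (s psi T sg rho f0 : R) : (2 <= p)%Z ->
  -1 <= s <= 1 -> sg = 1 \/ sg = -1 -> 0 <= sg * s ->
  let tau := omega s * T in let al := f0 + eta * (sg * s) * tau in
  0 < tau <= PI -> 0 <= rho -> 0 <= f0 <= PI ->
  rho * cos f0 = cos tau -> rho * sin f0 = sg * s * sin tau ->
  0 <= al <= PI / IZR p -> minimizingL p q I1 I3 (geod s psi) T.
Proof.
  intros Hp Hs Hsg Hss tau al Ht Hr Hf Hc Hsn Hal k c a b (Hab & Hcc & Hcs & Ha & Hb).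
  assert (Hp2 : 2 <= IZR p) by (now apply IZR_le). assert (HP := PI_RGT_0).
  assert (Hsg2 : sg * sg = 1) by (destruct Hsg; subst; ring).
  assert (Ho := omega_pos I1 I3 eta HI3 HI Heta s Hs).
  assert (HT : 0 < T) by (unfold tau in Ht; apply (Rmult_lt_reg_l (omega s)); lra).
  rewrite (geod_len I1 I3 eta HI3 HI Heta s psi 0 T Hs), Rminus_0_r by lra.
  set (th := 2 * PI * IZR k / IZR p).
  destruct (geod_polar I1 eta s psi T sg rho f0 Hsg2 Hc Hsn) as [G0 G3].
  fold tau al in G0, G3.
  destruct (polar_sign sg rho al Hsg) as [P0 P3]. rewrite P0 in G0. rewrite P3 in G3.
  apply (geod_lower_bound I1 I3 eta HI3 HI Heta s psi T sg rho f0 c (velocity c) a b (th + sg * al));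
    auto using C1curve_C1with; fold tau al; try lra.
  - intros _. assert (PI / IZR p <= PI / 2); [|lra].
    apply Rmult_le_compat_l; [lra|]. apply Rinv_le_contravar; lra.
  - destruct Hsg as [->| ->].
    + rewrite Rmult_1_l, Rplus_comm. now apply cos_orbit_le.
    + replace (th + -1 * al) with (- (al + 2 * PI * IZR (- k) / IZR p))
        by (unfold th; rewrite opp_IZR; field; lra).
      rewrite cos_neg. now apply cos_orbit_le.
  - rewrite Hb, act_torus. unfold torus; cbn [qc0]. rewrite G0, G3, cos_plus. fold th. ring.
  - rewrite Hb, act_torus. unfold torus; cbn [qc3]. rewrite G0, G3, sin_plus. fold th. ring.
Qed.

Lemma cutTime_intro (p q : Z) (s psi T : R) : -1 <= s <= 1 -> 0 <= T ->
  minimizingL p q I1 I3 (geod s psi) T ->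
  (forall t, T < t -> ~ minimizingL p q I1 I3 (geod s psi) t) ->
  cutTime p q I1 I3 (geod s psi) T.
Proof.
  intros Hs HT Hm Hn. split; [exact HT|]. split; [|exact Hn].
  intros t Ht. apply (minimizingL_prefix p q I1 I3 (geod s psi) (geodv s psi) T t); auto.
  - now apply geod_C1.
  - intros u _. now apply geod_onS3.
Qed.

Lemma cutTime_wall (p q : Z) (s psi T sg rho f0 : R) : (2 <= p)%Z ->
  -1 <= s <= 1 -> sg = 1 \/ sg = -1 -> 0 <= sg * s ->
  let tau := omega s * T in
  0 < tau <= PI -> 0 <= rho -> 0 <= f0 <= PI ->
  rho * cos f0 = cos tau -> rho * sin f0 = sg * s * sin tau ->
  f0 + eta * (sg * s) * tau = PI / IZR p ->
  cutTime p q I1 I3 (geod s psi) T /\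
  qc0 (geod s psi T) = rho * cos (PI / IZR p) /\
  qc3 (geod s psi T) = sg * (rho * sin (PI / IZR p)).
Proof.
  intros Hp Hs Hsg Hss tau Ht Hr Hf Hc Hsn Hal.
  assert (Hp2 : 2 <= IZR p) by (now apply IZR_le). assert (HP := PI_RGT_0).
  assert (Hpp : 0 < PI / IZR p) by (apply Rdiv_lt_0_compat; lra).
  assert (Hsg2 : sg * sg = 1) by (destruct Hsg; subst; ring).
  assert (Ho := omega_pos I1 I3 eta HI3 HI Heta s Hs).
  assert (HT : 0 < T) by (unfold tau in Ht; apply (Rmult_lt_reg_l (omega s)); lra).
  destruct (geod_polar I1 eta s psi T sg rho f0 Hsg2 Hc Hsn) as [G0 G3].
  fold tau in G0, G3. rewrite Hal in G0, G3. split; [|auto].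
  apply cutTime_intro; auto; [lra| |].
  - apply (geod_minimizing p q s psi T sg rho f0); auto; fold tau; lra.
  - intros t Hlt. apply (wall_not_minimizing p q s psi T t sg rho); auto.
Qed.

(** At [tau = PI] one has [rho = 1] and [f0 = PI], so the argument is [PI (1 + eta |s|)]. Its bound
    by [PI / p] forces [eta < 0]; later times are excluded by the corner if [|s| < 1] and by the
    fibre comparison if [|s| = 1]. *)
Lemma cutTime_fibre (p q : Z) (s psi sg : R) : (2 <= p)%Z ->
  -1 <= s <= 1 -> sg = 1 \/ sg = -1 -> 0 <= sg * s ->
  0 <= PI * (1 + eta * (sg * s)) <= PI / IZR p ->
  let T := PI / omega s in
  cutTime p q I1 I3 (geod s psi) T /\
  geod s psi T = mkP4 (cos (PI * (1 + eta * (sg * s)))) 0 0 (sg * sin (PI * (1 + eta * (sg * s)))).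
Proof.
  intros Hp Hs Hsg Hss Hal T.
  assert (Hp2 : 2 <= IZR p) by (now apply IZR_le). assert (HP := PI_RGT_0).
  assert (Hpp : PI / IZR p <= PI / 2) by (apply Rmult_le_compat_l; [lra|]; apply Rinv_le_contravar; lra).
  assert (Hsg2 : sg * sg = 1) by (destruct Hsg; subst; ring).
  assert (Ho := omega_pos I1 I3 eta HI3 HI Heta s Hs).
  assert (HTo : omega s * T = PI) by (unfold T; field; lra).
  assert (HT : 0 < T) by (unfold T; apply Rdiv_lt_0_compat; auto).
  assert (Hc : 1 * cos PI = cos (omega s * T)) by (rewrite HTo; ring).
  assert (Hsn : 1 * sin PI = sg * s * sin (omega s * T)) by (rewrite HTo, sin_PI; ring).
  assert (Eal : PI + eta * (sg * s) * (omega s * T) = PI * (1 + eta * (sg * s))) by (rewrite HTo; ring).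
  split.
  - apply cutTime_intro; auto; [lra| |].
    + apply (geod_minimizing p q s psi T sg 1 PI); auto; try rewrite Eal; try lra.
    + intros t Hlt.
      assert (He : eta < 0).
      { destruct (Rlt_le_dec eta 0) as [|Hge]; auto. exfalso.
        assert (0 <= PI * (eta * (sg * s))) by (apply Rmult_le_pos; [lra|apply Rmult_le_pos; lra]). lra. }
      destruct (Req_dec (sg * s) 1) as [E|E].
      * assert (s = sg) by (transitivity (sg * sg * s); [rewrite Hsg2; ring|rewrite Rmult_assoc, E; ring]).
        subst s. now apply (fibre_not_minimizing p q sg psi T t).
      * apply (antipode_not_minimizing p q s psi T t); auto.
        destruct Hsg; subst sg; lra.
  - destruct (geod_polar I1 eta s psi T sg 1 PI Hsg2 Hc Hsn) as [G0 G3].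
    rewrite Eal in G0, G3. apply P4_eq; cbn [qc0 qc1 qc2 qc3].
    + rewrite G0; ring.
    + unfold geodesic; cbv zeta; cbn [qc1]. rewrite HTo, sin_PI; ring.
    + unfold geodesic; cbv zeta; cbn [qc2]. rewrite HTo, sin_PI; ring.
    + rewrite G3; ring.
Qed.

End CutTimes.

(** * The cut locus *)

Lemma ctn_inv (f : R -> R) : ctn f -> (forall t, f t <> 0) -> ctn (fun t => / f t).
Proof.
  intros Hf Hn t. apply continuity_pt_filterlim. apply (continuity_pt_inv f t); auto.
  apply continuity_pt_filterlim, Hf.
Qed.

Lemma ctn_atan (f : R -> R) : ctn f -> ctn (fun t => atan (f t)).
Proof. intros Hf; apply (ctn_comp atan f Hf); intros t; apply continuous_atan. Qed.

Lemma IVT_ctn (f : R -> R) (a b y : R) : ctn f -> a <= b -> f a <= y <= f b ->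
  exists x, a <= x <= b /\ f x = y.
Proof.
  intros Hf Hab Hy.
  destruct (IVT_gen f a b y (ctn_continuity f Hf)) as [x [Hx E]].
  - rewrite Rmin_left, Rmax_right; lra.
  - exists x. rewrite Rmin_left, Rmax_right in Hx by lra. auto.
Qed.

(* [f] is the continuous argument of [cos tau + i s sin tau], computed from
   [e^{-i tau} (cos tau + i s sin tau)], whose real part is positive. *)
Lemma continuous_argument (s : R) : 0 < s <= 1 -> exists f : R -> R,
  ctn f /\ f 0 = 0 /\ f PI = PI /\
  forall tau, 0 <= tau <= PI -> 0 <= f tau <= PI /\
    exists rho, 0 <= rho /\ rho * cos (f tau) = cos tau /\ rho * sin (f tau) = s * sin tau.
Proof.
  intros Hs. assert (HP := PI_RGT_0).
  set (re := fun t => cos t ^ 2 + s * sin t ^ 2).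
  set (im := fun t => (s - 1) * (sin t * cos t)).
  assert (Hre : forall t, 0 < re t).
  { intros t. unfold re. assert (A := cos2_sin2 t). assert (B := pow2_ge_0 (sin t)).
    assert (C := pow2_ge_0 (cos t)).
    assert (D := Rmult_le_compat_l (1 - s) (sin t ^ 2) 1 ltac:(lra) ltac:(lra)). lra. }
  set (f := fun t => t + atan (im t * / re t)).
  assert (Hfc : ctn f).
  { unfold f. apply ctn_plus; [apply ctn_id|]. apply ctn_atan, ctn_mult.
    - unfold im; cts.
    - apply ctn_inv; [unfold re; cts|]. intros t E. assert (H := Hre t). lra. }
  exists f. split; [exact Hfc|]. split; [|split].
  - unfold f, im. rewrite sin_0. replace ((s - 1) * (0 * cos 0) * / re 0) with 0 by ring.
    rewrite atan_0; ring.
  - unfold f, im. rewrite sin_PI. replace ((s - 1) * (0 * cos PI) * / re PI) with 0 by ring.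
    rewrite atan_0; ring.
  - intros tau Ht. unfold f. set (y := im tau * / re tau). set (g := atan y).
    assert (Hg := atan_bound y). fold g in Hg.
    assert (Hcg : 0 < cos g) by (apply cos_gt_0; lra).
    assert (Hsg : sin g = y * cos g).
    { assert (E := tan_atan y). fold g in E. rewrite <- E. unfold tan. field. lra. }
    set (rho := re tau / cos g).
    assert (Hr : 0 < rho) by (apply Rdiv_lt_0_compat; auto).
    assert (R1 : rho * cos g = re tau) by (unfold rho; field; lra).
    assert (R2 : rho * sin g = im tau).
    { rewrite Hsg. unfold rho, y. assert (H := Hre tau). field. split; lra. }
    assert (E := cos2_sin2 tau). assert (E' : sin tau ^ 2 = 1 - cos tau ^ 2) by lra.
    assert (C1 : rho * cos (tau + g) = cos tau).
    { rewrite cos_plus. transitivity (cos tau * (rho * cos g) - sin tau * (rho * sin g)); [ring|].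
      rewrite R1, R2. unfold re, im. ring [E']. }
    assert (C2 : rho * sin (tau + g) = s * sin tau).
    { rewrite sin_plus. transitivity (sin tau * (rho * cos g) + cos tau * (rho * sin g)); [ring|].
      rewrite R1, R2. unfold re, im.
      transitivity (s * sin tau * (cos tau ^ 2 + sin tau ^ 2)); [ring|rewrite E; ring]. }
    split; [|exists rho; repeat split; auto; lra].
    (* [tau + g] lies within [PI / 2] of [[0, PI]] and has a nonnegative sine, so it belongs to
       [[0, PI]]. *)
    assert (S : 0 <= s * sin tau) by (apply Rmult_le_pos; [lra|apply sin_ge_0; lra]).
    split.
    + destruct (Rle_lt_dec 0 (tau + g)) as [|Hlt]; auto. exfalso.
      assert (sin (tau + g) < 0) by (apply sin_lt_0_var; lra). nra.
    + destruct (Rle_lt_dec (tau + g) PI) as [|Hlt]; auto. exfalso.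
      assert (sin (tau + g) < 0) by (apply sin_lt_0; lra). nra.
Qed.

Lemma torus_torus (a b a' b' : R) (x : P4) : torus a b (torus a' b' x) = torus (a + a') (b + b') x.
Proof.
  apply P4_eq; unfold torus; cbn [qc0 qc1 qc2 qc3]; rewrite ?cos_plus, ?sin_plus; ring.
Qed.

Lemma act_act (p q j k : Z) (x : P4) : act p q j (act p q k x) = act p q (j + k) x.
Proof.
  rewrite !act_torus, torus_torus. f_equal.
  - rewrite plus_IZR. unfold Rdiv. ring.
  - rewrite Z.mul_add_distr_r, plus_IZR. unfold Rdiv. ring.
Qed.

Lemma sameorbit_trans (p q : Z) (x y z : P4) : sameorbit p q x y -> sameorbit p q y z -> sameorbit p q x z.
Proof. intros [k ->] [j ->]. exists (j + k)%Z. now rewrite act_act. Qed.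

Lemma torus_circle (a b f : R) : torus a b (mkP4 (cos f) 0 0 (sin f)) = mkP4 (cos (a + f)) 0 0 (sin (a + f)).
Proof.
  apply P4_eq; unfold torus; cbn [qc0 qc1 qc2 qc3]; rewrite ?cos_plus, ?sin_plus; ring.
Qed.

Lemma Rabs_sign (x : R) : exists sg, (sg = 1 \/ sg = -1) /\ x = sg * Rabs x.
Proof. unfold Rabs. destruct (Rcase_abs x); [exists (-1)|exists 1]; split; auto; ring. Qed.

Lemma Rabs_sg (sg x : R) : sg = 1 \/ sg = -1 -> 0 <= x -> Rabs (sg * x) = x.
Proof.
  intros Hsg Hx. rewrite Rabs_mult, (Rabs_right x) by lra.
  replace (Rabs sg) with 1; [ring|]. destruct Hsg as [->| ->]; [|rewrite Rabs_left by lra].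
  - now rewrite Rabs_R1.
  - ring.
Qed.

Section CutLocus.
Variables (p q : Z) (I1 I3 eta : R).
Hypotheses (Hp : (2 <= p)%Z) (HI3 : 0 < I3) (HI : I1 = I3 * (1 + eta)) (Heta : -1 < eta).

Notation geod := (geodesic I1 eta).
Notation omega := (frequency I1 eta).

Lemma IZR_p : 2 <= IZR p.
Proof. now apply IZR_le. Qed.

Lemma PI_p : 0 < PI / IZR p <= PI / 2.
Proof.
  assert (H := IZR_p). assert (HP := PI_RGT_0). split; [apply Rdiv_lt_0_compat; lra|].
  apply Rmult_le_compat_l; [lra|]. apply Rinv_le_contravar; lra.
Qed.

Lemma dL_of_polar (x : P4) (sg rho : R) : onS3 x -> sg = 1 \/ sg = -1 -> 0 <= rho ->
  qc0 x = rho * cos (PI / IZR p) -> qc3 x = sg * (rho * sin (PI / IZR p)) -> dL p x.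
Proof.
  intros Hx Hsg Hr E0 E3. split; auto. assert (Hpp := PI_p).
  assert (Hs : 0 <= sin (PI / IZR p)) by (apply sin_ge_0; lra).
  assert (Hrs : 0 <= rho * sin (PI / IZR p)) by (apply Rmult_le_pos; auto).
  rewrite E0, E3, Rabs_sg by auto. ring.
Qed.

Lemma polar_of_dL (x : P4) : dL p x -> exists sg rho, (sg = 1 \/ sg = -1) /\ 0 <= rho /\
  qc0 x = rho * cos (PI / IZR p) /\ qc3 x = sg * (rho * sin (PI / IZR p)) /\
  qc1 x ^ 2 + qc2 x ^ 2 = 1 - rho ^ 2.
Proof.
  intros [Hx E]. assert (Hpp := PI_p). set (a := PI / IZR p) in *.
  assert (HP := PI_RGT_0).
  assert (Hs : 0 < sin a) by (apply sin_gt_0; lra).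
  assert (C := cos2_sin2 a).
  set (rho := Rabs (qc3 x) / sin a).
  assert (E3 : Rabs (qc3 x) = rho * sin a) by (unfold rho; field; lra).
  assert (E0 : qc0 x = rho * cos a).
  { apply (Rmult_eq_reg_r (sin a)); [|lra]. rewrite E, E3. ring. }
  assert (Hr : 0 <= rho).
  { unfold rho. apply Rmult_le_pos; [apply Rabs_pos|]. left; now apply Rinv_0_lt_compat. }
  destruct (Rabs_sign (qc3 x)) as (sg & Hsg & E3'). exists sg, rho. rewrite <- E3.
  repeat split; auto.
  unfold onS3 in Hx. assert (Q : qc0 x ^ 2 + qc3 x ^ 2 = rho ^ 2).
  { rewrite <- (pow2_abs (qc3 x)), E3, E0. transitivity (rho ^ 2 * (cos a ^ 2 + sin a ^ 2)); [ring|rewrite C; ring]. }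
  lra.
Qed.

(** The argument moves continuously from 0 to [PI (1 + eta |s|)]. If that value reaches [PI / p],
    any crossing of the wall is the cut time, so no monotonicity enters; otherwise the cut happens
    at [tau = PI], on the arc. *)
Lemma geod_cut_point (s psi : R) : -1 <= s <= 1 ->
  exists T, cutTime p q I1 I3 (geod s psi) T /\
    (dL p (geod s psi T) \/ (eta < - ((IZR p - 1) / IZR p) /\ Jset p eta (geod s psi T))).
Proof.
  intros Hs. assert (Hp2 := IZR_p). assert (Hpp := PI_p). assert (HP := PI_RGT_0).
  assert (Ho := omega_pos I1 I3 eta HI3 HI Heta s Hs).
  destruct (Req_dec s 0) as [->|Hs0].
  (* For [s = 0] the coordinate z is the real number [cos tau]; it vanishes here, so [rho = 0] and
     the argument can be declared to be [PI / p]. *)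
  - exists (PI / 2 / omega 0).
    assert (Eo : omega 0 * (PI / 2 / omega 0) = PI / 2) by (field; lra).
    destruct (cutTime_wall I1 I3 eta HI3 HI Heta p q 0 psi (PI / 2 / omega 0) 1 0 (PI / IZR p))
      as (H1 & H2 & H3); auto; rewrite ?Eo, ?cos_PI2, ?sin_PI2; try lra.
    split; auto. left. apply (dL_of_polar _ 1 0); auto; try lra. apply geod_onS3; lra.
  - destruct (sign_ex s) as (sg & Hsg2 & Hss & Hsg).
    assert (Hs' : 0 < sg * s <= 1).
    { split; [|destruct Hsg; subst; lra]. destruct Hsg; subst sg; lra. }
    destruct (Rle_lt_dec (PI / IZR p) (PI * (1 + eta * (sg * s)))) as [Hcase|Hcase].
    + destruct (continuous_argument (sg * s) Hs') as (f & Hf & F0 & FP & Hfs).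
      destruct (IVT_ctn (fun t => f t + eta * (sg * s) * t) 0 PI (PI / IZR p)) as (tau & Ht & Et).
      * cts.
      * lra.
      * rewrite F0, FP. lra.
      * assert (Ht0 : 0 < tau).
        { destruct (Req_dec tau 0) as [->|]; [|lra]. rewrite F0 in Et. lra. }
        destruct (Hfs tau Ht) as (Hft & rho & Hr & Hc & Hsn).
        set (T := tau / omega s). assert (ET : omega s * T = tau) by (unfold T; field; lra).
        exists T. destruct (cutTime_wall I1 I3 eta HI3 HI Heta p q s psi T sg rho (f tau))
          as (H1 & H2 & H3); auto; rewrite ?ET; auto; try lra.
        split; auto. left. apply (dL_of_polar _ sg rho); auto. now apply geod_onS3.
    + assert (He : eta < 0).
      { destruct (Rlt_le_dec eta 0) as [|Hge]; auto. exfalso.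
        assert (0 <= PI * (eta * (sg * s))) by (apply Rmult_le_pos; [lra|apply Rmult_le_pos; lra]). lra. }
      assert (Hge : 1 + eta <= 1 + eta * (sg * s)) by nra.
      assert (Hpos : PI * (1 + eta) <= PI * (1 + eta * (sg * s))) by (apply Rmult_le_compat_l; lra).
      assert (Hpos0 : 0 < PI * (1 + eta)) by (apply Rmult_lt_0_compat; lra).
      destruct (cutTime_fibre I1 I3 eta HI3 HI Heta p q s psi sg Hp Hs Hsg Hss ltac:(lra)) as [H1 H2].
      exists (PI / omega s). split; auto. right. rewrite H2.
      set (al := PI * (1 + eta * (sg * s))) in *. split.
      * assert (K : 1 + eta < / IZR p).
        { apply (Rmult_lt_reg_l PI); auto. unfold Rdiv in Hcase. lra. }
        replace ((IZR p - 1) / IZR p) with (1 - / IZR p) by (field; lra). lra.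
      * assert (Hsal : 0 <= sin al) by (apply sin_ge_0; lra).
        assert (Hcal : 0 <= cos al) by (apply cos_ge_0; lra).
        assert (Ea := Rabs_sg sg (sin al) Hsg Hsal).
        assert (C := cos2_sin2 al).
        unfold Jset, onS3; cbn [qc0 qc1 qc2 qc3]. rewrite Ea.
        replace (PI * Rabs eta) with (PI - PI * (1 + eta)) by (rewrite Rabs_left by lra; ring).
        rewrite sin_PI_x. repeat split; auto.
        -- transitivity (cos al ^ 2 + sg * sg * sin al ^ 2); [ring|rewrite Hsg2; lra].
        -- apply sin_incr_1; lra.
        -- apply sin_incr_1; lra.
Qed.

Lemma minimizingL_ext (g h : R -> P4) (t : R) : g t = h t -> len I1 I3 g 0 t = len I1 I3 h 0 t ->
  minimizingL p q I1 I3 g t -> minimizingL p q I1 I3 h t.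
Proof. intros E El H k c a b Hc. rewrite <- El. apply (H k c a b). now rewrite E. Qed.

Lemma cut_point_of_geodesic (g : R -> P4) (T : R) : unit_geodesic I1 I3 g -> cutTime p q I1 I3 g T ->
  dL p (g T) \/ (eta < - ((IZR p - 1) / IZR p) /\ Jset p eta (g T)).
Proof.
  intros Hg (HT & HTm & HTn).
  destruct (unit_geodesic_classification I1 I3 eta HI3 HI Heta g Hg) as (s & psi & Hs & E).
  destruct (geod_cut_point s psi Hs) as (T0 & (H0 & H0m & H0n) & Hpt).
  assert (HI1 := I1_pos I1 I3 eta HI3 HI Heta).
  destruct Hg as (HC & _ & _ & Hsp & _).
  assert (El : forall t, 0 <= t -> len I1 I3 g 0 t = len I1 I3 (geod s psi) 0 t).
  { intros t Ht. rewrite (geod_len I1 I3 eta HI3 HI Heta) by auto.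
    apply (unit_speed_len I1 I3 g (velocity g)); auto using C1curve_C1with.
    intros u Hu. apply speed2_of_unit_speed; auto. apply Hsp; lra. }
  (* Minimality up to the cut time and its failure afterwards determine the cut time. *)
  assert (T = T0).
  { destruct (Rtotal_order T T0) as [Hlt|[|Hlt]]; auto; exfalso.
    - apply (HTn T0 Hlt). apply (minimizingL_ext (geod s psi) g); [symmetry; apply E; auto|symmetry; apply El; auto|].
      apply H0m; lra.
    - apply (H0n T Hlt). apply (minimizingL_ext g (geod s psi)); [apply E; auto|apply El; auto|].
      apply HTm; lra. }
  subst T0. rewrite E by auto. exact Hpt.
Qed.

Lemma geod_inCut (s psi T : R) (x : P4) : -1 <= s <= 1 -> cutTime p q I1 I3 (geod s psi) T ->
  sameorbit p q (geod s psi T) x -> inCut p q I1 I3 x.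
Proof.
  intros Hs HT Hx. exists (geod s psi), T.
  split; [exact (geod_unit_geodesic I1 I3 eta HI3 HI Heta s psi Hs)|]. split; auto.
Qed.

Lemma sg_scal (sg s : R) : sg = 1 \/ sg = -1 -> 0 <= s <= 1 ->
  -1 <= sg * s <= 1 /\ sg * (sg * s) = s /\ (sg * s) ^ 2 = s ^ 2.
Proof. intros [->| ->] Hs; repeat split; lra || ring. Qed.

Lemma dL_cut_point (y : P4) : dL p y ->
  exists s psi T, -1 <= s <= 1 /\ cutTime p q I1 I3 (geod s psi) T /\ geod s psi T = y.
Proof.
  intros Hy. assert (Hp2 := IZR_p). assert (Hpp := PI_p). assert (HP := PI_RGT_0).
  destruct (polar_of_dL y Hy) as (sg & rho & Hsg & Hr & E0 & E3 & E12).
  assert (Hr1 : rho <= 1).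
  { assert (A := pow2_ge_0 (qc1 y)). assert (B := pow2_ge_0 (qc2 y)). nra. }
  destruct (Req_dec rho 1) as [->|Hrn].
  (* For [rho = 1] the point has w = 0; the parametrisation of the other case breaks down there,
     because its denominator [S] vanishes at [f = 0]. *)
  - assert (W1 : qc1 y = 0) by (assert (A := pow2_ge_0 (qc1 y)); assert (B := pow2_ge_0 (qc2 y)); nra).
    assert (W2 : qc2 y = 0) by (assert (A := pow2_ge_0 (qc1 y)); assert (B := pow2_ge_0 (qc2 y)); nra).
    destruct (Rle_lt_dec (PI / IZR p) (PI * (1 + eta))) as [Hc|Hc].
    + destruct (sg_scal sg 1 Hsg ltac:(lra)) as (Hs & Hss & Hs2). rewrite Rmult_1_r in Hs, Hss, Hs2.
      assert (Ho := omega_pos I1 I3 eta HI3 HI Heta sg Hs).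
      (* Along the fibre [f0 = tau], so the argument of z is [(1 + eta) tau]. *)
      set (tau := PI / IZR p / (1 + eta)).
      assert (Etau : tau * (1 + eta) = PI / IZR p) by (unfold tau; field; lra).
      assert (Ht0 : 0 < tau) by (unfold tau; apply Rdiv_lt_0_compat; lra).
      assert (Ht1 : tau <= PI) by (apply (Rmult_le_reg_r (1 + eta)); lra).
      set (T := tau / omega sg). assert (ET : omega sg * T = tau) by (unfold T; field; lra).
      exists sg, 0, T. split; auto.
      destruct (cutTime_wall I1 I3 eta HI3 HI Heta p q sg 0 T sg 1 tau) as (H1 & H2 & H3);
        auto; rewrite ?ET, ?Hss; auto; try lra.
      split; auto. apply P4_eq; [lra| | |lra].
      * rewrite W1. unfold geodesic; cbv zeta; cbn [qc1]. rewrite Hs2.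
        replace (1 - 1 ^ 2) with 0 by ring. rewrite sqrt_0; ring.
      * rewrite W2. unfold geodesic; cbv zeta; cbn [qc2]. rewrite Hs2.
        replace (1 - 1 ^ 2) with 0 by ring. rewrite sqrt_0; ring.
    + assert (Hk : 1 + eta < / IZR p) by (apply (Rmult_lt_reg_l PI); auto).
      assert (ip : / IZR p <= / 2) by (apply Rinv_le_contravar; lra).
      assert (He : eta < 0) by lra.
      (* The fibre direction stops too early; the point is reached at [tau = PI] by the geodesic
         with [1 + eta s' = 1 / p]. *)
      set (s' := (1 - / IZR p) / - eta).
      assert (Es' : eta * s' = / IZR p - 1) by (unfold s'; field; lra).
      assert (Hs' : 0 <= s' <= 1).
      { split; [unfold s'; apply Rmult_le_pos; [lra|left; apply Rinv_0_lt_compat; lra]|].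
        apply (Rmult_le_reg_l (- eta)); lra. }
      destruct (sg_scal sg s' Hsg Hs') as (Hs & Hss & Hs2).
      destruct (cutTime_fibre I1 I3 eta HI3 HI Heta p q (sg * s') 0 sg Hp Hs Hsg) as [H1 H2].
      * rewrite Hss; lra.
      * rewrite Hss, Es'. replace (PI * (1 + (/ IZR p - 1))) with (PI / IZR p) by (field; lra). lra.
      * exists (sg * s'), 0, (PI / omega (sg * s')). split; auto. split; auto.
        rewrite H2, Hss, Es'. replace (PI * (1 + (/ IZR p - 1))) with (PI / IZR p) by (field; lra).
        apply P4_eq; cbn [qc0 qc1 qc2 qc3]; lra.
  - (* Solve for the argument [f] of [cos tau + i s sin tau], in terms of which
       [tau] and [s] are explicit. *)
    assert (Hr2 : rho < 1) by lra.
    set (ta := fun f => acos (rho * cos f)).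
    assert (Hb : forall f, -1 < rho * cos f < 1).
    { intros f. assert (C := COS_bound f). nra. }
    set (S := fun f => sqrt (1 - (rho * cos f) ^ 2)).
    assert (HS : forall f, 0 < S f) by (intros f; apply sqrt_lt_R0; assert (H := Hb f); nra).
    assert (HSs : forall f, sin (ta f) = S f).
    { intros f. unfold ta, S. rewrite sin_acos by (assert (H := Hb f); lra). f_equal. unfold Rsqr; ring. }
    assert (Cta : ctn ta).
    { intros f. apply (ex_derive_continuous ta f). eexists. unfold ta.
      apply (der_acos (fun f => rho * cos f)); [|apply Hb]. der_go. }
    assert (CS : ctn S) by (unfold S; cts).
    assert (CSi : ctn (fun f => / S f)).
    { apply ctn_inv; auto. intros f E. assert (H := HS f). lra. }
    (* The argument of z as a function of [f], with [tau = ta f] and [s = rho sin f / sin tau]. It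
       is 0 at 0 and [PI] at [PI], where [sin f] vanishes. *)
    destruct (IVT_ctn (fun f => f + eta * (rho * sin f * / S f) * ta f) 0 PI (PI / IZR p)) as (f0 & Hf & Ef).
    + cts.
    + lra.
    + rewrite sin_0, sin_PI, !Rmult_0_r, !Rmult_0_l, !Rmult_0_r, !Rmult_0_l. lra.
    + set (tau := ta f0) in *. set (s' := rho * sin f0 * / S f0) in *.
      assert (Htb : 0 < tau < PI) by (apply acos_bound_lt, Hb).
      assert (Hct : cos tau = rho * cos f0) by (apply cos_acos; assert (H := Hb f0); lra).
      assert (Hst : sin tau = S f0) by apply HSs.
      assert (HSp := HS f0).
      assert (Hsn : rho * sin f0 = s' * sin tau) by (rewrite Hst; unfold s'; field; lra).
      assert (Hsf : 0 <= sin f0) by (apply sin_ge_0; lra).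
      assert (Hsq : S f0 ^ 2 = 1 - (rho * cos f0) ^ 2).
      { unfold S. apply pow2_sqrt. assert (H := Hb f0). nra. }
      assert (Hcs := cos2_sin2 f0).
      assert (Hs' : 0 <= s' <= 1).
      { split; [unfold s'; apply Rmult_le_pos; [apply Rmult_le_pos; auto|left; now apply Rinv_0_lt_compat]|].
        apply (Rmult_le_reg_r (S f0)); auto. rewrite <- Hst at 1. rewrite <- Hsn, Rmult_1_l.
        assert (Q : (rho * sin f0) ^ 2 <= S f0 ^ 2).
        { rewrite Hsq. replace ((rho * sin f0) ^ 2) with (rho ^ 2 * (cos f0 ^ 2 + sin f0 ^ 2) - (rho * cos f0) ^ 2) by ring.
          rewrite Hcs. nra. }
        assert (0 <= rho * sin f0) by (apply Rmult_le_pos; auto). nra. }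
      destruct (sg_scal sg s' Hsg Hs') as (Hs & Hss & Hs2).
      assert (Ho := omega_pos I1 I3 eta HI3 HI Heta (sg * s') Hs).
      set (T := tau / omega (sg * s')). assert (ET : omega (sg * s') * T = tau) by (unfold T; field; lra).
      destruct (polar (qc1 y) (qc2 y)) as (rr & chi & Hrr & P1 & P2).
      assert (Err : sqrt (1 - s' ^ 2) * sin tau = rr).
      { assert (Hq : sqrt (1 - s' ^ 2) ^ 2 = 1 - s' ^ 2) by (apply pow2_sqrt; nra).
        assert (Hq0 := sqrt_pos (1 - s' ^ 2)).
        assert (Q : (sqrt (1 - s' ^ 2) * sin tau) ^ 2 = rr ^ 2).
        { transitivity (sqrt (1 - s' ^ 2) ^ 2 * sin tau ^ 2); [ring|]. rewrite Hq.
          transitivity (sin tau ^ 2 - (s' * sin tau) ^ 2); [ring|]. rewrite <- Hsn, Hst, Hsq.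
          transitivity (1 - rho ^ 2 * (cos f0 ^ 2 + sin f0 ^ 2)); [ring|]. rewrite Hcs.
          transitivity (rr ^ 2 * (cos chi ^ 2 + sin chi ^ 2)); [|rewrite cos2_sin2; ring].
          transitivity (qc1 y ^ 2 + qc2 y ^ 2); [rewrite E12; ring|]. rewrite <- P1, <- P2. ring. }
        assert (0 <= sqrt (1 - s' ^ 2) * sin tau) by (apply Rmult_le_pos; lra). nra. }
      (* Compensates the phase [- eta s tau] of w, leaving the prescribed phase [chi]. *)
      set (psi := chi + eta * (sg * s') * tau).
      exists (sg * s'), psi, T. split; auto.
      destruct (cutTime_wall I1 I3 eta HI3 HI Heta p q (sg * s') psi T sg rho f0) as (H1 & H2 & H3);
        auto; rewrite ?ET, ?Hss; auto; try lra.
      split; auto. apply P4_eq; [lra| | |lra].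
      * unfold geodesic; cbv zeta; cbn [qc1]. rewrite ET, Hs2, Err, <- P1. unfold psi. do 2 f_equal. ring.
      * unfold geodesic; cbv zeta; cbn [qc2]. rewrite ET, Hs2, Err, <- P2. unfold psi. do 2 f_equal. ring.
Qed.

(** * The arc attached to the wall *)

Section Arc.
Hypothesis He : eta < - ((IZR p - 1) / IZR p).

Lemma arc_bounds : eta < 0 /\ 0 < PI * (1 + eta) < PI / IZR p.
Proof.
  assert (Hp2 := IZR_p). assert (HP := PI_RGT_0).
  replace ((IZR p - 1) / IZR p) with (1 - / IZR p) in He by (field; lra).
  assert (ip : / IZR p <= / 2) by (apply Rinv_le_contravar; lra).
  split; [lra|]. split; [apply Rmult_lt_0_compat; lra|].
  unfold Rdiv. apply Rmult_lt_compat_l; lra.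
Qed.

(** Since [eta < 0], [sin (PI |eta|) = sin (PI (1 + eta))], and both [PI (1 + eta)] and [PI / p] lie
    in the quarter turn where the sine increases. The bounds on [|q3|] become bounds on the
    angle. *)
Lemma Jset_angle (y : P4) : Jset p eta y <->
  exists sg al, (sg = 1 \/ sg = -1) /\ PI * (1 + eta) <= al <= PI / IZR p /\
    y = mkP4 (cos al) 0 0 (sg * sin al).
Proof.
  destruct arc_bounds as [He0 Hb]. assert (Hpp := PI_p). assert (HP := PI_RGT_0).
  assert (Es : sin (PI * Rabs eta) = sin (PI * (1 + eta))).
  { rewrite Rabs_left by lra. rewrite <- (sin_PI_x (PI * (1 + eta))). f_equal. ring. }
  split.
  - intros (HS & H1 & H2 & H0 & H3). rewrite Es in H3. unfold onS3 in HS. rewrite H1, H2 in HS.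
    assert (HS' : qc0 y ^ 2 + qc3 y ^ 2 = 1) by lra.
    destruct (polar_upper (qc0 y) (Rabs (qc3 y)) (Rabs_pos _)) as (r & al & Hr & Hal & A & B).
    assert (Hr1 : r = 1).
    { rewrite <- (pow2_abs (qc3 y)), <- A, <- B in HS'.
      assert (C := cos2_sin2 al). assert (r ^ 2 = 1).
      { rewrite <- HS'. transitivity (r ^ 2 * (cos al ^ 2 + sin al ^ 2)); [rewrite C; ring|ring]. }
      nra. }
    subst r. rewrite Rmult_1_l in A, B.
    assert (Hal2 : al <= PI / 2).
    { destruct (Rle_lt_dec al (PI / 2)) as [|Hlt]; auto. exfalso.
      destruct (Req_dec al PI) as [->|Hn].
      - rewrite cos_PI in A. lra.
      - assert (cos al < 0) by (apply cos_lt_0; lra). lra. }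
    rewrite <- B in H3.
    destruct (Rabs_sign (qc3 y)) as (sg & Hsg & E3). exists sg, al. split; auto. split.
    + split; apply sin_incr_0; lra.
    + apply P4_eq; cbn [qc0 qc1 qc2 qc3]; auto. now rewrite B.
  - intros (sg & al & Hsg & Hal & ->).
    assert (Hsal : 0 <= sin al) by (apply sin_ge_0; lra).
    assert (Hcal : 0 <= cos al) by (apply cos_ge_0; lra).
    assert (Ea := Rabs_sg sg (sin al) Hsg Hsal).
    assert (C := cos2_sin2 al).
    unfold Jset, onS3; cbn [qc0 qc1 qc2 qc3]. rewrite Ea, Es. repeat split; auto.
    + destruct Hsg as [->| ->]; lra.
    + apply sin_incr_1; lra.
    + apply sin_incr_1; lra.
Qed.

Lemma Jset_cut_point (y : P4) : Jset p eta y ->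
  exists s psi T, -1 <= s <= 1 /\ cutTime p q I1 I3 (geod s psi) T /\ geod s psi T = y.
Proof.
  intros Hy. destruct arc_bounds as [He0 Hb]. assert (Hpp := PI_p). assert (HP := PI_RGT_0).
  apply Jset_angle in Hy. destruct Hy as (sg & al & Hsg & Hal & ->).
  (* Solves [PI (1 + eta s') = al]: the geodesic with this parameter returns to the circle w = 0 at
     angle [al] when [tau = PI]. *)
  set (s' := (1 - al / PI) / - eta).
  assert (Es' : PI * (1 + eta * s') = al) by (unfold s'; field; lra).
  assert (Hs' : 0 <= s' <= 1).
  { split.
    - unfold s'. apply Rmult_le_pos; [|left; apply Rinv_0_lt_compat; lra].
      assert (al / PI <= 1); [|lra]. apply (Rmult_le_reg_r PI); auto.
      unfold Rdiv. rewrite Rmult_assoc, Rinv_l by lra. lra.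
    - apply (Rmult_le_reg_l (PI * - eta)); [apply Rmult_lt_0_compat; lra|]. lra. }
  destruct (sg_scal sg s' Hsg Hs') as (Hs & Hss & Hs2).
  destruct (cutTime_fibre I1 I3 eta HI3 HI Heta p q (sg * s') 0 sg Hp Hs Hsg) as [H1 H2];
    rewrite ?Hss, ?Es'; try lra.
  exists (sg * s'), 0, (PI / omega (sg * s')). split; auto. split; auto.
  rewrite H2, Hss, Es'. reflexivity.
Qed.

Lemma act_circle (k : Z) (f : R) :
  act p q k (mkP4 (cos f) 0 0 (sin f)) =
  mkP4 (cos (2 * PI * IZR k / IZR p + f)) 0 0 (sin (2 * PI * IZR k / IZR p + f)).
Proof. rewrite act_torus. apply torus_circle. Qed.

Lemma circle_sameorbit (k : Z) (f f' : R) : f' = 2 * PI * IZR k / IZR p + f ->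
  sameorbit p q (mkP4 (cos f) 0 0 (sin f)) (mkP4 (cos f') 0 0 (sin f')).
Proof. intros ->. exists k. now rewrite act_circle. Qed.

(** Angles of one orbit on the circle w = 0 differ by an integer multiple of [2 PI / p], full turns
    included; a smaller difference is zero. *)
Lemma circle_sameorbit_inv (f f' : R) : Rabs (f' - f) < 2 * PI / IZR p ->
  sameorbit p q (mkP4 (cos f) 0 0 (sin f)) (mkP4 (cos f') 0 0 (sin f')) -> f = f'.
Proof.
  intros Hlt [k E]. rewrite act_circle in E. assert (Hp2 := IZR_p). assert (HP := PI_RGT_0).
  assert (E0 := f_equal qc0 E). assert (E3 := f_equal qc3 E). cbn [qc0 qc3] in E0, E3.
  set (h := 2 * PI * IZR k / IZR p + f) in *.
  assert (C : cos (f' - h) = 1).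
  { rewrite cos_minus, E0, E3. assert (H := cos2_sin2 h). lra. }
  assert (S : sin ((f' - h) / 2) = 0).
  { replace (f' - h) with (2 * ((f' - h) / 2)) in C by field. rewrite cos_2a_sin in C. nra. }
  destruct (sin_eq_0_0 _ S) as [n Hn].
  assert (D : f' - f = 2 * PI / IZR p * IZR (k + n * p)).
  { rewrite plus_IZR, mult_IZR. replace f' with (h + 2 * (IZR n * PI)) by lra. unfold h. field. lra. }
  assert (K : Rabs (IZR (k + n * p)) < 1).
  { assert (P : 0 < 2 * PI / IZR p) by (apply Rdiv_lt_0_compat; lra).
    rewrite D, Rabs_mult, (Rabs_right (2 * PI / IZR p)) in Hlt by lra.
    apply (Rmult_lt_reg_l (2 * PI / IZR p)); lra. }
  rewrite <- abs_IZR in K. apply lt_IZR in K.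
  assert (Z0 : (k + n * p = 0)%Z) by lia. rewrite Z0, Rmult_0_r in D. lra.
Qed.

Lemma sg_circle (sg al : R) : sg = 1 \/ sg = -1 ->
  mkP4 (cos al) 0 0 (sg * sin al) = mkP4 (cos (sg * al)) 0 0 (sin (sg * al)).
Proof.
  intros [->| ->]; [now rewrite !Rmult_1_l|].
  replace (-1 * al) with (- al) by ring. rewrite cos_neg, sin_neg. f_equal. ring.
Qed.

Lemma wall_points_identified :
  sameorbit p q (mkP4 (cos (PI / IZR p)) 0 0 (sin (PI / IZR p)))
                (mkP4 (cos (PI / IZR p)) 0 0 (- sin (PI / IZR p))).
Proof.
  assert (Hp2 := IZR_p). rewrite <- cos_neg at 2. rewrite <- sin_neg.
  apply (circle_sameorbit (-1)). simpl. field. lra.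
Qed.

(** The angle runs from [A = PI (1 + eta)] through [a = PI / p] to [2 a - A]. Beyond [a],
    subtracting the deck rotation [2 a] lands on the component with negative [q3]. The total
    [2 a - 2 A] is less than [2 PI / p], which gives injectivity modulo the action. *)
Lemma arc_parametrization : exists f : R -> P4,
  (forall s, continuous (fun u => qc0 (f u)) s /\ continuous (fun u => qc1 (f u)) s /\
             continuous (fun u => qc2 (f u)) s /\ continuous (fun u => qc3 (f u)) s) /\
  (forall s, 0 <= s <= 1 -> onS3 (f s)) /\
  (forall x, onS3 x ->
     (inPi p q (Jset p eta) x <-> exists s, 0 <= s <= 1 /\ sameorbit p q (f s) x)) /\
  (forall s s', 0 <= s <= 1 -> 0 <= s' <= 1 -> sameorbit p q (f s) (f s') -> s = s').
Proof.
  destruct arc_bounds as [He0 Hb]. assert (Hpp := PI_p). assert (HP := PI_RGT_0). assert (Hp2 := IZR_p).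
  set (A := PI * (1 + eta)) in *. set (a := PI / IZR p) in *.
  set (L := 2 * a - 2 * A). assert (HL : 0 < L) by (unfold L; lra).
  set (an := fun u => A + u * L).
  exists (fun u => mkP4 (cos (an u)) 0 0 (sin (an u))).
  split; [|split; [|split]].
  - assert (Can : ctn an) by (unfold an; cts).
    intros s. cbn [qc0 qc1 qc2 qc3].
    assert (C0 : ctn (fun u => cos (an u))) by cts. assert (C3 : ctn (fun u => sin (an u))) by cts.
    repeat split; try apply continuous_const; auto.
  - intros s _. unfold onS3; cbn [qc0 qc1 qc2 qc3]. assert (C := cos2_sin2 (an s)). lra.
  - intros x _. split.
    + intros (y & Hy & Hx). apply Jset_angle in Hy. destruct Hy as (sg & al & Hsg & Hal & ->).
      fold A a in Hal. rewrite sg_circle in Hx by auto.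
      destruct Hsg as [->| ->].
      * rewrite Rmult_1_l in Hx. exists ((al - A) / L).
        assert (Ean : an ((al - A) / L) = al) by (unfold an; field; lra). rewrite Ean. split; auto.
        split.
        -- apply Rmult_le_pos; [lra|left; now apply Rinv_0_lt_compat].
        -- apply (Rmult_le_reg_r L); auto. unfold Rdiv. rewrite Rmult_assoc, Rinv_l by lra. unfold L; lra.
      * exists ((2 * a - al - A) / L).
        assert (Ean : an ((2 * a - al - A) / L) = 2 * a - al) by (unfold an; field; lra). rewrite Ean. split.
        -- split.
           ++ apply Rmult_le_pos; [lra|left; now apply Rinv_0_lt_compat].
           ++ apply (Rmult_le_reg_r L); auto. unfold Rdiv. rewrite Rmult_assoc, Rinv_l by lra. unfold L; lra.
        -- refine (sameorbit_trans _ _ _ _ _ _ Hx). apply (circle_sameorbit (-1)).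
           unfold a; simpl; field; lra.
    + intros (s & Hs & Hx).
      assert (B0 : 0 <= s * L) by (apply Rmult_le_pos; lra).
      assert (B1 : s * L <= 1 * L) by (apply Rmult_le_compat_r; lra).
      destruct (Rle_lt_dec (an s) a) as [Hle|Hgt].
      * exists (mkP4 (cos (an s)) 0 0 (sin (an s))). split; auto. apply Jset_angle.
        exists 1, (an s). rewrite Rmult_1_l. fold A a. repeat split; auto; unfold an; lra.
      * exists (mkP4 (cos (2 * a - an s)) 0 0 (-1 * sin (2 * a - an s))). split.
        -- apply Jset_angle. exists (-1), (2 * a - an s). fold A a. repeat split; auto; unfold an, L in *; lra.
        -- rewrite sg_circle by auto. refine (sameorbit_trans _ _ _ _ _ _ Hx).
           apply (circle_sameorbit 1). unfold a; simpl; field; lra.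
  - intros s s' Hs Hs' H. apply circle_sameorbit_inv in H.
    + unfold an in H. apply (Rmult_eq_reg_r L); lra.
    + replace (2 * PI / IZR p) with (2 * a) by (unfold a; field; lra).
      apply Rabs_def1; unfold an, L; nra.
Qed.

Lemma torus_w0 (a b : R) (x : P4) :
  qc1 (torus a b x) = 0 /\ qc2 (torus a b x) = 0 <-> qc1 x = 0 /\ qc2 x = 0.
Proof.
  unfold torus; cbn [qc1 qc2]. split.
  - intros [H1 H2]. assert (E : qc1 x ^ 2 + qc2 x ^ 2 = 0).
    { transitivity ((cos b ^ 2 + sin b ^ 2) * (qc1 x ^ 2 + qc2 x ^ 2)); [rewrite cos2_sin2; ring|].
      transitivity ((cos b * qc1 x - sin b * qc2 x) ^ 2 + (sin b * qc1 x + cos b * qc2 x) ^ 2); [ring|].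
      rewrite H1, H2; ring. }
    split; nra.
  - intros [-> ->]; split; ring.
Qed.

(** Points of the arc have w = 0 and the action preserves this. On the wall it forces [rho = 1],
    which leaves only the two identified endpoints. *)
Lemma wall_meets_arc (x : P4) :
  inPi p q (dL p) x /\ inPi p q (Jset p eta) x <->
  sameorbit p q (mkP4 (cos (PI / IZR p)) 0 0 (sin (PI / IZR p))) x.
Proof.
  destruct arc_bounds as [He0 Hb]. assert (Hpp := PI_p). assert (HP := PI_RGT_0).
  split.
  - intros [(y & Hy & Hyx) (y' & Hy' & Hyx')].
    apply Jset_angle in Hy'. destruct Hy' as (sg' & al & _ & _ & Ey').
    assert (Hw : qc1 y = 0 /\ qc2 y = 0).
    { destruct Hyx as [k E], Hyx' as [k' E']. rewrite act_torus in E, E'.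
      apply (torus_w0 (2 * PI * IZR k / IZR p) (2 * PI * IZR (k * q) / IZR p)).
      rewrite <- E, E'. apply torus_w0. rewrite Ey'; auto. }
    destruct (polar_of_dL y Hy) as (sg & rho & Hsg & Hr & E0 & E3 & E12).
    destruct Hw as [W1 W2]. rewrite W1, W2 in E12. assert (rho = 1) by nra. subst rho.
    rewrite !Rmult_1_l in *. destruct y as [y0 y1 y2 y3]; cbn [qc0 qc1 qc2 qc3] in *. subst.
    destruct Hsg as [->| ->].
    + rewrite Rmult_1_l in Hyx. exact Hyx.
    + replace (-1 * sin (PI / IZR p)) with (- sin (PI / IZR p)) in Hyx by ring.
      exact (sameorbit_trans _ _ _ _ _ wall_points_identified Hyx).
  - intros Hx. split.
    + eexists; split; [|exact Hx]. apply (dL_of_polar _ 1 1); cbn [qc0 qc3]; auto; try lra.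
      unfold onS3; cbn [qc0 qc1 qc2 qc3]. assert (C := cos2_sin2 (PI / IZR p)). lra.
    + eexists; split; [|exact Hx]. apply Jset_angle. exists 1, (PI / IZR p).
      rewrite Rmult_1_l. repeat split; auto; lra.
Qed.

End Arc.

Lemma inCut_dL (x : P4) : inPi p q (dL p) x -> inCut p q I1 I3 x.
Proof.
  intros (y & Hy & Hx). destruct (dL_cut_point y Hy) as (s & psi & T & Hs & HT & <-).
  now apply (geod_inCut s psi T).
Qed.

Lemma inCut_Jset (x : P4) : eta < - ((IZR p - 1) / IZR p) ->
  inPi p q (Jset p eta) x -> inCut p q I1 I3 x.
Proof.
  intros He (y & Hy & Hx). destruct (Jset_cut_point He y Hy) as (s & psi & T & Hs & HT & <-).
  now apply (geod_inCut s psi T).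
Qed.

Lemma inCut_cases (x : P4) : inCut p q I1 I3 x ->
  inPi p q (dL p) x \/ (eta < - ((IZR p - 1) / IZR p) /\ inPi p q (Jset p eta) x).
Proof.
  intros (g & T & Hg & HT & Hx). destruct (cut_point_of_geodesic g T Hg HT) as [H|[He H]].
  - left. exists (g T); auto.
  - right. split; auto. exists (g T); auto.
Qed.

End CutLocus.

Theorem mainTheorem9 (p q : Z) (I1 I3 : R) :
  (2 <= p)%Z -> Z.gcd p q = 1%Z -> 0 < I1 -> 0 < I3 ->
  let eta := I1 / I3 - 1 in
  let pr := IZR p in
  (eta >= - ((pr - 1) / pr) ->
     forall x, onS3 x -> (inCut p q I1 I3 x <-> inPi p q (dL p) x)) /\
  (-1 < eta < - ((pr - 1) / pr) ->
     (forall x, onS3 x ->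
        (inCut p q I1 I3 x <-> inPi p q (dL p) x \/ inPi p q (Jset p eta) x)) /\
     sameorbit p q (mkP4 (cos (PI / pr)) 0 0 (sin (PI / pr)))
                   (mkP4 (cos (PI / pr)) 0 0 (- sin (PI / pr))) /\
     (exists f : R -> P4,
        (forall s, continuous (fun u => qc0 (f u)) s /\ continuous (fun u => qc1 (f u)) s /\
                   continuous (fun u => qc2 (f u)) s /\ continuous (fun u => qc3 (f u)) s) /\
        (forall s, 0 <= s <= 1 -> onS3 (f s)) /\
        (forall x, onS3 x ->
           (inPi p q (Jset p eta) x <-> exists s, 0 <= s <= 1 /\ sameorbit p q (f s) x)) /\
        (forall s s', 0 <= s <= 1 -> 0 <= s' <= 1 ->
           sameorbit p q (f s) (f s') -> s = s')) /\
     (forall x, onS3 x ->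
        (inPi p q (dL p) x /\ inPi p q (Jset p eta) x <->
         sameorbit p q (mkP4 (cos (PI / pr)) 0 0 (sin (PI / pr))) x))).
Proof.
  intros Hp _ HI1 HI3 eta pr.
  assert (HI : I1 = I3 * (1 + eta)) by (unfold eta; field; lra).
  assert (Heta : -1 < eta).
  { unfold eta. assert (0 < I1 / I3) by (apply Rdiv_lt_0_compat; auto). lra. }
  split.
  - intros Hge x _. split.
    + intros Hx. destruct (inCut_cases p q I1 I3 eta Hp HI3 HI Heta x Hx) as [|[Hlt _]]; auto.
      unfold pr in Hge. lra.
    + now apply (inCut_dL p q I1 I3 eta).
  - intros [_ Hlt]. split; [|split; [|split]].
    + intros x _. split.
      * intros Hx. destruct (inCut_cases p q I1 I3 eta Hp HI3 HI Heta x Hx) as [|[_ H]]; auto.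
      * intros [Hx|Hx]; [now apply (inCut_dL p q I1 I3 eta)|now apply (inCut_Jset p q I1 I3 eta)].
    + now apply wall_points_identified.
    + now apply arc_parametrization.
    + intros x _. now apply wall_meets_arc.
Qed.
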